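(* (The $d''_A$-Poincaré Lemma) Let $(A,B)$ be a minimally foliated Lie algebroid over a foliated manifold $(M,\mathcal{F})$. For any local $A$-form $\lambda$ of type $(u,v)$ with $v>0$ such that $d''_A\lambda=0$, one has (locally) $\lambda=d''_A\mu$, where $\mu$ is a local $A$-form of type $(u,v-1)$.
   Context: All objects are $C^\infty$; $T\mathcal{F}$ is the tangent bundle of the leaves of $\mathcal{F}$. A foliated Lie algebroid $(A,B)$ over $(M,\mathcal{F})$: $A$ is a Lie algebroid on $M$ (anchor $\sharp_A$, bracket $[\,,\,]_A$), $B\subseteq A$ a Lie subalgebroid over $M$, $\sharp_A(B)=T\mathcal{F}$, and locally $\Gamma A$ is spanned over $C^\infty$ functions by $B$-foliated sections, i.e. sections $a$ with $[b,a]_A\in\Gamma B$ for all $b\in\Gamma B$. It is minimally foliated if $\sharp_A:B\to T\mathcal{F}$ is a vector bundle isomorphism. $A$-forms are sections of $\wedge A^*$, with the usual Lie algebroid differential $d_A$. Fix a decomposition $A=B\oplus C$. An $A$-form is of type $(s,r)$ if it is a section of $\wedge^sC^*\otimes\wedge^rB^*$ (where $C^*\cong\mathrm{ann}\,B$ and $B^*\cong\mathrm{ann}\,C$), and $\Omega^{s,r}(A)$ denotes the space of such forms. Since $B$ is closed under brackets, $d_A=d'_A+d''_A+\partial_A$ with terms of types $(1,0)$, $(0,1)$, $(2,-1)$; so for $\lambda$ of type $(s,r)$, $d''_A\lambda$ is the component of type $(s,r+1)$ of $d_A\lambda$. ''Local'' means on an open neighborhood of a given point, which may be shrunk. *)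

(* Defs.v *)
From HB Require Import structures.
From mathcomp Require Import all_boot all_order all_algebra.
From mathcomp Require Import all_classical all_reals all_analysis.

Set Implicit Arguments.
Unset Strict Implicit.
Unset Printing Implicit Defensive.

Import Order.TTheory GRing.Theory Num.Theory.
Import numFieldNormedType.Exports.

Local Open Scope classical_set_scope.
Local Open Scope ring_scope.

(** ** Smooth functions on open subsets of R^n *)

Definition basis_vec (R : realType) (n : nat) (i : 'I_n) : 'rV[R]_n :=
  delta_mx 0 i.

Fixpoint iter_partial (R : realType) (n : nat) (s : seq 'I_n)
    (f : 'rV[R]_n -> R) : 'rV[R]_n -> R :=
  if s is i :: s' then fun z => 'D_(basis_vec R i) (iter_partial s' f) z
  else f.

(* C^infinity on the open set W: all iterated partial derivatives exist and
   are continuous at the points of W.  The values of f outside W are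
   irrelevant. *)
Definition smooth_eucl (R : realType) (n : nat) (W : set 'rV[R]_n)
    (f : 'rV[R]_n -> R) : Prop :=
  forall (s : seq 'I_n) (z : 'rV[R]_n), W z ->
    {for z, continuous (iter_partial s f)} /\
    forall i : 'I_n, derivable (iter_partial s f) z (basis_vec R i).

(** ** Smooth manifolds *)

(* Charts are pairs of mutually inverse homeomorphisms between an open subset
   of T and an open subset of R^n, extended by junk to total functions. *)
Record chart (R : realType) (T : topologicalType) (n : nat) := Chart {
  cdom : set T;
  ccod : set 'rV[R]_n;
  cmap : T -> 'rV[R]_n;
  cinv : 'rV[R]_n -> T;
  cdom_open : open cdom;
  ccod_open : open ccod;
  cmap_cod : forall x, cdom x -> ccod (cmap x);
  cinv_dom : forall z, ccod z -> cdom (cinv z);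
  cmapK : forall x, cdom x -> cinv (cmap x) = x;
  cinvK : forall z, ccod z -> cmap (cinv z) = z;
  cmap_cont : forall x, cdom x -> {for x, continuous cmap};
  cinv_cont : forall z, ccod z -> {for z, continuous cinv} }.

(* The image in R^n of the overlap of the domains of c and d. *)
Definition overlap (R : realType) (T : topologicalType) (n : nat)
    (c d : chart R T n) : set 'rV[R]_n :=
  [set z | ccod c z /\ cdom d (cinv c z)].

Definition smooth_transition (R : realType) (T : topologicalType) (n : nat)
    (c d : chart R T n) : Prop :=
  forall j : 'I_n,
    smooth_eucl (overlap c d) (fun z => cmap d (cinv c z) 0 j).

Record manifold (R : realType) (n : nat) := Manifold {
  mpoint :> topologicalType;
  mhausdorff : hausdorff_space mpoint;
  msecond : @second_countable mpoint;
  atlas : set (chart R mpoint n);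
  chart_at : mpoint -> chart R mpoint n;
  chart_at_atlas : forall x, atlas (chart_at x);
  chart_at_dom : forall x, cdom (chart_at x) x;
  atlas_smooth : forall c d, atlas c -> atlas d -> smooth_transition c d }.

Definition smooth_fun (R : realType) (n : nat) (M : manifold R n)
    (U : set M) (f : M -> R) : Prop :=
  forall c, atlas c ->
    smooth_eucl [set z | ccod c z /\ U (cinv c z)] (fun z => f (cinv c z)).

(* A tangent vector at x is represented by its components in the
   distinguished chart [chart_at x]; this does not make vector fields trivial,
   since [chart_at x] jumps with x: smoothness is expressed by
   [smooth_vfield] below. *)
Definition tangent (R : realType) (n : nat) (M : manifold R n) (x : M) :=
  'rV[R]_n.

(* The derivative v(f) of a function f along the tangent vector v at x. *)
Definition tder (R : realType) (n : nat) (M : manifold R n) (x : M)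
    (v : tangent x) (f : M -> R) : R :=
  'D_(v : 'rV[R]_n) (fun z => f (cinv (chart_at x) z)) (cmap (chart_at x) x).

(* The components v(c^j) of v in an arbitrary chart c. *)
Definition tcomp (R : realType) (n : nat) (M : manifold R n) (x : M)
    (v : tangent x) (c : chart R M n) (j : 'I_n) : R :=
  tder v (fun y => cmap c y 0 j).

Definition smooth_vfield (R : realType) (n : nat) (M : manifold R n)
    (U : set M) (X : forall x : M, tangent x) : Prop :=
  forall c, atlas c -> forall j : 'I_n,
    smooth_fun (U `&` cdom c) (fun x => tcomp (X x) c j).

(** ** Foliations *)

(* Foliated charts have values in R^p x R^q: the first p coordinates are
   leafwise and the last q are transverse, the plaques being the slices on
   which the transverse coordinates are constant.  In a change of foliated
   charts the new transverse coordinates are locally functions of the old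
   transverse coordinates alone. *)
Definition foliated_transition (R : realType) (T : topologicalType)
    (p q : nat) (c d : chart R T (p + q)) : Prop :=
  forall z, overlap c d z -> exists W, [/\ nbhs z W, W `<=` overlap c d &
    forall z1 z2, W z1 -> W z2 -> rsubmx z1 = rsubmx z2 ->
      rsubmx (cmap d (cinv c z1)) = rsubmx (cmap d (cinv c z2))].

Record foliation (R : realType) (p q : nat) (M : manifold R (p + q)) :=
  Foliation {
  fcharts : set (chart R M (p + q));
  fcharts_smooth : forall c d, fcharts c -> atlas d ->
    smooth_transition c d /\ smooth_transition d c;
  fcharts_cover : forall x : M, exists2 c, fcharts c & cdom c x;
  fcharts_foliated : forall c d, fcharts c -> fcharts d ->
    foliated_transition c d }.

(* The tangent space at x of the leaf through x. *)
Definition leaf_tangent (R : realType) (p q : nat) (M : manifold R (p + q))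
    (F : foliation M) (x : M) : set (tangent x) :=
  [set v | forall c, fcharts F c -> cdom c x ->
             forall j : 'I_q, tcomp v c (rshift p j) = 0].

(** ** Vector bundles *)

(* A vector bundle of rank m: a family of vector spaces with an atlas of local
   frames, related by smooth transition matrices. *)
Record vbundle (R : realType) (n : nat) (M : manifold R n) (m : nat) :=
  Vbundle {
  fiber :> M -> vectType R;
  frames : set (set M * ('I_m -> forall x : M, fiber x));
  frames_open : forall e, frames e -> open e.1;
  frames_basis : forall e, frames e -> forall x, e.1 x ->
    basis_of fullv [tuple e.2 i x | i < m];
  frames_cover : forall x : M, exists2 e, frames e & e.1 x;
  frames_smooth : forall e e', frames e -> frames e' -> forall i j : 'I_m,
    smooth_fun (e.1 `&` e'.1)
      (fun x => coord [tuple e'.2 l x | l < m] j (e.2 i x)) }.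

Definition section (R : realType) (n : nat) (M : manifold R n) (m : nat)
    (E : vbundle M m) := forall x : M, E x.

(* s restricts to a smooth section of E over the open set U. *)
Definition smooth_section (R : realType) (n : nat) (M : manifold R n)
    (m : nat) (E : vbundle M m) (U : set M) (s : section E) : Prop :=
  forall e, frames e -> forall i : 'I_m,
    smooth_fun (U `&` e.1) (fun x => coord [tuple e.2 l x | l < m] i (s x)).

Definition subbundle (R : realType) (n : nat) (M : manifold R n) (m : nat)
    (E : vbundle M m) (B : forall x : M, {vspace E x}) : Prop :=
  forall x0 : M, exists (U : set M) (r : nat) (e : 'I_r -> section E),
    [/\ open U, U x0, forall i, smooth_section U (e i) &
        forall x, U x -> basis_of (B x) [tuple e i x | i < r]].

(* Gamma B, as a set of sections of E. *)
Definition sub_section (R : realType) (n : nat) (M : manifold R n) (m : nat)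
    (E : vbundle M m) (B : forall x : M, {vspace E x}) : set (section E) :=
  [set s | smooth_section setT s /\ forall x, s x \in B x].

(** ** Lie algebroids *)

(* The bracket is an operation on Gamma A; its values on sections which are
   not smooth are irrelevant. *)
Record lie_algebroid (R : realType) (n : nat) (M : manifold R n) (m : nat) :=
  LieAlgebroid {
  la_bundle :> vbundle M m;
  anchor : forall x : M, 'Hom(la_bundle x, 'rV[R]_n);
  bracket : section la_bundle -> section la_bundle -> section la_bundle;
  anchor_smooth : forall (U : set M) (a : section la_bundle),
    open U -> smooth_section U a ->
    smooth_vfield U (fun x => anchor x (a x) : tangent x);
  bracket_smooth : forall a b : section la_bundle,
    smooth_section setT a -> smooth_section setT b ->
    smooth_section setT (bracket a b);
  bracket_linear : forall (t : R) (a b c : section la_bundle),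
    smooth_section setT a -> smooth_section setT b ->
    smooth_section setT c -> forall x,
    bracket (fun y => t *: a y + b y) c x =
      t *: bracket a c x + bracket b c x;
  bracket_antisym : forall a b : section la_bundle,
    smooth_section setT a -> smooth_section setT b -> forall x,
    bracket a b x = - bracket b a x;
  bracket_jacobi : forall a b c : section la_bundle,
    smooth_section setT a -> smooth_section setT b ->
    smooth_section setT c -> forall x,
    bracket a (bracket b c) x + bracket b (bracket c a) x
      + bracket c (bracket a b) x = 0;
  bracket_leibniz : forall (f : M -> R) (a b : section la_bundle),
    smooth_fun setT f -> smooth_section setT a -> smooth_section setT b ->
    forall x, bracket a (fun y => f y *: b y) x =
      f x *: bracket a b x + tder (anchor x (a x) : tangent x) f *: b x;
  anchor_bracket : forall (U : set M) (f : M -> R) (a b : section la_bundle),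
    open U -> smooth_fun U f ->
    smooth_section setT a -> smooth_section setT b -> forall x, U x ->
    tder (anchor x (bracket a b x) : tangent x) f =
      tder (anchor x (a x) : tangent x)
        (fun y => tder (anchor y (b y) : tangent y) f) -
      tder (anchor x (b x) : tangent x)
        (fun y => tder (anchor y (a y) : tangent y) f) }.

Definition anchor_der (R : realType) (n : nat) (M : manifold R n) (m : nat)
    (A : lie_algebroid M m) (a : section A) (f : M -> R) : M -> R :=
  fun x => tder (anchor A x (a x) : tangent x) f.

Definition lie_subalgebroid (R : realType) (n : nat) (M : manifold R n)
    (m : nat) (A : lie_algebroid M m) (B : forall x : M, {vspace A x}) :
    Prop :=
  subbundle B /\
  forall a b, sub_section B a -> sub_section B b -> sub_section B (bracket a b).

(* a is a B-foliated section of A over U.  The bracket of A is a local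
   operation, so the bracket of local sections is computed at x by means of
   sections over M having the same germs at x; here the germs at x of local
   sections of B are those of sections in Gamma B. *)
Definition foliated_section (R : realType) (n : nat) (M : manifold R n)
    (m : nat) (A : lie_algebroid M m) (B : forall x : M, {vspace A x})
    (U : set M) (a : section A) : Prop :=
  smooth_section U a /\
  forall x, U x -> forall a' b : section A,
    smooth_section setT a' -> (\forall y \near x, a' y = a y) ->
    sub_section B b -> bracket b a' x \in B x.

Record foliated_lie_algebroid (R : realType) (p q : nat)
    (M : manifold R (p + q)) (F : foliation M) (m : nat)
    (A : lie_algebroid M m) (B : forall x : M, {vspace A x}) : Prop := {
  fla_subalgebroid : lie_subalgebroid B;
  fla_anchor : forall x : M,
    [set anchor A x b | b in [set b | b \in B x]] = leaf_tangent F (x := x);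
  fla_spanned : forall x0 : M, exists U : set M, [/\ open U, U x0 &
    forall s : section A, smooth_section U s ->
      exists (N : nat) (f : 'I_N -> M -> R) (a : 'I_N -> section A),
        [/\ forall i, smooth_fun U (f i),
            forall i, foliated_section B U (a i) &
            forall x, U x -> s x = \sum_(i < N) f i x *: a i x]] }.

(* Since the anchor maps B smoothly onto TF, it is a vector bundle isomorphism
   B -> TF if and only if it is injective on the fibers of B. *)
Record minimally_foliated (R : realType) (p q : nat)
    (M : manifold R (p + q)) (F : foliation M) (m : nat)
    (A : lie_algebroid M m) (B : forall x : M, {vspace A x}) : Prop := {
  mfla_foliated : foliated_lie_algebroid F B;
  mfla_iso : forall x : M, {in B x &, injective (anchor A x)} }.

(* E = B (+) C *)
Definition bundle_decomposition (R : realType) (n : nat) (M : manifold R n)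
    (m : nat) (E : vbundle M m) (B C : forall x : M, {vspace E x}) : Prop :=
  [/\ subbundle B, subbundle C &
      forall x, (B x + C x)%VS = fullv /\ (B x :&: C x)%VS = 0%VS].

(** ** A-forms *)

Definition aform (R : realType) (n : nat) (M : manifold R n) (m : nat)
    (E : vbundle M m) (k : nat) := forall x : M, ('I_k -> E x) -> R.

Definition set_arg (T : Type) (k : nat) (v : 'I_k -> T) (i : 'I_k) (w : T) :
    'I_k -> T :=
  fun j => if j == i then w else v j.

Definition alternating_form (R : realType) (V : lmodType R) (k : nat)
    (w : ('I_k -> V) -> R) : Prop :=
  (forall (v : 'I_k -> V) (i : 'I_k) (t : R) (a b : V),
     w (set_arg v i (t *: a + b)) = t * w (set_arg v i a) + w (set_arg v i b))
  /\
  (forall (v : 'I_k -> V) (i j : 'I_k), i != j -> v i = v j -> w v = 0).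

(* The smooth sections of the k-th exterior power of E^* over the open set
   U. *)
Definition aform_on (R : realType) (n : nat) (M : manifold R n) (m : nat)
    (E : vbundle M m) (k : nat) (U : set M) (w : aform E k) : Prop :=
  (forall x, U x -> alternating_form (w x)) /\
  (forall (V : set M) (a : 'I_k -> section E), open V -> V `<=` U ->
     (forall i, smooth_section V (a i)) ->
     smooth_fun V (fun x => w x (fun i => a i x))).

(* w is a linear combination of exterior products of s covectors in ann B
   and r covectors in ann C, the exterior product of covectors g_1, .., g_k
   being the form (v_1, .., v_k) |-> det (g_i (v_j)). *)
Definition bigraded_form (R : realType) (V : vectType R) (B C : {vspace V})
    (s r k : nat) (w : ('I_k -> V) -> R) : Prop :=
  k = (s + r)%N /\
  exists (N : nat) (t : 'I_N -> R) (g : 'I_N -> 'I_k -> 'Hom(V, R^o)),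
    [/\ forall l (i : 'I_k), (i < s)%N -> forall v, v \in B -> g l i v = 0,
        forall l (i : 'I_k), (s <= i)%N -> forall v, v \in C -> g l i v = 0 &
        forall v : 'I_k -> V,
          w v = \sum_(l < N) t l * \det (\matrix_(i < k, j < k) g l i (v j))].

Definition aform_of_type (R : realType) (n : nat) (M : manifold R n)
    (m : nat) (E : vbundle M m) (B C : forall x : M, {vspace E x})
    (s r k : nat) (U : set M) (w : aform E k) : Prop :=
  aform_on U w /\ forall x, U x -> bigraded_form (B x) (C x) s r (w x).

(* For i < j: the bracket of a_i and a_j, followed by the list a without its
   entries i and j. *)
Definition bracket_args (R : realType) (n : nat) (M : manifold R n) (m : nat)
    (A : lie_algebroid M m) (k : nat) (a : 'I_k.+1 -> section A)
    (i j : 'I_k.+1) : 'I_k -> section A :=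
  fun l => if l == 0%N :> nat then bracket (a i) (a j)
           else a (inord (bump j (bump i l.-1))).

(* The form w as an operator on k-tuples of sections. *)
Definition eval_form (R : realType) (n : nat) (M : manifold R n) (m : nat)
    (E : vbundle M m) (k : nat) (w : aform E k) (a : 'I_k -> section E) :
    M -> R :=
  fun x => w x (fun i => a i x).

(* (d_A w)(a_0, .., a_k) for a_0, .., a_k in Gamma A.  Its value at x only
   depends on w near x, so that d_A applies to local forms. *)
Definition dA (R : realType) (n : nat) (M : manifold R n) (m : nat)
    (A : lie_algebroid M m) (k : nat) (w : aform A k)
    (a : 'I_k.+1 -> section A) : M -> R :=
  fun x =>
    \sum_(i < k.+1) (-1) ^+ i *
      anchor_der (a i) (eval_form w (fun l => a (lift i l))) x +
    \sum_(i < k.+1) \sum_(j < k.+1 | (i < j)%N) (-1) ^+ (i + j) *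
      eval_form w (bracket_args a i j) x.

(* The projections of A onto C along B (for b = true) and onto B along C. *)
Definition proj_section (R : realType) (n : nat) (M : manifold R n) (m : nat)
    (E : vbundle M m) (B C : forall x : M, {vspace E x}) (b : bool)
    (a : section E) : section E :=
  fun x => if b then daddv_pi (C x) (B x) (a x) else daddv_pi (B x) (C x) (a x).

(* The component of type (s, k - s) of a form given as an operator on
   sections: the sum of those terms of the multilinear expansion of
   w (b_1 + c_1, .., b_k + c_k) in which exactly s arguments are in C. *)
Definition type_component (R : realType) (n : nat) (M : manifold R n)
    (m : nat) (E : vbundle M m) (B C : forall x : M, {vspace E x}) (s k : nat)
    (w : ('I_k -> section E) -> M -> R) (a : 'I_k -> section E) : M -> R :=
  fun x => \sum_(S : {set 'I_k} | #|S| == s)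
    w (fun i => proj_section B C (i \in S) (a i)) x.

(* d''_A w for w of type (s, r): the component of type (s, r + 1) of d_A w. *)
Definition d2A (R : realType) (n : nat) (M : manifold R n) (m : nat)
    (A : lie_algebroid M m) (B C : forall x : M, {vspace A x}) (s k : nat)
    (w : aform A k) : ('I_k.+1 -> section A) -> M -> R :=
  type_component B C s (dA w).

(* Equality over U of two A-forms given as operators on sections. *)
Definition eq_forms_on (R : realType) (n : nat) (M : manifold R n) (m : nat)
    (E : vbundle M m) (k : nat) (U : set M)
    (w w' : ('I_k -> section E) -> M -> R) : Prop :=
  forall a : 'I_k -> section E, (forall i, smooth_section setT (a i)) ->
    forall x, U x -> w a x = w' a x.

(* Main.v *)
From HB Require Import structures.
Require Import Defs.
From mathcomp Require Import all_boot all_order all_algebra fingroup perm.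
From mathcomp Require Import all_classical all_reals all_analysis.
From mathcomp Require Import ring lra zify.
Set Implicit Arguments.
Unset Strict Implicit.
Unset Printing Implicit Defensive.
Import Order.TTheory GRing.Theory Num.Theory.
Import numFieldNormedType.Exports.
Local Open Scope classical_set_scope.
Local Open Scope ring_scope.

(** Take a foliated chart around the point, with leafwise coordinates of index
    less than p. As the anchor identifies B with the tangent bundle of the
    leaves, the leafwise coordinate vector fields lift to sections of B; these
    lifts commute, because their brackets lie in B and have anchor 0. Locally A
    is spanned by B-foliated sections, and so C has local bases whose brackets
    with sections of B stay in B. Together these form an adapted frame
    ([adapted_frame_exists]).

    A form of type (u, r) vanishes on frame sections unless exactly u of them
    are in C. In the formula for the differential on frame sections of which u
    are in C, a bracket always costs one argument in C; hence the bracket terms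
    vanish, and so do the anchor terms that differentiate along C
    ([frame_bracket_vanish], [dA_frame]). In terms of components, d''_A is thus
    the exterior derivative along the slices of the chart, the transverse
    indices and the transverse coordinates being parameters.

    What remains is the Poincare lemma with parameters, with the usual homotopy
    operator: contract with the Euler field of the slice and average over the
    homotheties of ratio t in [0, 1], with a weight t ^ r
    ([homotopy_op]). The homotopy formula [flat_homotopy] is the identity of
    [leaf_mean_euler], which is the fundamental theorem of calculus in t, and
    differentiation under the integral gives smoothness in all coordinates.

    The components obtained in this way are antisymmetric and vanish for tuples
    of the wrong type, and thus define a form of type (u, v - 1)
    ([primitive_form_type]). Its differential is given as an operator on
    sections over M, whereas the computation takes place on tuples of frame
    sections. The passage between the two is tensoriality: the operator is linear
    over functions ([tensorial_dA]), hence determined at a point by its values on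
    a frame ([tensorial_frame_eq]). The frame sections have to be defined on all
    of M for their brackets to make sense, which is why bump functions are
    constructed. *)

(** * Smooth functions on open subsets of R^n *)

Section DirectionalDerivative.
Variables (R : realType) (V : normedModType R).

Lemma line_is_derive (f : V -> R) (a e : V) (s : R) :
  derivable f (s *: e + a) e ->
  is_derive s 1 (fun h : R => f (h *: e + a)) ('D_e f (s *: e + a)).
Proof.
move=> df.
have E : (fun h : R => h^-1 *: (((fun h : R => f (h *: e + a)) \o shift s) (h *: 1)
    - f (s *: e + a))) =
   (fun h : R => h^-1 *: ((f \o shift (s *: e + a)) (h *: e) - f (s *: e + a))).
  by apply/funext => h /=; rewrite [h *: 1]mulr1 scalerDl addrA.
by apply: DeriveDef; rewrite /derivable /derive E.
Qed.

(** A parameter t of either sign is allowed, because the increments of a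
    coordinate have no definite sign. *)
Lemma mean_value_line (f : V -> R) (a e : V) (t : R) :
  (forall s : R, `|s| <= `|t| -> derivable f (s *: e + a) e) ->
  exists2 s : R, `|s| <= `|t| & f (t *: e + a) - f a = t * 'D_e f (s *: e + a).
Proof.
move=> df; pose g (h : R) := f (h *: e + a).
have dg (s : R) : `|s| <= `|t| -> is_derive s 1 g ('D_e f (s *: e + a)).
  by move=> /df; exact: line_is_derive.
have g0 : g 0 = f a by rewrite /g scale0r add0r.
have [t0|t0] := leP 0 t.
- have I s : s \in `[0, t] -> `|s| <= `|t|.
    by rewrite in_itv /= => /andP[s0 st]; rewrite !ger0_norm.
  have [||c cI E] := @MVT_segment R g (fun s => 'D_e f (s *: e + a)) 0 t t0.
  + by move=> x /subset_itv_oo_cc /I; exact: dg.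
  + apply: derivable_within_continuous => x /I /dg dx; exact: (@ex_derive _ _ _ _ _ _ _ dx).
  + by exists c; [exact: I|rewrite -g0 -/(g t) E subr0 mulrC].
- have I s : s \in `[t, 0] -> `|s| <= `|t|.
    rewrite in_itv /= => /andP[s0 st]; rewrite !ler0_norm ?lerN2 //.
    exact: ltW.
  have [||c cI E] := @MVT_segment R g (fun s => 'D_e f (s *: e + a)) t 0 (ltW t0).
  + by move=> x /subset_itv_oo_cc /I; exact: dg.
  + apply: derivable_within_continuous => x /I /dg dx; exact: (@ex_derive _ _ _ _ _ _ _ dx).
  + exists c; first exact: I.
    by rewrite -g0 -/(g t) -opprB E sub0r mulrN opprK mulrC.
Qed.

Lemma differentiable_littleo (f : V -> R) (df : {linear V -> R}) (z : V) :
  continuous df ->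
  (forall eps : R, 0 < eps ->
     \forall h \near 0, `|f (h + z) - f z - df h| <= eps * `|h|) ->
  differentiable f z /\ 'd f z = df :> (V -> R).
Proof.
move=> cdf Hdf.
have E : f \o shift z = cst (f z) + df +o_ 0 id.
  apply/eqaddoP => eps eps0; apply: filterS (Hdf eps eps0) => h /=.
  by rewrite !fctE /= opprD addrA.
have D := diff_unique cdf E.
split=> //; apply/diff_locallyP; split; first by rewrite D.
by rewrite D.
Qed.

End DirectionalDerivative.

Section Differentiability.
Variables (R : realType) (n : nat).
Implicit Types (W : set 'rV[R]_n) (f : 'rV[R]_n -> R).

Definition gradient_form f (z : 'rV[R]_n) (h : 'rV[R]_n) : R :=
  \sum_j h 0 j * 'D_(basis_vec R j) f z.

Fact gradient_form_is_linear f z : linear (gradient_form f z).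
Proof.
move=> c a b; rewrite /gradient_form scaler_sumr -big_split /=.
by apply: eq_bigr => j _; rewrite !mxE mulrDl -mulrA.
Qed.

HB.instance Definition _ f z := GRing.isLinear.Build R 'rV[R]_n R _
  (gradient_form f z) (@gradient_form_is_linear f z).

Lemma le_coord_norm (h : 'rV[R]_n) j : `|h 0 j| <= `|h|.
Proof.
by rewrite [leRHS]/Num.Def.normr /= mx_normrE; apply/bigmax_geP; right; exists (0, j).
Qed.

Lemma row_norm_le (h : 'rV[R]_n) (e : R) :
  0 <= e -> (forall j, `|h 0 j| <= e) -> `|h| <= e.
Proof.
move=> e0 H; rewrite [leLHS]/Num.Def.normr /= mx_normrE.
by apply: bigmax_le => // -[i j] _ /=; rewrite ord1.
Qed.

Lemma gradient_form_continuous f z : continuous (gradient_form f z).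
Proof.
have -> : gradient_form f z =
  \sum_(j < n) ((fun h : 'rV[R]_n => h 0 j) * cst ('D_(basis_vec R j) f z)).
  by apply/funext => h; rewrite fct_sumE.
move=> h; apply: differentiable_continuous.
apply: differentiable_sum => j.
by apply: differentiableM; [exact: differentiable_coord|exact: differentiable_cst].
Qed.

(** Used in two ways: as k varies, these rows are the corners of a path to h
    along the coordinate axes; when k is the dimension of the leaves, this is
    the leafwise part of h. *)
Definition head_row k (h : 'rV[R]_n) : 'rV[R]_n :=
  \row_j (if (j < k)%N then h 0 j else 0).

(** The increment of f telescopes along the corners head_row k h + z, whose
    consecutive terms differ in one coordinate; each difference is a value of
    one partial derivative at an intermediate point, hence close to its value
    at z. *)
Lemma partial_continuous_differentiable W f z : open W -> W z ->
  (forall z' i, W z' -> derivable f z' (basis_vec R i)) ->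
  (forall i, {for z, continuous ('D_(basis_vec R i) f)}) ->
  differentiable f z /\ forall v, 'D_v f z = gradient_form f z v.
Proof.
move=> oW Wz dW cz.
suff [d E] : differentiable f z /\ 'd f z = gradient_form f z :> (_ -> _).
  by split=> // v; rewrite deriveE // E.
apply: (@differentiable_littleo _ _ _ (gradient_form f z)).
  exact: gradient_form_continuous.
move=> eps eps0.
(* There are n terms to bound; n + 1 is nonzero also when n = 0. *)
pose eps' := eps / n.+1%:R.
have eps'0 : 0 < eps' by rewrite divr_gt0.
have : \forall w \near z, W w /\
    forall i : 'I_n, `|'D_(basis_vec R i) f z - 'D_(basis_vec R i) f w| <= eps'.
  apply: filterI; first exact: open_nbhs_nbhs.
  apply: (@filter_forall _ 'I_n (fun i w =>
    `|'D_(basis_vec R i) f z - 'D_(basis_vec R i) f w| <= eps') (nbhs z)) => i.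
  by have /cvgrPdist_le := cz i; apply.
move=> /nbhs_ballP[d /= d0 Hd].
have {}Hd w : `|w - z| < d -> W w /\
    forall i, `|'D_(basis_vec R i) f z - 'D_(basis_vec R i) f w| <= eps'.
  by move=> wz; apply: Hd; rewrite -ball_normE /= distrC.
apply/nbhs_ballP; exists d => //= h; rewrite -ball_normE /= sub0r normrN => hd.
have hh k : `|head_row k h| <= `|h|.
  apply: row_norm_le => // j; rewrite mxE.
  by case: ifP => _; rewrite ?normr0 // le_coord_norm.
have tele : f (h + z) - f z =
    \sum_(k < n) (f (head_row k.+1 h + z) - f (head_row k h + z)).
  rewrite -(big_mkord xpredT
    (fun k => f (head_row k.+1 h + z) - f (head_row k h + z))).
  rewrite telescope_sumr //; congr (f (_ + _) - f _).
    by apply/rowP => j; rewrite mxE ltn_ord.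
  have -> : head_row 0 h = 0 by apply/rowP => j; rewrite !mxE ltn0.
  by rewrite add0r.
rewrite tele [gradient_form f z h]/gradient_form -sumrB.
apply: le_trans (ler_norm_sum _ _ _) _.
have step (k : 'I_n) : `|f (head_row k.+1 h + z) - f (head_row k h + z)
     - h 0 k * 'D_(basis_vec R k) f z| <= eps' * `|h|.
  have hS : head_row k.+1 h = h 0 k *: basis_vec R k + head_row k h.
    apply/rowP => j; rewrite !mxE ltnS leq_eqVlt eqxx /=.
    have [->|jk] := eqVneq j k; first by rewrite eqxx ltnn mulr1 addr0.
    by rewrite -val_eqE /= in jk; rewrite (negbTE jk) mulr0 add0r.
  have seg s : `|s| <= `|h 0 k| ->
      `|s *: basis_vec R k + (head_row k h + z) - z| < d.
    move=> sk; rewrite addrA addrK; apply: le_lt_trans hd.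
    apply: row_norm_le => // j; rewrite !mxE eqxx /=.
    have [->|jk] := eqVneq j k.
      by rewrite ltnn mulr1 addr0 (le_trans sk) // le_coord_norm.
    rewrite mulr0 add0r; case: ifP => _; rewrite ?normr0 //.
    exact: le_coord_norm.
  (* The segment between two consecutive corners stays in the ball where the
     derivatives are controlled. *)
  have [|s sk E] := @mean_value_line R _ f (head_row k h + z) (basis_vec R k) (h 0 k).
    by move=> s /seg /Hd[Ws _]; exact: dW.
  rewrite hS -(addrA (_ *: _)) E -mulrBr normrM mulrC.
  apply: ler_pM => //; last exact: le_coord_norm.
  by rewrite distrC; have [_] := Hd _ (seg s sk); apply.
apply: le_trans (ler_sum _ (fun k _ => step k)) _.
rewrite sumr_const card_ord -mulrnAl ler_wpM2r //.
rewrite -mulr_natr /eps' -mulrA ger_pMr //.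
by rewrite mulrC ler_pdivrMr // mul1r ler_nat.
Qed.

End Differentiability.

Section Ck.
Variables (R : realType).

Section Def.
Variables (n : nat) (W : set 'rV[R]_n).

(** Peels off the innermost derivative, whereas iter_partial is built from the
    outermost one: inductions for products, inverses and composites need the
    derivative of f itself to be of the lower class. *)
Fixpoint Ck k (f : 'rV[R]_n -> R) : Prop :=
  (forall z, W z -> {for z, continuous f}) /\
  if k is k'.+1 then
    (forall z i, W z -> derivable f z (basis_vec R i)) /\
    forall i, Ck k' ('D_(basis_vec R i) f)
  else True.

End Def.

Lemma near_eq_continuous n (f g : 'rV[R]_n -> R) z :
  (\forall w \near z, f w = g w) -> {for z, continuous f} ->
  {for z, continuous g}.
Proof.
move=> fg; rewrite /prop_for /continuous_at -(nbhs_singleton fg) => cf A /cf fA.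
change (nbhs z (fun w => A (g w))).
by apply: (@filterS2 _ (nbhs z) _ _ _ _ _ fg fA) => w /= ->.
Qed.

Lemma iter_partial_rcons n (s : seq 'I_n) i (f : 'rV[R]_n -> R) :
  iter_partial (rcons s i) f = iter_partial s ('D_(basis_vec R i) f).
Proof. by elim: s => //= j s ->. Qed.

(** Derivatives are exchanged between the two ends of the list of indices by
    iter_partial_rcons, which avoids any appeal to their symmetry. *)
Lemma smooth_euclP n (W : set 'rV[R]_n) f :
  smooth_eucl W f <-> forall k, Ck W k f.
Proof.
split=> [sf k|cf s].
  elim: k f sf => [|k IH] f sf; split=> //.
  - by move=> z Wz; have [] := sf [::] z Wz.
  - by move=> z Wz; have [] := sf [::] z Wz.
  - split=> [z i Wz|i]; first by have [_] := sf [::] z Wz; apply.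
    by apply: IH => s z Wz; rewrite -iter_partial_rcons; exact: sf.
elim/last_ind: s f cf => [|s i IH] f cf z Wz.
  by have [c [d _]] := cf 1; split; [exact: c|move=> i; exact: d].
rewrite iter_partial_rcons; apply: IH => // k.
by have [_ [_]] := cf k.+1; apply.
Qed.

Section Closure.
Variables (n : nat) (W : set 'rV[R]_n) (oW : open W).
Implicit Types (f g : 'rV[R]_n -> R).

Lemma Ck_sub k (W' : set 'rV[R]_n) f : W' `<=` W -> Ck W k f -> Ck W' k f.
Proof.
move=> sW; elim: k f => [|k IH] f [c H]; split; try by move=> z /sW; exact: c.
  by [].
case: H => d H; split=> [z i /sW|i]; first exact: d.
exact: (IH _ (H i)).
Qed.

Lemma CkW k f : Ck W k.+1 f -> Ck W k f.
Proof.
elim: k f => [|k IH] f [c [d H]]; split=> //; split=> // i.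
exact: IH.
Qed.

Lemma Ck_ext k f g : (forall z, W z -> f z = g z) -> Ck W k f -> Ck W k g.
Proof.
have nfg f' g' z : (forall z, W z -> f' z = g' z) -> W z ->
    \forall w \near z, f' w = g' w.
  by move=> fg Wz; apply: filterS fg _; exact: open_nbhs_nbhs.
have nc f' g' : (forall z, W z -> f' z = g' z) ->
    (forall z, W z -> {for z, continuous f'}) ->
    forall z, W z -> {for z, continuous g'}.
  move=> fg c z Wz; apply: near_eq_continuous (c z Wz); exact: nfg.
elim: k f g => [|k IH] f g fg [c H]; split; try exact: nc c.
  by [].
case: H => d H; split=> [z i Wz|i].
  by apply: near_eq_derivable (d z i Wz); exact: nfg.
apply: IH (H i) => z Wz; apply: near_eq_derive; exact: nfg.
Qed.

Lemma Ck_cst k (c : R) : Ck W k (cst c).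
Proof.
elim: k c => [|k IH] c; split; try by move=> z _; exact: cst_continuous.
  by [].
split=> [z i _|i]; first exact: derivable_cst.
by apply: Ck_ext (IH 0) => z _; rewrite derive_cst.
Qed.

Lemma CkD k f g : Ck W k f -> Ck W k g -> Ck W k (fun z => f z + g z).
Proof.
elim: k f g => [|k IH] f g [cf Hf] [cg Hg].
  by split=> // z Wz; apply: continuousD; [exact: cf|exact: cg].
split=> [z Wz|]; first by apply: continuousD; [exact: cf|exact: cg].
case: Hf Hg => df Hf [dg Hg]; split=> [z i Wz|i].
  by apply: derivableD; [exact: df|exact: dg].
apply: Ck_ext (IH _ _ (Hf i) (Hg i)) => z Wz.
by rewrite deriveD //; [exact: df|exact: dg].
Qed.

Lemma CkM k f g : Ck W k f -> Ck W k g -> Ck W k (fun z => f z * g z).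
Proof.
elim: k f g => [|k IH] f g Hf0 Hg0; have [cf Hf] := Hf0; have [cg Hg] := Hg0.
  by split=> // z Wz; apply: continuousM; [exact: cf|exact: cg].
split=> [z Wz|]; first by apply: continuousM; [exact: cf|exact: cg].
case: Hf Hg => df Hf [dg Hg]; split=> [z i Wz|i].
  by apply: derivableM; [exact: df|exact: dg].
have := CkD (IH _ _ (CkW Hf0) (Hg i)) (IH _ _ (CkW Hg0) (Hf i)).
apply: Ck_ext => z Wz.
by rewrite deriveM //; [exact: df|exact: dg].
Qed.

Lemma Ck_sum k (I : Type) (s : seq I) (P : pred I) (F : I -> 'rV[R]_n -> R) :
  (forall i, P i -> Ck W k (F i)) -> Ck W k (fun z => \sum_(i <- s | P i) F i z).
Proof.
move=> H; elim: s => [|a s IH].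
  by apply: Ck_ext (Ck_cst k 0) => z _; rewrite big_nil.
case Pa : (P a).
  apply: Ck_ext (CkD (H a Pa) IH) => z _; by rewrite big_cons Pa.
by apply: Ck_ext IH => z _; rewrite big_cons Pa.
Qed.

Lemma CkV k f : (forall z, W z -> f z != 0) -> Ck W k f ->
  Ck W k (fun z => (f z)^-1).
Proof.
move=> f0; elim: k => [|k IH] Hf; have [cf H] := Hf.
  by split=> // z Wz; apply: continuousV; [exact: f0|exact: cf].
split=> [z Wz|]; first by apply: continuousV; [exact: f0|exact: cf].
case: H => df H; split=> [z i Wz|i].
  by apply: derivableV; [exact: f0|exact: df].
have Hi := IH (CkW Hf).
have := CkM (Ck_cst k (-1)) (CkM (CkM Hi Hi) (H i)).
apply: Ck_ext => z Wz.
rewrite deriveV; [|exact: f0|exact: df].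
by rewrite /= mulN1r -exprVn expr2 scaleNr.
Qed.

Lemma Ck_differentiable k f z : Ck W k.+1 f -> W z ->
  differentiable f z /\ forall v, 'D_v f z = gradient_form f z v.
Proof.
move=> [_ [d H]] Wz; apply: (partial_continuous_differentiable oW Wz d) => i.
by case: k H => [|k] H; have [c _] := H i; exact: (c z Wz).
Qed.

End Closure.

Lemma chain_rule n m (W : set 'rV[R]_n) (W' : set 'rV[R]_m)
    (g : 'rV[R]_n -> 'rV[R]_m) (f : 'rV[R]_m -> R) z v :
  open W -> open W' -> W z -> W' (g z) -> Ck W' 1 f ->
  (forall j, Ck W 1 (fun z => g z 0 j)) ->
  differentiable (f \o g) z /\
  'D_v (f \o g) z =
    \sum_j 'D_v (fun z => g z 0 j) z * 'D_(basis_vec R j) f (g z).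
Proof.
move=> oW oW' Wz Wgz cf cg.
have [df Df] := Ck_differentiable oW' cf Wgz.
have dgj j : differentiable (fun z => g z 0 j) z.
  by have [] := Ck_differentiable oW (cg j) Wz.
have dg : differentiable g z.
  have -> : g = \sum_(j < m) (fun z => g z 0 j *: basis_vec R j).
    apply/funext => x; rewrite fct_sumE; apply/rowP => j.
    rewrite summxE (bigD1 j) //= !mxE !eqxx mulr1 big1 ?addr0 // => i ij.
    by rewrite !mxE eqxx /= eq_sym (negbTE ij) mulr0.
  by apply: differentiable_sum => j; apply: differentiableZl.
have dfg := differentiable_comp dg df.
split=> //.
rewrite deriveE // diff_comp //= -deriveE // -deriveE // Df /gradient_form.
apply: eq_bigr => j _; congr (_ * _).
rewrite derive_mx; last exact: diff_derivable.
by rewrite mxE.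
Qed.

(** The partial derivatives of a composite are sums of products of derivatives
    of g with composites of derivatives of f, so the induction has to run over
    all smooth f simultaneously. *)
Lemma Ck_comp n m (W : set 'rV[R]_n) (W' : set 'rV[R]_m) k
    (g : 'rV[R]_n -> 'rV[R]_m) (f : 'rV[R]_m -> R) :
  open W -> open W' -> (forall z, W z -> W' (g z)) ->
  (forall k, Ck W' k f) -> (forall j k, Ck W k (fun z => g z 0 j)) ->
  Ck W k (f \o g).
Proof.
move=> oW oW' WW'; elim: k f => [|k IH] f cf cg.
  split=> // z Wz; apply: differentiable_continuous.
  by have [] := chain_rule 0 oW oW' Wz (WW' _ Wz) (cf 1) (cg^~ 1).
have D z v (Wz : W z) := chain_rule v oW oW' Wz (WW' _ Wz) (cf 1) (cg^~ 1).
split=> [z Wz|].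
  by apply: differentiable_continuous; have [] := D z 0 Wz.
split=> [z i Wz|i].
  by apply: diff_derivable; have [] := D z 0 Wz.
apply: (@Ck_ext _ _ oW _ (fun z => \sum_j
   'D_(basis_vec R i) (fun z => g z 0 j) z * 'D_(basis_vec R j) f (g z))).
  by move=> z Wz; have [_ ->] := D z (basis_vec R i) Wz.
apply: Ck_sum => // j _; apply: CkM => //.
  by have [_ [_]] := cg j k.+1; apply.
by apply: (IH ('D_(basis_vec R j) f)) => // k'; have [_ [_]] := cf k'.+1; apply.
Qed.

End Ck.

(** * Bump functions on R^n *)

Section Flat.
Variable R : realType.

(** The powers of the inverse make the family stable under differentiation:
    the derivative of each member is a combination of two later ones, so that
    smoothness of exp (- 1 / x) at 0 is proved for all derivatives by the same
    argument. *)
Definition flat (k : nat) (x : R) : R :=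
  if 0 < x then x^-1 ^+ k * expR (- x^-1) else 0.

Lemma flat_ge0 k x : 0 <= flat k x.
Proof.
rewrite /flat; case: ifP => // x0.
by rewrite mulr_ge0 ?expR_ge0 // exprn_ge0 // invr_ge0 ltW.
Qed.

(** One term of the exponential series bounds the left-hand side. Applied to
    k + 1, this shows that the difference quotient of flat k at 0 tends to
    0. *)
Lemma flat_le k x : 0 <= x -> flat k x <= k.+1`!%:R * x.
Proof.
move=> x0; rewrite /flat; case: ifP => [xp|_]; last by rewrite mulr_ge0.
have y0 : 0 < x^-1 by rewrite invr_gt0.
have E := expR_ge1Dxn k (ltW y0).
have f0 : (0 : R) < k.+1`!%:R by rewrite ltr0n fact_gt0.
rewrite expRN ler_pdivrMr ?expR_gt0 //.
apply: (@le_trans _ _ (k.+1`!%:R * x * (x^-1 ^+ k.+1 / k.+1`!%:R))).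
  rewrite exprS [_ * (_ * _ / _)]mulrC.
  suff -> : x^-1 * x^-1 ^+ k / k.+1`!%:R * (k.+1`!%:R * x) = x^-1 ^+ k by [].
  by field; rewrite lt0r_neq0 // lt0r_neq0.
rewrite ler_wpM2l //; first by rewrite mulr_ge0 // ltW.
by apply: le_trans E; rewrite lerDr.
Qed.

Lemma flat_is_derive k (x : R) :
  is_derive x 1 (flat k) (flat k.+2 x - k%:R * flat k.+1 x).
Proof.
have [x0|x0|->] := ltgtP x 0.
- have nz : \forall y \near x, cst (0 : R) y = flat k y.
    near=> y; rewrite /flat; have -> : (0 < y) = false => //.
    apply/negbTE; rewrite -leNgt ltW //; near: y; exact: lt_nbhsl.
  apply: (near_eq_is_derive nz); rewrite /flat !ltNge (ltW x0) /= mulr0 subr0.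
  exact: is_derive_cst.
- have nz : \forall y \near x, y^-1 ^+ k * expR (- y^-1) = flat k y.
    near=> y; rewrite /flat; have -> : (0 < y) = true => //.
    near: y; exact: lt_nbhsr.
  apply: (near_eq_is_derive nz).
  have xn : x != 0 by rewrite lt0r_neq0.
  have dV : is_derive x 1 (fun y : R => y^-1) (- x ^- 2).
    apply: DeriveDef; first exact: derivableV.
    by rewrite deriveV // derive_id scaler1.
  have dX : is_derive x 1 (fun y : R => y^-1 ^+ k)
      (k%:R * x^-1 ^+ k.-1 * (- x ^- 2)).
    have := @is_deriveX R R (fun y => y^-1) k x 1 _ dV.
    case: (k) => [|j] /=.
      move=> _; rewrite mul0r mul0r; exact: is_derive_cst.
    have -> : (fun y : R => y^-1 ^+ j.+1) = (fun y : R => y^-1) ^+ j.+1.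
      by apply/funext => y; rewrite exprfctE.
    by move=> H.
  have dE : is_derive x 1 (fun y : R => expR (- y^-1)) (expR (- x^-1) * x ^- 2).
    have dN : is_derive x 1 (fun y : R => - y^-1) (x ^- 2).
      by apply: is_derive_eq; rewrite opprK.
    apply: DeriveDef.
      apply/derivable1_diffP/(@differentiable_comp _ _ _ _ (fun y : R => - y^-1) expR).
        by apply/derivable1_diffP; exact: (@ex_derive _ _ _ _ _ _ _ dN).
      by apply/derivable1_diffP; exact: derivable_expR.
    rewrite -derive1E (@derive1_comp _ (fun y : R => - y^-1) expR).
    - have E : derive1 (@expR R) (- x^-1) = expR (- x^-1) :> R.
        by rewrite derive1E; exact: (congr1 (fun f => f (- x^-1)) (derive_expR R)).
      by rewrite E derive1E (@derive_val _ _ _ _ _ _ _ dN).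
    - exact: (@ex_derive _ _ _ _ _ _ _ dN).
    - exact: derivable_expR.
  have := @is_deriveM _ _ _ _ x 1 _ _ dX dE.
  move=> H; apply: (is_derive_eq H).
  rewrite /flat x0 /GRing.scale /=.
  case: (k) => [|j].
    by rewrite !mul0r mulr0 addr0 subr0 expr0 mul1r exprVn mulrC.
  rewrite /= !exprS expr0 mulr1.
  by field.
- have F0 : flat k 0 = 0 by rewrite /flat ltxx.
  have -> : flat k.+2 0 - k%:R * flat k.+1 0 = 0 :> R.
    by rewrite /flat ltxx mulr0 subr0.
  suff H : h^-1 *: ((flat k \o shift 0) (h *: (1 : R)) - flat k 0) @[h --> 0^'] --> (0 : R).
    apply: DeriveDef; first by apply/cvg_ex; exists 0.
    exact/cvg_lim.
  apply/cvgrPdist_le => e e0.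
  have c0 : (0 : R) < k.+2`!%:R by rewrite ltr0n fact_gt0.
  near=> h.
  rewrite sub0r normrN /= addr0 F0 subr0 [h *: 1]mulr1 /GRing.scale /=.
  have hn : h != 0 by near: h; exact: nbhs_dnbhs_neq.
  rewrite /flat; case: ifP => h0; last by rewrite mulr0 normr0 ltW.
  have -> : h^-1 * (h^-1 ^+ k * expR (- h^-1)) = flat k.+1 h.
    by rewrite /flat h0 exprS mulrA.
  rewrite ger0_norm ?flat_ge0 //; apply: (le_trans (flat_le _ (ltW h0))).
  rewrite mulrC -ler_pdivlMr // -[h]ger0_norm ?(ltW h0) //.
  rewrite -[h]subr0 distrC.
  near: h; apply: nbhs_dnbhs; apply/nbhs_ballP; exists (e / k.+2`!%:R) => /=.
    by rewrite divr_gt0.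
  by move=> y; rewrite -ball_normE /= => /ltW.
Unshelve. all: by end_near.
Qed.

Lemma flat_gt0 x : 0 < x -> 0 < flat 0 x.
Proof. by move=> x0; rewrite /flat x0 expr0 mul1r expR_gt0. Qed.

Lemma flat_eq0 k x : x <= 0 -> flat k x = 0.
Proof. by move=> x0; rewrite /flat ltNge x0. Qed.

Lemma flat_Ck j k : Ck setT j (fun w : 'rV[R]_1 => flat k (w 0 0)).
Proof.
have D l (w : 'rV[R]_1) i :
    is_derive w (basis_vec R i) (fun w : 'rV[R]_1 => flat l (w 0 0))
      (flat l.+2 (w 0 0) - l%:R * flat l.+1 (w 0 0)).
  have E : (fun h : R => h^-1 *: (((fun w : 'rV[R]_1 => flat l (w 0 0)) \o shift w)
      (h *: basis_vec R i) - flat l (w 0 0))) =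
    (fun h : R => h^-1 *: ((flat l \o shift (w 0 0)) (h *: (1:R)) - flat l (w 0 0))).
    apply/funext => h /=; rewrite !mxE (ord1 i) !eqxx.
    by rewrite [h *: 1]mulr1 mulr1.
  have [dd dv] := flat_is_derive l (w 0 0).
  by apply: DeriveDef; rewrite /derivable /derive E.
have cont l (w : 'rV[R]_1) : {for w, continuous (fun w : 'rV[R]_1 => flat l (w 0 0))}.
  have /derivable1_diffP/differentiable_continuous c : derivable (flat l) (w 0 0) 1.
    by have [] := flat_is_derive l (w 0 0).
  have c2 : {for w, continuous (fun w : 'rV[R]_1 => w 0 0)}.
    by apply: differentiable_continuous; exact: differentiable_coord.
  exact: (@continuous_comp _ _ _ (fun w : 'rV[R]_1 => w 0 0) (flat l) w c2 c).
elim: j k => [|j IH] k; split; try by move=> z _; exact: cont.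
  by [].
split=> [z i _|i]; first by have [] := D k z i.
have := CkD openT (IH k.+2) (CkM openT (Ck_cst openT j (- k%:R)) (IH k.+1)).
apply: Ck_ext; first exact: openT.
move=> z _; have [_ ->] := D k z i; by rewrite mulNr.
Qed.

End Flat.

Section EuclideanBump.
Variables (R : realType) (n : nat).

Lemma Ck_coord (W : set 'rV[R]_n) k j : open W -> Ck W k (fun z => z 0 j).
Proof.
move=> oW; case: k => [|k]; split.
- by move=> z _; apply: differentiable_continuous; exact: differentiable_coord.
- by [].
- by move=> z _; apply: differentiable_continuous; exact: differentiable_coord.
have D (z : 'rV[R]_n) i : is_derive z (basis_vec R i) (fun z : 'rV[R]_n => z 0 j) (i == j)%:R.
  apply: DeriveDef; first exact/diff_derivable/differentiable_coord.
  apply/cvg_lim => //.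
  apply: cvg_near_cst.
  near=> h; rewrite /= !mxE eqxx addrK /= eq_sym /GRing.scale /= mulrA mulVf ?mul1r //.
  by near: h; exact: nbhs_dnbhs_neq.
split=> [z i _|i]; first by have [] := D z i.
apply: (Ck_ext oW) (Ck_cst oW k (i == j)%:R) => z _.
by have [_ ->] := D z i.
Unshelve. all: by end_near.
Qed.

(** The quotient a / (a + b), where a is positive exactly at Euclidean
    distance less than d from z0 and b exactly at distance more than d / 2.
    The norm of row vectors is the maximum of the coordinates, which is not
    smooth; the sum of squares q is, and it dominates the square of that
    norm. *)
Lemma bump_eucl (z0 : 'rV[R]_n) (d : R) : 0 < d ->
  exists phi : 'rV[R]_n -> R,
    [/\ forall k, Ck setT k phi, \forall z \near z0, phi z = 1 &
        forall z, d <= `|z - z0| -> phi z = 0].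
Proof.
move=> d0.
pose q (z : 'rV[R]_n) := \sum_i (z 0 i - z0 0 i) * (z 0 i - z0 0 i).
have qs k : Ck setT k q.
  apply: (Ck_sum openT) => i _.
  have H : Ck setT k (fun z : 'rV[R]_n => z 0 i - z0 0 i).
    exact: (CkD openT (Ck_coord k i openT) (Ck_cst openT k (- z0 0 i))).
  exact: (CkM openT H H).
have fs (a b : R) k : Ck setT k (fun z => flat 0 (a * q z + b)).
  pose g z : 'rV[R]_1 := const_mx (a * q z + b).
  have -> : (fun z => flat 0 (a * q z + b)) = (fun w : 'rV[R]_1 => flat 0 (w 0 0)) \o g.
    by apply/funext => z; rewrite /= mxE.
  apply: (Ck_comp k openT openT) => // [k'|j k']; first exact: flat_Ck.
  apply: (@Ck_ext _ _ _ openT _ (fun z => a * q z + b)).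
    by move=> z _; rewrite mxE.
  exact: (CkD openT (CkM openT (Ck_cst openT k' a) (qs k')) (Ck_cst openT k' b)).
(* Squared radius of the region where b vanishes. *)
pose r := (d / 2) ^+ 2; have r0 : 0 < r by rewrite exprn_gt0 // divr_gt0.
(* The two terms have no common zero because r < d ^ 2. *)
pose den z := flat 0 (-1 * q z + d ^+ 2) + flat 0 (1 * q z + - r).
have rd : r < d ^+ 2.
  by rewrite /r ltr_pXn2r ?nnegrE //= ?divr_ge0 ?(ltW d0) // ltr_pdivrMr // ltr_pMr // ltr1n.
have den0 z : den z != 0.
  apply: lt0r_neq0; rewrite /den; have [h|h] := ltP (q z) (d ^+ 2).
    by rewrite ltr_wpDr ?flat_ge0 // flat_gt0 // mulN1r addrC subr_gt0.
  rewrite ltr_wpDl ?flat_ge0 // flat_gt0 // mul1r subr_gt0.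
  exact: lt_le_trans h.
exists (fun z => flat 0 (-1 * q z + d ^+ 2) * (den z)^-1); split.
- move=> k; apply: (CkM openT); first exact: fs.
  by apply: (CkV openT) => //; exact: (CkD openT (fs _ _ k) (fs _ _ k)).
- have q0 : q z0 = 0.
    by rewrite /q big1 // => i _; rewrite subrr mul0r.
  have cq : {for z0, continuous q} by have [c _] := qs 0%N; exact: c.
  have : \forall z \near z0, q z < r.
    have := cvgr_lt (q z0) cq r; rewrite q0; exact.
  apply: filterS => z qz.
  have f1 : flat 0 (1 * q z + - r) = 0.
    by apply: flat_eq0; rewrite mul1r subr_le0 ltW.
  have := den0 z; rewrite /den f1 addr0 => H.
  by rewrite divff.
- move=> z dz; rewrite flat_eq0 ?mul0r //.
  rewrite mulN1r addrC subr_le0.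
  have [i di] : exists i, d <= `|(z - z0) 0 i|.
    apply/not_existsP => H.
    have : `|z - z0| < d.
      rewrite [ltLHS]/Num.Def.normr /= mx_normrE.
      apply: bigmax_lt => // -[i j] _ /=; rewrite (ord1 i) ltNge.
      by apply/negP; exact: H.
    by rewrite ltNge dz.
  rewrite /q (bigD1 i) //= -expr2.
  apply: (@le_trans _ _ ((z 0 i - z0 0 i) ^+ 2)).
    rewrite -[leRHS]real_normK ?num_real //.
    rewrite !mxE in di; rewrite ler_pXn2r ?nnegrE ?normr_ge0 //; exact: ltW.
  rewrite lerDl; apply: sumr_ge0 => j _; rewrite -expr2; exact: sqr_ge0.
Qed.

End EuclideanBump.

(** * Integrals over the unit interval depending on a parameter *)

Section UnitIntegral.
Variable R : realType.
Implicit Types (f g : R -> R).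

Definition int01 f : R := \int[lebesgue_measure]_(t in `[0, 1]) f t.

Definition cont01 f := forall t : R, 0 <= t <= 1 -> {for t, continuous f}.

Lemma cont01_within f : cont01 f -> {within `[0, 1], continuous f}.
Proof.
move=> cf; apply: continuous_in_subspaceT => x /set_mem /=.
by rewrite in_itv /= => /cf.
Qed.

Lemma cont01_integrable f : cont01 f ->
  lebesgue_measure.-integrable `[0, 1] (EFin \o f).
Proof.
move=> cf; apply: continuous_compact_integrable; first exact: segment_compact.
exact: cont01_within.
Qed.

Lemma eq_int01 f g : (forall t, 0 <= t <= 1 -> f t = g t) -> int01 f = int01 g.
Proof.
move=> fg; apply: eq_Rintegral => t /set_mem /=; rewrite in_itv /=; exact: fg.
Qed.

Lemma int01D f g : cont01 f -> cont01 g ->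
  int01 (fun t => f t + g t) = int01 f + int01 g.
Proof. by move=> cf cg; apply: RintegralD => //; exact: cont01_integrable. Qed.

Lemma int01Z (a : R) f : cont01 f -> int01 (fun t => a * f t) = a * int01 f.
Proof. by move=> cf; apply: RintegralZl => //; exact: cont01_integrable. Qed.

Lemma cont01Z (a : R) f : cont01 f -> cont01 (fun t => a * f t).
Proof.
by move=> cf t t01; apply: continuousM; [exact: cst_continuous|exact: cf].
Qed.

Lemma cont01_sum (I : Type) (s : seq I) (P : pred I) (F : I -> R -> R) :
  (forall i, cont01 (F i)) -> cont01 (fun t => \sum_(i <- s | P i) F i t).
Proof.
move=> cF; elim: s => [|i s IH].
  move=> t t01; have -> : (fun t => \sum_(i <- [::] | P i) F i t) = cst 0.
    by apply/funext => x; rewrite big_nil.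
  exact: cst_continuous.
move=> t t01; case Pi : (P i).
  have -> : (fun t => \sum_(i <- i :: s | P i) F i t) =
      (fun t => F i t + \sum_(i <- s | P i) F i t).
    by apply/funext => x; rewrite big_cons Pi.
  by apply: continuousD; [exact: cF|exact: IH].
have -> : (fun t => \sum_(i <- i :: s | P i) F i t) =
    (fun t => \sum_(i <- s | P i) F i t).
  by apply/funext => x; rewrite big_cons Pi.
exact: IH.
Qed.

Lemma int01_sum (I : Type) (s : seq I) (P : pred I) (F : I -> R -> R) :
  (forall i, cont01 (F i)) ->
  int01 (fun t => \sum_(i <- s | P i) F i t) = \sum_(i <- s | P i) int01 (F i).
Proof.
move=> cF; elim: s => [|i s IH].
  rewrite big_nil -[RHS](mul0r (int01 (cst 0))) -int01Z.
    by apply: eq_int01 => t _; rewrite big_nil mul0r.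
  by move=> t _; exact: cst_continuous.
rewrite big_cons; case: ifP => Pi.
  rewrite -IH -int01D //; last exact: cont01_sum.
  by apply: eq_int01 => t _; rewrite big_cons Pi.
by rewrite -IH; apply: eq_int01 => t _; rewrite big_cons Pi.
Qed.

Lemma le_norm_int01 f (e : R) : cont01 f ->
  (forall t, 0 <= t <= 1 -> `|f t| <= e) -> `|int01 f| <= e.
Proof.
move=> cf fe; apply: (le_trans (le_normr_Rintegral _ _)) => //.
  exact: cont01_integrable.
have -> : e = \int[lebesgue_measure]_(t in `[0, 1]) (cst e t).
  rewrite Rintegral_cst //= lebesgue_measure_itv /= lte_fin ltr01 /=.
  by rewrite subr0 mulr1.
apply: le_Rintegral => //.
- apply: (@cont01_integrable (fun t => `|f t|)) => t t01.
  exact: (@continuous_comp _ _ _ f (fun x : R => `|x|) t (cf t t01)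
    (@norm_continuous _ _ _)).
- by apply: (@cont01_integrable (cst e)) => t _; exact: cst_continuous.
Qed.

Lemma int01_derive (F f : R -> R) : cont01 f ->
  (forall t : R, 0 <= t <= 1 -> is_derive t 1 F (f t)) -> int01 f = F 1 - F 0.
Proof.
move=> cf dF; rewrite /int01 /Rintegral.
have dFt (t : R) : 0 <= t <= 1 -> {for t, continuous F}.
  move=> /dF dt; apply: differentiable_continuous; apply/derivable1_diffP.
  exact: (@ex_derive _ _ _ _ _ _ _ dt).
rewrite (@continuous_FTC2 _ f F 0 1) //.
- exact: cont01_within.
- split.
  + move=> t; rewrite in_itv /= => /andP[t0 t1].
    have t01 : 0 <= t <= 1 by rewrite !ltW.
    exact: (@ex_derive _ _ _ _ _ _ _ (dF t t01)).
  + by apply: cvg_at_right_filter; apply: dFt; rewrite lexx ler01.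
  + by apply: cvg_at_left_filter; apply: dFt; rewrite lexx ler01.
- move=> t; rewrite in_itv /= => /andP[t0 t1].
  have t01 : 0 <= t <= 1 by rewrite !ltW.
  by rewrite derive1E (@derive_val _ _ _ _ _ _ _ (dF t t01)).
Qed.

End UnitIntegral.

Section Parametric.
Variables (R : realType) (V : normedModType R).
Implicit Types (g : R -> V -> R).

Definition joint_cont g (z : V) := forall t : R, 0 <= t <= 1 ->
  {for (t, z), continuous (fun tz : R * V => g tz.1 tz.2)}.

Lemma joint_cont01 g z : joint_cont g z -> cont01 (g^~ z).
Proof.
move=> jc t t01.
have c : {for t, continuous (fun t : R => (t, z))}.
  move=> A [[B1 B2] /= [n1 n2] sub]; apply: filterS n1 => x Bx.
  by apply: sub; split=> //=; exact: nbhs_singleton n2.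
exact: (@continuous_comp _ _ _ (fun t : R => (t, z))
  (fun tz : R * V => g tz.1 tz.2) t c (jc t t01)).
Qed.

(** Compactness of the unit interval makes the continuity in z uniform in
    t. *)
Lemma joint_cont_uniform g z (e : R) : joint_cont g z -> 0 < e ->
  \forall z' \near z, forall t, 0 <= t <= 1 -> `|g t z' - g t z| <= e.
Proof.
move=> jc e0.
have /compact_near_coveringP K := @segment_compact R 0 1.
have := K V (nbhs z) (fun z' t => `|g t z' - g t z| <= e) _.
have H : forall t : R, `[0, 1]%classic t ->
    \forall t' \near t & z' \near z, `|g t' z' - g t' z| <= e.
  move=> t /=; rewrite in_itv /= => t01.
  have e2 : 0 < e / 2 by rewrite divr_gt0.
  have /cvgrPdist_le/(_ _ e2) H1 := jc t t01.
  have /cvgrPdist_le/(_ _ e2) H2 := joint_cont01 jc t01.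
  have {}H2 : \forall tz \near (t, z), `|g t z - g tz.1 z| <= e / 2.
    exists ([set t' | `|g t z - g t' z| <= e / 2], setT) => /=.
      by split=> //; exact: filterT.
    by move=> [a b] [].
  change (\forall tz \near (t, z), `|g tz.1 tz.2 - g tz.1 z| <= e).
  apply: (@filterS2 _ (nbhs (t, z)) _ _ _ _ _ H1 H2) => -[t' z'] /= h1 h2.
  rewrite -(subrKA (g t z)) (splitr e) (le_trans (ler_normD _ _)) // lerD //.
  by rewrite distrC.
move=> /(_ _ H); apply: filterS => z' Hz t t01; apply: Hz.
by rewrite /= in_itv.
Qed.

Lemma int01_param_continuous g z :
  (\forall z' \near z, joint_cont g z') ->
  {for z, continuous (fun z => int01 (g^~ z))}.
Proof.
move=> jn; have jc := nbhs_singleton jn.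
apply/cvgrPdist_le => e e0.
apply: filterS2 jn (joint_cont_uniform jc e0) => z' jz' H.
have c1 := joint_cont01 jc; have c2 := joint_cont01 jz'.
have E : int01 (g^~ z) - int01 (g^~ z') = int01 (fun t => g t z + -1 * g t z').
  by rewrite int01D ?int01Z ?mulN1r //; exact: cont01Z.
rewrite E; apply: le_norm_int01.
  move=> t t01; apply: continuousD; first exact: c1.
  exact: (cont01Z c2).
by move=> t t01; rewrite mulN1r distrC; exact: H.
Qed.

(** By the mean value theorem the difference quotient of g t is a value of dg
    t at a nearby point, and it converges uniformly in t by compactness. *)
Lemma int01_param_derive g dg (W : set V) z e :
  open W -> W z ->
  (forall z', W z' -> joint_cont g z') -> (forall z', W z' -> joint_cont dg z') ->
  (forall t z', 0 <= t <= 1 -> W z' -> is_derive z' e (g t) (dg t z')) ->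
  is_derive z e (fun z => int01 (g^~ z)) (int01 (dg^~ z)).
Proof.
move=> oW Wz jg jdg dgW.
suff H : h^-1 *: (((fun z => int01 (g^~ z)) \o shift z) (h *: e) - int01 (g^~ z))
    @[h --> 0^'] --> int01 (dg^~ z).
  apply: DeriveDef; first by apply/cvg_ex; exists (int01 (dg^~ z)).
  exact/cvg_lim.
apply/cvgrPdist_le => eps eps0.
have : \forall z' \near z, W z' /\
    forall t, 0 <= t <= 1 -> `|dg t z' - dg t z| <= eps.
  by apply: filterI; [exact: open_nbhs_nbhs|exact: joint_cont_uniform (jdg z Wz) eps0].
move=> /nbhs_ballP[d /= d0 Hd].
have ce : {for (0 : R), continuous (fun h : R => `|h *: e|)}.
  apply: (@continuous_comp _ _ _ (fun h : R => h *: e) (fun x : V => `|x|)).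
    exact: scalel_continuous.
  exact: norm_continuous.
have hd : \forall h \near (0:R), `|h *: e| < d.
  by have := cvgr_lt _ ce; rewrite scale0r normr0; apply.
move: hd => /nbhs_ballP[d' /= d'0 Hd'].
near=> h.
have hn : h != 0 by near: h; exact: nbhs_dnbhs_neq.
have hh : `|h| < d'.
  near: h; apply: nbhs_dnbhs; apply/nbhs_ballP; exists d' => //= y.
  by rewrite -ball_normE /= sub0r normrN.
have seg s : `|s| <= `|h| -> ball z d (s *: e + z).
  move=> sh; rewrite -ball_normE /= distrC addrK.
  by apply: Hd'; rewrite -ball_normE /= sub0r normrN (le_lt_trans sh).
have Wh : W (h *: e + z) by have [] := Hd _ (seg h (lexx _)).
have c1 := joint_cont01 (jg z Wz); have c2 := joint_cont01 (jg _ Wh).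
have c3 := joint_cont01 (jdg z Wz).
have E : int01 (dg^~ z) - h^-1 *: (int01 (g^~ (h *: e + z)) - int01 (g^~ z)) =
    int01 (fun t => dg t z + (- h^-1 * g t (h *: e + z) + h^-1 * g t z)).
  rewrite int01D //; last first.
    by move=> t t01; apply: continuousD; exact: cont01Z t01.
  rewrite int01D; [|exact: cont01Z|exact: cont01Z].
  rewrite !int01Z // /GRing.scale /=; ring.
rewrite /= E; apply: le_norm_int01.
  move=> t t01; apply: continuousD; first exact: c3.
  by apply: continuousD; exact: cont01Z t01.
move=> t t01.
have [|s sh Es] := @mean_value_line R V (g t) z e h.
  move=> s /seg /Hd[Ws _].
  exact: (@ex_derive _ _ _ _ _ _ _ (dgW t _ t01 Ws)).
have [Ws Hs] := Hd _ (seg s sh).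
rewrite (@derive_val _ _ _ _ _ _ _ (dgW t _ t01 Ws)) in Es.
have -> : dg t z + (- h^-1 * g t (h *: e + z) + h^-1 * g t z) =
  dg t z - h^-1 * (g t (h *: e + z) - g t z) by ring.
by rewrite Es mulrA mulVf // mul1r distrC; exact: Hs.
Unshelve. all: by end_near.
Qed.

End Parametric.

(** * Means along leafwise homotheties *)

Section LeafHomotopy.
Variables (R : realType) (n p : nat) (z0 : 'rV[R]_n) (d : R).

Definition cube : set 'rV[R]_n := [set z | `|z - z0| < d].

(** The homothety of ratio t along the plaque through z, the transverse
    coordinates being fixed: at t = 0 the plaque is contracted to its point
    whose leafwise coordinates are those of z0. *)
Definition leaf_scale (t : R) (z : 'rV[R]_n) : 'rV[R]_n :=
  z + (t - 1) *: head_row p (z - z0).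

Lemma open_cube : open cube.
Proof.
have -> : cube = ball z0 d by apply/seteqP; split=> z; rewrite -ball_normE /cube /= distrC.
exact: ball_open.
Qed.

Lemma head_rowD (x y : 'rV[R]_n) : head_row p (x + y) = head_row p x + head_row p y.
Proof. by apply/rowP => j; rewrite !mxE; case: ifP; rewrite ?addr0. Qed.

Lemma head_rowZ (a : R) (x : 'rV[R]_n) : head_row p (a *: x) = a *: head_row p x.
Proof. by apply/rowP => j; rewrite !mxE; case: ifP; rewrite ?mulr0. Qed.

Lemma norm_head_row (x : 'rV[R]_n) : `|head_row p x| <= `|x|.
Proof.
apply: row_norm_le => // j; rewrite mxE.
by case: ifP => _; rewrite ?normr0 // le_coord_norm.
Qed.

Lemma leaf_scale_cube t z : 0 <= t <= 1 -> cube z -> cube (leaf_scale t z).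
Proof.
move=> /andP[t0 t1]; rewrite /cube /=; apply: le_lt_trans.
rewrite /leaf_scale addrAC; apply: row_norm_le => // j; rewrite 5!mxE.
have := le_coord_norm (z - z0) j; rewrite !mxE => H.
case: ifP => _; last by rewrite mulr0 addr0.
rewrite -{1}[z 0 j - z0 0 j]mul1r -mulrDl addrCA subrr addr0 normrM.
by rewrite (le_trans _ H) // ger0_norm // ler_piMl.
Qed.

Lemma leaf_scale1 z : leaf_scale 1 z = z.
Proof. by rewrite /leaf_scale subrr scale0r addr0. Qed.

Lemma leaf_scaleD t (z h : 'rV[R]_n) : leaf_scale t (h + z) =
  (h + (t - 1) *: head_row p h) + leaf_scale t z.
Proof. rewrite /leaf_scale -[h + z - z0]addrA (head_rowD h) scalerDr.
exact: addrACA. Qed.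

Lemma leaf_scale_line t z :
  leaf_scale t z = t *: head_row p (z - z0) + (z - head_row p (z - z0)).
Proof. by rewrite /leaf_scale scalerBl scale1r addrCA. Qed.

Lemma leaf_scale_continuous :
  continuous (fun tz : R * 'rV[R]_n => leaf_scale tz.1 tz.2).
Proof.
move=> [t z]; rewrite /continuous_at /=.
have c2 : (fun tz : R * 'rV[R]_n => tz.2) x @[x --> (t, z)] --> z by exact: cvg_snd.
have c1 : (fun tz : R * 'rV[R]_n => tz.1 - 1) x @[x --> (t, z)] --> t - 1.
  by apply: cvgB; [exact: cvg_fst|exact: cvg_cst].
have ch : (fun tz : R * 'rV[R]_n => head_row p (tz.2 - z0)) x @[x --> (t, z)]
    --> head_row p (z - z0).
  apply/cvgrPdist_lt => e e0.
  have /cvgrPdist_lt/(_ _ e0) := c2; apply: filterS => -[t' z'] /=.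
  apply: le_lt_trans.
  have -> : head_row p (z - z0) - head_row p (z' - z0) = head_row p (z - z').
    rewrite -[- head_row _ _]scaleN1r -head_rowZ -head_rowD scaleN1r; congr head_row.
    by rewrite opprB addrA subrK.
  exact: norm_head_row.
by apply: cvgD; [exact: c2|apply: cvgZ; [exact: c1|exact: ch]].
Qed.

(** This is the average in the classical homotopy operator: a leafwise form of
    degree r + 1 contracted with the Euler field has r leafwise arguments
    left, and their images under the homothety of ratio t give the factor
    t ^ r. *)
Definition leaf_mean (r : nat) (f : 'rV[R]_n -> R) (z : 'rV[R]_n) : R :=
  int01 (fun t => t ^+ r * f (leaf_scale t z)).

Lemma leaf_mean_joint r f z : (forall z, cube z -> {for z, continuous f}) ->
  cube z -> joint_cont (fun t z => t ^+ r * f (leaf_scale t z)) z.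
Proof.
move=> cf Wz t t01.
apply: (@continuousM _ _ (fun tz : R * 'rV[R]_n => tz.1 ^+ r)
  (fun tz => f (leaf_scale tz.1 tz.2))).
  apply: (@continuous_comp _ _ _ (fun tz : R * 'rV[R]_n => tz.1) (fun t => t ^+ r)).
    exact: cvg_fst.
  exact: exprn_continuous.
apply: (@continuous_comp _ _ _ (fun tz : R * 'rV[R]_n => leaf_scale tz.1 tz.2) f).
  exact: leaf_scale_continuous.
by apply: cf; exact: leaf_scale_cube.
Qed.

Lemma leaf_scale_derive r f t z i : Ck cube 1 f -> 0 <= t <= 1 -> cube z ->
  is_derive z (basis_vec R i) (fun z => t ^+ r * f (leaf_scale t z))
    (t ^+ (r + (i < p)) * 'D_(basis_vec R i) f (leaf_scale t z)).
Proof.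
move=> cf t01 Wz.
have Ws := leaf_scale_cube t01 Wz.
have [df Df] := Ck_differentiable open_cube cf Ws.
set c := if (i < p)%N then t else 1.
have hb : basis_vec R i + (t - 1) *: head_row p (basis_vec R i) = c *: basis_vec R i.
  apply/rowP => j; rewrite !mxE eqxx /= /c.
  have [->|ji] := eqVneq j i; last by rewrite if_same !mulr0 addr0.
  by case: ifP => _; ring.
have d1 : is_derive z (basis_vec R i) (fun z => f (leaf_scale t z))
    ('D_(c *: basis_vec R i) f (leaf_scale t z)).
  have E : (fun h : R => h^-1 *: (((fun z => f (leaf_scale t z)) \o shift z)
      (h *: basis_vec R i) - f (leaf_scale t z))) =
    (fun h : R => h^-1 *: ((f \o shift (leaf_scale t z)) (h *: (c *: basis_vec R i))
      - f (leaf_scale t z))).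
    apply/funext => h /=; congr (_ *: (f _ - _)).
    by rewrite leaf_scaleD head_rowZ scalerA mulrC -scalerA -scalerDr hb.
  have dd : derivable f (leaf_scale t z) (c *: basis_vec R i).
    exact: diff_derivable.
  by apply: DeriveDef; rewrite /derivable /derive E.
have -> : t ^+ (r + (i < p)) * 'D_(basis_vec R i) f (leaf_scale t z) =
    t ^+ r * 'D_(c *: basis_vec R i) f (leaf_scale t z).
  rewrite Df (Df (c *: _)) linearZ /= /GRing.scale /= exprD mulrA /c.
  by case: ifP => _; rewrite ?expr1 ?mul1r ?expr0 ?mulr1 // mulrA.
exact: (@is_deriveZ _ _ _ _ (t ^+ r) _ _ _ d1).
Qed.

(** A leafwise derivative falls on the homothety and produces a factor t, a
    transverse one does not. This is also why the mean stays smooth in the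
    transverse coordinates. *)
Lemma leaf_mean_derive r f z i : Ck cube 1 f -> cube z ->
  is_derive z (basis_vec R i) (leaf_mean r f)
    (leaf_mean (r + (i < p)) ('D_(basis_vec R i) f) z).
Proof.
move=> cf Wz; have [c0 [_ c1]] := cf.
apply: (@int01_param_derive _ _ (fun t z => t ^+ r * f (leaf_scale t z))
  (fun t z => t ^+ (r + (i < p)) * 'D_(basis_vec R i) f (leaf_scale t z))
  cube z _ open_cube Wz).
- by move=> z' Wz'; exact: leaf_mean_joint.
- move=> z' Wz'.
  exact: (@leaf_mean_joint (r + (i < p)) ('D_(basis_vec R i) f) z' (c1 i).1 Wz').
- by move=> t z' t01 Wz'; exact: leaf_scale_derive.
Qed.

Lemma leaf_mean_Ck r f k : (forall k, Ck cube k f) -> Ck cube k (leaf_mean r f).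
Proof.
elim: k r f => [|k IH] r f cf.
  split=> // z Wz; apply: int01_param_continuous.
  apply: filterS (open_nbhs_nbhs (conj open_cube Wz)) => z' Wz'.
  by apply: leaf_mean_joint => //; have [c _] := cf 0%N.
split=> [z Wz|].
  apply: int01_param_continuous.
  apply: filterS (open_nbhs_nbhs (conj open_cube Wz)) => z' Wz'.
  by apply: leaf_mean_joint => //; have [c _] := cf 0%N.
have D z i := @leaf_mean_derive r f z i (cf 1%N).
split=> [z i Wz|i]; first exact: (@ex_derive _ _ _ _ _ _ _ (D z i Wz)).
apply: (Ck_ext open_cube) (IH (r + (i < p))%N ('D_(basis_vec R i) f) _).
  by move=> z Wz; rewrite (@derive_val _ _ _ _ _ _ _ (D z i Wz)).
by move=> k'; have [_ [_]] := cf k'.+1; apply.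
Qed.

(** The integrand on the left is the derivative in t of the product of
    t ^ (r + 1) with f at the point scaled by t: its two terms come from the
    power of t and from the Euler field of the leaf. *)
Lemma leaf_mean_euler r f z : Ck cube 1 f -> cube z ->
  r.+1%:R * leaf_mean r f z +
  \sum_(j < n | (j < p)%N)
     (z 0 j - z0 0 j) * leaf_mean r.+1 ('D_(basis_vec R j) f) z = f z.
Proof.
move=> cf Wz; have [c0 [_ c1]] := cf.
have cc r' (f' : 'rV[R]_n -> R) : (forall z, cube z -> {for z, continuous f'}) ->
    cont01 (fun t => t ^+ r' * f' (leaf_scale t z)).
  move=> cf'; exact: (@joint_cont01 _ _ (fun t z => t ^+ r' * f' (leaf_scale t z)) z
    (@leaf_mean_joint r' f' z cf' Wz)).
have c1' j : cont01 (fun t => t ^+ r.+1 * 'D_(basis_vec R j) f (leaf_scale t z)).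
  exact: (cc r.+1 ('D_(basis_vec R j) f) (c1 j).1).
rewrite /leaf_mean -int01Z; last exact: cc.
rewrite (eq_bigr (fun j => int01 (fun t => (z 0 j - z0 0 j) *
  (t ^+ r.+1 * 'D_(basis_vec R j) f (leaf_scale t z))))); last first.
  by move=> j _; rewrite int01Z.
rewrite -int01_sum; last by move=> j; exact: cont01Z.
rewrite -int01D; [|exact: cont01Z (cc _ _ c0)|]; last first.
  by apply: cont01_sum => j; exact: cont01Z.
have E1 : 1 ^+ r.+1 * f (leaf_scale 1 z) - 0 ^+ r.+1 * f (leaf_scale 0 z) = f z.
  by rewrite expr1n leaf_scale1 mul1r expr0n /= mul0r subr0.
rewrite -[RHS]E1.
apply: (@int01_derive _ (fun t => t ^+ r.+1 * f (leaf_scale t z))).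
- move=> t t01; apply: continuousD; first exact: cont01Z (cc _ _ c0) _ t01.
  by apply: cont01_sum t01 => j; exact: cont01Z.
- move=> t t01; set u := head_row p (z - z0).
  have Ws := leaf_scale_cube t01 Wz.
  have [df Df] := Ck_differentiable open_cube cf Ws.
  have d1 : is_derive t 1 (fun t => f (leaf_scale t z)) ('D_u f (leaf_scale t z)).
    have E : (fun t => f (leaf_scale t z)) = (fun t => f (t *: u + (z - u))).
      by apply/funext => s; rewrite leaf_scale_line.
    rewrite E leaf_scale_line; apply: line_is_derive.
    by rewrite -leaf_scale_line; exact: diff_derivable.
  have d2 : is_derive t 1 (fun t : R => t ^+ r.+1) (r.+1%:R * t ^+ r).
    have H : is_derive t 1 ((@idfun R) ^+ r.+1) ((r.+1%:R * t ^+ r) *: 1).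
      exact: is_deriveX.
    rewrite [_ *: 1]mulr1 in H.
    have E : (fun t : R => t ^+ r.+1) = (@idfun R) ^+ r.+1.
      by apply/funext => s; rewrite exprfctE.
    by rewrite E.
  have := @is_deriveM _ _ _ _ t 1 _ _ d2 d1 => H; apply: (is_derive_eq H).
  rewrite /GRing.scale /= Df /gradient_form addrC [f _ * _]mulrC -mulrA.
  congr (_ + _); rewrite mulr_sumr [RHS]big_mkcond /=; apply: eq_bigr => j _.
  by rewrite !mxE; case: ifP => _; ring.
Qed.

End LeafHomotopy.

(** * Alternating forms and their types *)

Section AlternatingForms.
Variables (R : realType) (V : lmodType R).

Lemma set_arg_id (T : Type) k (v : 'I_k -> T) i : set_arg v i (v i) = v.
Proof. by apply/funext => j; rewrite /set_arg; case: eqP => [->|]. Qed.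

Lemma set_arg_eq (T : Type) k (v : 'I_k -> T) i w : set_arg v i w i = w.
Proof. by rewrite /set_arg eqxx. Qed.

Lemma set_argC (T : Type) k (v : 'I_k -> T) i j w w' : i != j ->
  set_arg (set_arg v i w) j w' = set_arg (set_arg v j w') i w.
Proof.
move=> ij; apply/funext => l; rewrite /set_arg.
by have [->|//] := eqVneq l j; rewrite eq_sym (negbTE ij).
Qed.

Section Multilinear.
Variables (k : nat) (w : ('I_k -> V) -> R).
Hypothesis wlin : forall (v : 'I_k -> V) (i : 'I_k) (t : R) (a b : V),
  w (set_arg v i (t *: a + b)) = t * w (set_arg v i a) + w (set_arg v i b).

Lemma mlin0 v i : w (set_arg v i 0) = 0.
Proof.
have := wlin v i 1 0 0; rewrite scale1r addr0 mul1r => /eqP.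
by rewrite -subr_eq subrr eq_sym => /eqP.
Qed.

Lemma mlinZ v i t a : w (set_arg v i (t *: a)) = t * w (set_arg v i a).
Proof. by rewrite -[t *: a]addr0 wlin mlin0 addr0. Qed.

Lemma mlinD v i a b : w (set_arg v i (a + b)) = w (set_arg v i a) + w (set_arg v i b).
Proof. by rewrite -[a]scale1r wlin mul1r scale1r. Qed.

Lemma mlin_sum v i (I : Type) (r : seq I) (P : pred I) (F : I -> V) :
  w (set_arg v i (\sum_(l <- r | P l) F l)) =
  \sum_(l <- r | P l) w (set_arg v i (F l)).
Proof.
elim: r => [|l r IH]; first by rewrite !big_nil mlin0.
by rewrite !big_cons; case: ifP => // _; rewrite mlinD IH.
Qed.

Definition head_family h (u v : 'I_k -> V) : 'I_k -> V :=
  fun i => if (i < h)%N then u i else v i.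

(** The arguments are expanded one at a time. After h steps the tuple L is
    pinned to an arbitrary index D from h on, so that all the intermediate
    sums run over the same type of tuples. *)
Lemma mlin_expand m (e : 'I_m -> V) (theta : 'I_m -> V -> R) (v : 'I_k -> V) :
  (forall i, v i = \sum_l theta l (v i) *: e l) ->
  w v = \sum_(L : {ffun 'I_k -> 'I_m})
    (\prod_i theta (L i) (v i)) * w (fun i => e (L i)).
Proof.
move=> ve.
pose g (h : nat) (L : {ffun 'I_k -> 'I_m}) : R :=
  \prod_(i < k) (if (i < h)%N then theta (L i) (v i) else 1).
suff H h : (h <= k)%N -> forall (D : 'I_m), w v =
    \sum_(L : {ffun 'I_k -> 'I_m} | [forall i : 'I_k, (h <= i)%N ==> (L i == D)])
      g h L * w (head_family h (fun i => e (L i)) v).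
  have [m0|] := posnP m; last first.
    move=> m0; rewrite (H k (leqnn k) (Ordinal m0)); apply: eq_big => L.
      by apply/forallP => i; rewrite leqNgt ltn_ord.
    move=> _; congr (_ * w _).
      by apply: eq_bigr => i _; rewrite ltn_ord.
    by apply/funext => i; rewrite /head_family ltn_ord.
  have [k0|k0] := posnP k.
    have L0 : {ffun 'I_k -> 'I_m} by apply: ffun0; rewrite card_ord.
    rewrite (bigD1 L0) //=.
    rewrite big1 ?mul1r; last by move=> i _; exfalso; have := ltn_ord i; rewrite {2}k0.
    rewrite big1 ?addr0; last first.
      move=> L /eqP nL; case: nL; apply/ffunP => i; exfalso.
      by have := ltn_ord i; rewrite {2}k0.
    by congr w; apply/funext => i; exfalso; have := ltn_ord i; rewrite {2}k0.
  rewrite big1 => [|L _]; last first.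
    by exfalso; case: (L (Ordinal k0)) => l; rewrite m0.
  have v0 : v (Ordinal k0) = 0.
    by rewrite ve big1 // => l _; exfalso; have := ltn_ord l; rewrite {2}m0.
  by rewrite -[v](set_arg_id v (Ordinal k0)) v0 mlin0.
elim: h => [|h IH] hk D.
  rewrite (bigD1 [ffun=> D]) /=; last by apply/forallP => i; rewrite ffunE.
  rewrite big1 ?addr0; last first.
    move=> L /andP[/forallP HL /eqP nL]; case: nL; apply/ffunP => i.
    by rewrite ffunE; apply/eqP; exact: HL.
  by rewrite /g big1 ?mul1r // => i _.
rewrite (IH (ltnW hk) D).
pose ih := Ordinal hk.
pose ext (L : {ffun 'I_k -> 'I_m}) l := [ffun i => if i == ih then l else L i].
transitivity (\sum_(L : {ffun 'I_k -> 'I_m} | [forall i : 'I_k, (h <= i)%N ==> (L i == D)])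
   \sum_(l < m) g h.+1 (ext L l) *
      w (head_family h.+1 (fun i => e (ext L l i)) v)).
  apply: eq_bigr => L HL.
  set u := head_family h _ v.
  have uih : u ih = \sum_l theta l (v ih) *: e l.
    by rewrite /u /head_family ltnn -ve.
  rewrite -[w u](congr1 w (set_arg_id u ih)) uih mlin_sum mulr_sumr.
  apply: eq_bigr => l _; rewrite mlinZ mulrA; congr (_ * w _).
    rewrite /g (bigD1 ih) //= ltnn mul1r [RHS](bigD1 ih) //= ltnSn ffunE eqxx mulrC.
    congr (_ * _); apply: eq_bigr => i ni; rewrite ffunE (negbTE ni) ltnS.
    rewrite -(inj_eq val_inj) /= in ni.
    by rewrite [(i <= h)%N]leq_eqVlt (negbTE ni).
  apply/funext => i; rewrite /set_arg /u /head_family ltnS [(i <= h)%N]leq_eqVlt ffunE.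
  have [->|ni] := eqVneq i ih; first by rewrite /= eqxx.
  by rewrite -(inj_eq val_inj) /= in ni; rewrite (negbTE ni).
rewrite pair_big_dep /=.
pose res (L : {ffun 'I_k -> 'I_m}) := [ffun i => if i == ih then D else L i].
rewrite (reindex (fun L => (res L, L ih))) /=; last first.
  exists (fun Ll => ext Ll.1 Ll.2) => [L _|[L l]] /=.
    apply/ffunP => i; rewrite !ffunE; by case: eqP => [->|].
  rewrite inE andbT => /forallP HL; congr pair; last by rewrite ffunE eqxx.
  apply/ffunP => i; rewrite !ffunE; case: eqP => [->|//].
  by apply/esym/eqP; have := HL ih; rewrite leqnn.
apply: eq_big => L.
  rewrite andbT; apply/forallP/forallP => HL i; apply/implyP => hi.
    have := HL i; rewrite (ltnW hi) ffunE /=; have [ii|//] := eqVneq i ih.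
    by rewrite ii ltnn in hi.
  rewrite ffunE /=; have [_|ni] := eqVneq i ih; first by rewrite eqxx.
  apply: (implyP (HL i)).
  rewrite ltn_neqAle hi andbT; apply: contra ni => /eqP hh.
  by apply/eqP/val_inj; rewrite /= hh.
move=> _; have -> // : ext (res L) (L ih) = L.
by apply/ffunP => i; rewrite !ffunE; case: eqP => [->|].
Qed.

End Multilinear.

Section Alternating.
Variables (k : nat) (w : ('I_k -> V) -> R) (aw : alternating_form w).
Let wlin := aw.1.

(** Polarization: w vanishes when the arguments i and j are both replaced by
    the sum of the two. *)
Lemma alt_swap (v : 'I_k -> V) i j : i != j -> w (v \o tperm i j) = - w v.
Proof.
move=> ij; pose W a b := w (set_arg (set_arg v i a) j b).
have Wd a : W a a = 0.
  apply: (aw.2 _ i j ij); rewrite set_arg_eq /set_arg.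
  by rewrite (negbTE ij) eqxx.
have := Wd (v i + v j); rewrite /W (mlinD wlin).
rewrite !(set_argC _ _ _ ij) !(mlinD wlin) -!(set_argC _ _ _ ij) -!/(W _ _).
rewrite !Wd addr0 add0r.
have -> : W (v i) (v j) = w v.
  by rewrite /W set_arg_id set_arg_id.
have -> : W (v j) (v i) = w (v \o tperm i j).
  congr w; apply/funext => l; rewrite /set_arg /=.
  case: tpermP => [->|->|/eqP/negbTE -> /eqP/negbTE ->//].
    by rewrite (negbTE ij) eqxx.
  by rewrite eqxx.
by move/eqP; rewrite addr_eq0 => /eqP.
Qed.

Lemma alt_perm (v : 'I_k -> V) (s : {perm 'I_k}) : w (v \o s) = (-1) ^+ s * w v.
Proof.
have [ts -> /allP dts] := prod_tpermP s.
elim: ts dts v => [|t ts IH] dts v.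
  rewrite big_nil odd_perm1 mul1r; congr w; apply/funext => i /=; by rewrite perm1.
rewrite big_cons odd_permM odd_tperm.
have tt : t.1 != t.2 by apply: dts; rewrite inE eqxx.
rewrite tt signr_addb /= mulN1r mulNr -IH; last first.
  by move=> t' t'ts; apply: dts; rewrite inE t'ts orbT.
rewrite -(alt_swap (v \o _) tt); congr w; apply/funext => i /=; by rewrite permM.
Qed.

End Alternating.

Definition fcons (T : Type) k (a : T) (v : 'I_k -> T) : 'I_k.+1 -> T :=
  fun i => oapp v a (unlift ord0 i).

Lemma fcons0 (T : Type) k (a : T) (v : 'I_k -> T) : fcons a v ord0 = a.
Proof. by rewrite /fcons unlift_none. Qed.

Lemma fconsS (T : Type) k (a : T) (v : 'I_k -> T) i : fcons a v (lift ord0 i) = v i.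
Proof. by rewrite /fcons liftK. Qed.

(** Moving the argument i to the front is a cycle of sign (-1) ^ i. *)
Lemma alt_front k (w : ('I_k.+1 -> V) -> R) (v : 'I_k.+1 -> V) i :
  alternating_form w -> w (fcons (v i) (v \o lift i)) = (-1) ^+ i * w v.
Proof.
move=> aw; have -> : fcons (v i) (v \o lift i) = v \o lift_perm ord0 i 1.
  apply/funext => j /=; case: (unliftP ord0 j) => [l ->|->].
    by rewrite fconsS lift_perm_lift perm1.
  by rewrite fcons0 lift_perm_id.
rewrite alt_perm // odd_lift_perm odd_perm1 addbF /= signr_odd.
by [].
Qed.

(** The form is the mean of its signed values at the permuted arguments;
    expanding these in the basis and exchanging the sums produces
    determinants. *)
Lemma alt_det_expand k (w : ('I_k -> V) -> R) m (e : 'I_m -> V)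
    (theta : 'I_m -> V -> R) (v : 'I_k -> V) : alternating_form w ->
  (forall x, x = \sum_l theta l x *: e l) ->
  w v = \sum_(L : {ffun 'I_k -> 'I_m})
    (k`!%:R^-1 * w (fun i => e (L i))) *
    \det (\matrix_(i < k, j < k) theta (L i) (v j)).
Proof.
move=> aw ve.
have k0 : k`!%:R != 0 :> R by rewrite pnatr_eq0 -lt0n fact_gt0.
apply: (mulfI k0); rewrite mulr_sumr.
transitivity (\sum_(s : 'S_k) (-1) ^+ s * w (v \o s)).
  rewrite (eq_bigr (fun=> w v)); last first.
    by move=> s _; rewrite alt_perm // mulrA -signr_addb addbb mul1r.
  by rewrite sumr_const card_Sn mulr_natl.
rewrite (eq_bigr (fun s : 'S_k => \sum_(L : {ffun 'I_k -> 'I_m})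
   ((-1) ^+ s * \prod_i theta (L i) (v (s i))) * w (fun i => e (L i)))); last first.
  move=> s _; rewrite (mlin_expand aw.1 (e := e) (theta := theta)) //.
  by rewrite mulr_sumr; apply: eq_bigr => L _; rewrite mulrA.
rewrite exchange_big; apply: eq_bigr => L _.
rewrite !mulrA divff // mul1r -mulr_suml mulrC; congr (_ * _).
by apply: eq_bigr => s _; congr (_ * _); apply: eq_bigr => i _; rewrite mxE.
Qed.

End AlternatingForms.

Section Bigraded.
Local Open Scope set_scope.
Variables (R : realType) (V : vectType R) (B C : {vspace V}).

Lemma card_ord_ge s r : (#|[set i : 'I_(s + r) | (s <= i)%N]| <= r)%N.
Proof.
apply: (@leq_trans #|[set rshift s j | j in [set: 'I_r]]|).
  apply: subset_leq_card; apply/fintype.subsetP => i; rewrite inE => si.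
  have lt : (i - s < r)%N by rewrite ltn_subLR.
  apply/imsetP; exists (Ordinal lt) => //; apply/val_inj => /=.
  by rewrite subnKC.
by rewrite (leq_trans (leq_imset_card _ _)) // cardsT card_ord.
Qed.

Lemma card_ord_lt s r : (#|[set i : 'I_(s + r) | (i < s)%N]| <= s)%N.
Proof.
apply: (@leq_trans #|[set lshift r j | j in [set: 'I_s]]|).
  apply: subset_leq_card; apply/fintype.subsetP => i; rewrite inE => si.
  by apply/imsetP; exists (Ordinal si) => //; apply/val_inj.
by rewrite (leq_trans (leq_imset_card _ _)) // cardsT card_ord.
Qed.

Lemma perm_hits k (sg : {perm 'I_k}) (D T : {set 'I_k}) :
  (#|D| < #|T|)%N -> exists2 i, i \notin D & sg i \in T.
Proof.
move=> DT; apply/not_exists2P => H; move: DT; apply/negP; rewrite -leqNgt.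
rewrite -(card_imset D (@perm_inj _ sg)); apply: subset_leq_card.
apply/fintype.subsetP => j jT; apply/imsetP; exists ((sg^-1)%g j); last by rewrite permKV.
by have [/negP|] := H ((sg^-1)%g j); [rewrite negbK|rewrite permKV].
Qed.

(** A term of a determinant pairs the covectors with the arguments. At most r
    covectors are outside the annihilator of B, so one of the arguments in B
    is paired with a covector that annihilates it. *)
Lemma bigraded_vanish_B s r k (w : ('I_k -> V) -> R) (v : 'I_k -> V)
    (T : {set 'I_k}) : bigraded_form B C s r w -> (r < #|T|)%N ->
  (forall j, j \in T -> v j \in B) -> w v = 0.
Proof.
case=> ks; subst k => -[N [t [g [gB gC ->]]]] rT vT; apply: big1 => l _.
rewrite /determinant big1 ?mulr0 // => sg _.
have [i] := perm_hits sg (leq_ltn_trans (card_ord_ge s r) rT).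
rewrite inE -ltnNge => is_ sT.
by rewrite (bigD1 i) //= mxE gB ?mul0r ?mulr0 // vT.
Qed.

Lemma bigraded_vanish_C s r k (w : ('I_k -> V) -> R) (v : 'I_k -> V)
    (T : {set 'I_k}) : bigraded_form B C s r w -> (s < #|T|)%N ->
  (forall j, j \in T -> v j \in C) -> w v = 0.
Proof.
case=> ks; subst k => -[N [t [g [gB gC ->]]]] rT vT; apply: big1 => l _.
rewrite /determinant big1 ?mulr0 // => sg _.
have [i] := perm_hits sg (leq_ltn_trans (card_ord_lt s r) rT).
rewrite inE -leqNgt => is_ sT.
by rewrite (bigD1 i) //= mxE gC ?mul0r ?mulr0 // vT.
Qed.

(** The covectors of a decomposable form of type (s, r) come with those that
    annihilate B in front, while those of a basis expansion come in any
    order. *)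
Lemma sort_by_type k s (isB : pred 'I_k) : #|[set i | ~~ isB i]| = s ->
  exists sg : {perm 'I_k}, forall i : 'I_k, isB (sg i) = (s <= i)%N.
Proof.
move=> cs.
pose L := seq.filter (predC isB) (enum 'I_k) ++ seq.filter isB (enum 'I_k).
have : perm_eq L (ord_tuple k).
  by rewrite val_ord_tuple /L perm_catC perm_filterC.
case/tuple_permP => sg EL; exists sg => i.
have sL : size (seq.filter (predC isB) (enum 'I_k)) = s.
  rewrite -cs cardE; congr size; rewrite {2}/enum_mem -enumT.
  by apply: eq_filter => j; rewrite !inE.
have nL : nth i L i = sg i.
  have -> : L = map sg (enum 'I_k).
    by rewrite EL /=; apply: eq_map => j; rewrite tnth_ord_tuple.
  by rewrite (nth_map i) ?size_enum_ord // nth_ord_enum.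
rewrite -nL /L nth_cat sL; case: ltnP => is_.
  have : nth i (seq.filter (predC isB) (enum 'I_k)) i \in seq.filter (predC isB) (enum 'I_k).
    by apply: mem_nth; rewrite sL.
  by rewrite mem_filter => /andP[/= /negbTE].
have : nth i (seq.filter isB (enum 'I_k)) (i - s) \in seq.filter isB (enum 'I_k).
  apply: mem_nth; have : size L = k by rewrite EL size_tuple.
  rewrite /L size_cat sL => H; rewrite ltn_subLR // H; exact: ltn_ord.
by rewrite mem_filter => /andP[/= ->].
Qed.

(** In the expansion of w over a dual basis adapted to B and C, the covectors
    of each surviving determinant can be sorted by type: the sign of the
    permutation appears both in the coefficient and in the determinant. *)
Lemma bigraded_of_basis s r k (w : ('I_k -> V) -> R) m (e : 'I_m -> V)
    (theta : 'I_m -> 'Hom(V, R^o)) (isB : pred 'I_m) :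
  alternating_form w -> k = (s + r)%N ->
  (forall x, x = \sum_l theta l x *: e l) ->
  (forall l v, ~~ isB l -> v \in B -> theta l v = 0) ->
  (forall l v, isB l -> v \in C -> theta l v = 0) ->
  (forall L : 'I_k -> 'I_m, #|[set i | ~~ isB (L i)]| != s ->
     w (fun i => e (L i)) = 0) ->
  bigraded_form B C s r w.
Proof.
move=> aw ks xe tB tC w0; split=> //.
have sortL (L : 'I_k -> 'I_m) : exists sg : {perm 'I_k},
    #|[set i | ~~ isB (L i)]| = s -> forall i, isB (L (sg i)) = (s <= i)%N.
  have [E|nE] := eqVneq #|[set i | ~~ isB (L i)]| s; last first.
    by exists 1%g => E; rewrite E eqxx in nE.
  by have [sg H] := sort_by_type E; exists sg.
have [sg Hsg] := choice sortL.
pose good (L : 'I_k -> 'I_m) := #|[set i | ~~ isB (L i)]| == s.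
pose Lf (l : 'I_#|{ffun 'I_k -> 'I_m}|) : {ffun 'I_k -> 'I_m} := enum_val l.
exists #|{ffun 'I_k -> 'I_m}|,
  (fun l => k`!%:R^-1 * w (fun i => e (Lf l (sg (Lf l) i)))),
  (fun l i => if good (Lf l) then theta (Lf l (sg (Lf l) i)) else 0).
split.
- move=> l i is_ v vB; case: ifP => [/eqP g|_]; last by rewrite lfunE.
  by apply: tB => //; rewrite Hsg // -ltnNge.
- move=> l i is_ v vB; case: ifP => [/eqP g|_]; last by rewrite lfunE.
  by apply: tC => //; rewrite Hsg.
- move=> v; rewrite (alt_det_expand v aw xe).
  rewrite (reindex (fun l => Lf l)) /=; last first.
    by apply: onW_bij; exists enum_rank; [exact: enum_valK|exact: enum_rankK].
  apply: eq_bigr => l _; set L := Lf l; have [g|ng] := boolP (good L).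
    have -> : w (fun i => e (L (sg L i))) = (-1) ^+ sg L * w (fun i => e (L i)).
      exact: (alt_perm aw (fun i => e (L i))).
    have -> : \det (\matrix_(i, j) theta (L (sg L i)) (v j)) =
        (-1) ^+ sg L * \det (\matrix_(i, j) theta (L i) (v j)).
      rewrite -det_perm -det_mulmx -row_permE; congr (\det _).
      by apply/matrixP => i j; rewrite !mxE.
    have ss : (-1) ^+ sg L * (-1) ^+ sg L = 1 :> R by rewrite -signr_addb addbb.
    set E : R := (-1) ^+ sg L in ss *.
    by rewrite -[LHS]mul1r -ss; ring.
  rewrite w0 // mulr0 mul0r.
  have -> : w (fun i => e (L (sg L i))) = (-1) ^+ sg L * w (fun i => e (L i)).
    exact: (alt_perm aw (fun i => e (L i))).
  by rewrite w0 // !mulr0 mul0r.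
Qed.

(** If the arguments i and j are equal, then exchanging the entries i and j of
    L keeps the product and changes the sign of the coefficient, so that the
    sum is its own opposite. *)
Lemma antisym_array_alternating m k (theta : 'I_m -> 'Hom(V, R^o))
    (a : ('I_k -> 'I_m) -> R) :
  (forall L i j, i != j -> a (L \o tperm i j) = - a L) ->
  alternating_form (fun v : 'I_k -> V => \sum_(L : {ffun 'I_k -> 'I_m})
     (\prod_i theta (L i) (v i)) * a L).
Proof.
move=> anti; split.
- move=> v i t x y; rewrite mulr_sumr -big_split /=; apply: eq_bigr => L _.
  rewrite mulrA -mulrDl; congr (_ * _).
  have P z : \prod_j theta (L j) (set_arg v i z j) =
      theta (L i) z * \prod_(j | j != i) theta (L j) (v j).
    rewrite (bigD1 i) //= set_arg_eq; congr (_ * _).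
    by apply: eq_bigr => j ji; rewrite /set_arg (negbTE ji).
  by rewrite !P linearP mulrDl mulrA.
- move=> v i j ij vij; set S := \sum_L _.
  suff : S = - S by move=> /eqP; rewrite -subr_eq0 opprK -mulr2n mulrn_eq0 /= => /eqP.
  rewrite {1}/S.
  pose h (L : {ffun 'I_k -> 'I_m}) := [ffun l => L (tperm i j l)].
  have hK : involutive h by move=> L; apply/ffunP => l; rewrite !ffunE tpermK.
  rewrite (reindex_inj (inv_inj hK)) /= /S -sumrN; apply: eq_bigr => L _.
  have -> : (h L : 'I_k -> 'I_m) = L \o tperm i j.
    by apply/funext => l; rewrite ffunE.
  rewrite anti // mulrN; congr (- (_ * _)).
  rewrite (reindex_inj (@perm_inj _ (tperm i j))) /=; apply: eq_bigr => l _.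
  rewrite tpermK; congr (theta _ _).
  by case: tpermP => [->|->|].
Qed.

End Bigraded.

(** * Smooth functions and derivations on manifolds *)

Section SmoothEuclidean.
Variables (R : realType) (n : nat).
Implicit Types (W : set 'rV[R]_n) (f g : 'rV[R]_n -> R).

Lemma smooth_eucl_local W f :
  (forall z, W z -> exists W', [/\ open W', W' z & smooth_eucl W' f]) ->
  smooth_eucl W f.
Proof. by move=> H s z /H[W' [_ W'z]]; exact. Qed.

Lemma smooth_eucl_sub W W' f : W' `<=` W -> smooth_eucl W f -> smooth_eucl W' f.
Proof. by move=> sW H s z /sW; exact: H. Qed.

Lemma smooth_eucl_ext W f g : open W -> (forall z, W z -> f z = g z) ->
  smooth_eucl W f -> smooth_eucl W g.
Proof.
by move=> oW fg /smooth_euclP H; apply/smooth_euclP => k; exact: Ck_ext (H k).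
Qed.

Lemma smooth_eucl_cst W (c : R) : open W -> smooth_eucl W (fun=> c).
Proof. by move=> oW; apply/smooth_euclP => k; exact: Ck_cst. Qed.

Lemma smooth_euclD W f g : open W -> smooth_eucl W f -> smooth_eucl W g ->
  smooth_eucl W (fun z => f z + g z).
Proof.
move=> oW /smooth_euclP Hf /smooth_euclP Hg.
by apply/smooth_euclP => k; exact: CkD.
Qed.

Lemma smooth_euclM W f g : open W -> smooth_eucl W f -> smooth_eucl W g ->
  smooth_eucl W (fun z => f z * g z).
Proof.
move=> oW /smooth_euclP Hf /smooth_euclP Hg.
by apply/smooth_euclP => k; exact: CkM.
Qed.

Lemma smooth_euclV W f : open W -> (forall z, W z -> f z != 0) ->
  smooth_eucl W f -> smooth_eucl W (fun z => (f z)^-1).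
Proof.
move=> oW f0 /smooth_euclP Hf.
by apply/smooth_euclP => k; exact: CkV.
Qed.

Lemma smooth_eucl_partial W f i : smooth_eucl W f ->
  smooth_eucl W ('D_(basis_vec R i) f).
Proof. by move=> H s z Wz; rewrite -iter_partial_rcons; exact: H. Qed.

End SmoothEuclidean.

Lemma smooth_eucl_comp (R : realType) n m (W : set 'rV[R]_n) (W' : set 'rV[R]_m)
    (g : 'rV[R]_n -> 'rV[R]_m) (f : 'rV[R]_m -> R) :
  open W -> open W' -> (forall z, W z -> W' (g z)) ->
  smooth_eucl W' f -> (forall j, smooth_eucl W (fun z => g z 0 j)) ->
  smooth_eucl W (fun z => f (g z)).
Proof.
move=> oW oW' WW' /smooth_euclP Hf Hg.
apply/smooth_euclP => k; apply: (Ck_comp k oW oW' WW' Hf) => j k'.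
by have /smooth_euclP := Hg j.
Qed.

Section SmoothManifold.
Variables (R : realType) (n : nat) (M : manifold R n).
Implicit Types (U V : set M) (f g : M -> R) (c d : chart R M n) (x : M).

(** Foliated charts are not assumed to belong to the atlas; smoothness of
    their transitions with it is what makes them usable as charts. *)
Definition compatible c := forall d, atlas d ->
  smooth_transition c d /\ smooth_transition d c.

Lemma atlas_compatible c : atlas c -> compatible c.
Proof. by move=> ac d ad; split; exact: atlas_smooth. Qed.

Definition pullback c U : set 'rV[R]_n := [set z | ccod c z /\ U (cinv c z)].

Lemma open_pullback c U : open U -> open (pullback c U).
Proof.
rewrite !openE => oU z [cz Uz]; apply: filterI.
  by have := @ccod_open _ _ _ c; rewrite openE; apply.
by have := cinv_cont cz; apply; exact: oU.
Qed.

Arguments open_pullback c {U} _.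

Lemma pullback_map c U x : cdom c x -> U x -> pullback c U (cmap c x).
Proof. by move=> cx Ux; split; [exact: cmap_cod|rewrite cmapK]. Qed.

Lemma smooth_fun_sub U V f : V `<=` U -> smooth_fun U f -> smooth_fun V f.
Proof.
by move=> VU H c ac; apply: smooth_eucl_sub (H c ac) => z [cz /VU].
Qed.

Lemma smooth_fun_local U f :
  (forall x, U x -> exists V, [/\ open V, V x & smooth_fun V f]) ->
  smooth_fun U f.
Proof.
move=> H c ac; apply: smooth_eucl_local => z [cz /H[V [oV Vz sf]]].
by exists (pullback c V); split=> //; [exact: open_pullback|exact: sf].
Qed.

Lemma smooth_fun_ext U f g : open U -> (forall x, U x -> f x = g x) ->
  smooth_fun U f -> smooth_fun U g.
Proof.
move=> oU fg H c ac; apply: smooth_eucl_ext (H c ac).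
  exact: open_pullback.
by move=> z [_ /fg].
Qed.

Lemma smooth_fun_cst U (a : R) : open U -> smooth_fun U (fun=> a).
Proof.
by move=> oU c _; apply: smooth_eucl_cst; exact: open_pullback.
Qed.

Lemma smooth_funD U f g : open U -> smooth_fun U f -> smooth_fun U g ->
  smooth_fun U (fun x => f x + g x).
Proof.
move=> oU Hf Hg c ac; apply: (@smooth_euclD _ _ _ (fun z => f (cinv c z))).
- exact: open_pullback.
- exact: Hf.
- exact: Hg.
Qed.

Lemma smooth_funM U f g : open U -> smooth_fun U f -> smooth_fun U g ->
  smooth_fun U (fun x => f x * g x).
Proof.
move=> oU Hf Hg c ac; apply: (@smooth_euclM _ _ _ (fun z => f (cinv c z))).
- exact: open_pullback.
- exact: Hf.
- exact: Hg.
Qed.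

Lemma smooth_funV U f : open U -> (forall x, U x -> f x != 0) ->
  smooth_fun U f -> smooth_fun U (fun x => (f x)^-1).
Proof.
move=> oU f0 Hf c ac; apply: (@smooth_euclV _ _ _ (fun z => f (cinv c z))).
- exact: open_pullback.
- by move=> z [_ /f0].
- exact: Hf.
Qed.

Lemma smooth_fun_sum U (I : Type) (s : seq I) (P : pred I) (F : I -> M -> R) :
  open U -> (forall i, P i -> smooth_fun U (F i)) ->
  smooth_fun U (fun x => \sum_(i <- s | P i) F i x).
Proof.
move=> oU H; elim: s => [|a s IH].
  by apply: smooth_fun_ext (smooth_fun_cst 0 oU) => // x _; rewrite big_nil.
case Pa : (P a).
  by apply: smooth_fun_ext (smooth_funD oU (H a Pa) IH) => // x _; rewrite big_cons Pa.
by apply: smooth_fun_ext IH => // x _; rewrite big_cons Pa.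
Qed.

Lemma smooth_fun_prod U (I : Type) (s : seq I) (P : pred I) (F : I -> M -> R) :
  open U -> (forall i, P i -> smooth_fun U (F i)) ->
  smooth_fun U (fun x => \prod_(i <- s | P i) F i x).
Proof.
move=> oU H; elim: s => [|a s IH].
  by apply: smooth_fun_ext (smooth_fun_cst 1 oU) => // x _; rewrite big_nil.
case Pa : (P a).
  by apply: smooth_fun_ext (smooth_funM oU (H a Pa) IH) => // x _; rewrite big_cons Pa.
by apply: smooth_fun_ext IH => // x _; rewrite big_cons Pa.
Qed.

Lemma smooth_fun_det U k (T : M -> 'M[R]_k) : open U ->
  (forall i j, smooth_fun U (fun x => T x i j)) ->
  smooth_fun U (fun x => \det (T x)).
Proof.
move=> oU H; apply: smooth_fun_sum => // s _; apply: smooth_funM => //.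
  exact: smooth_fun_cst.
by apply: smooth_fun_prod => // i _; exact: H.
Qed.

(** Cramer's rule. *)
Lemma smooth_fun_invmx U k (T : M -> 'M[R]_k) : open U ->
  (forall i j, smooth_fun U (fun x => T x i j)) ->
  (forall x, U x -> T x \in unitmx) ->
  forall i j, smooth_fun U (fun x => invmx (T x) i j).
Proof.
move=> oU H uT i j.
apply: (@smooth_fun_ext U (fun x => (\det (T x))^-1 * \adj (T x) i j)) => //.
  by move=> x Ux; rewrite /invmx uT // [RHS]mxE.
apply: smooth_funM => //.
  apply: smooth_funV => //; last exact: smooth_fun_det.
  by move=> x /uT; rewrite unitmxE unitfE.
apply: (@smooth_fun_ext U (fun x => cofactor (T x) j i)) => //.
  by move=> x _; rewrite mxE.
apply: smooth_funM => //; first exact: smooth_fun_cst.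
apply: smooth_fun_det => // a b.
by apply: smooth_fun_ext (H (lift j a) (lift i b)) => // x _; rewrite !mxE.
Qed.

Lemma smooth_in_chart U f c : compatible c -> open U -> smooth_fun U f ->
  smooth_eucl (pullback c U) (fun z => f (cinv c z)).
Proof.
move=> cc oU Hf; apply: smooth_eucl_local => z [cz Uz].
pose d := chart_at (cinv c z).
have dz : cdom d (cinv c z) by exact: chart_at_dom.
have ad : atlas d by exact: chart_at_atlas.
exists (pullback c (U `&` cdom d)); split.
- by apply: open_pullback; apply: openI => //; exact: cdom_open.
- by split.
have oW : open (pullback c (U `&` cdom d)).
  by apply: open_pullback; apply: openI => //; exact: cdom_open.
apply: (@smooth_eucl_ext _ _ _ (fun z => f (cinv d (cmap d (cinv c z))))) => //.
  by move=> w [_ [_ dw]]; rewrite cmapK.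
apply: (@smooth_eucl_comp _ _ _ _ (pullback d U)
  (fun z => cmap d (cinv c z)) (fun z => f (cinv d z))) => //.
- exact: open_pullback.
- by move=> w [_ [Uw dw]]; exact: pullback_map.
- exact: Hf.
- move=> j; have [+ _] := cc d ad; move=> /(_ j); apply: smooth_eucl_sub.
  by move=> w [cw [_ dw]].
Qed.

Lemma smooth_fun_chart U f c : compatible c -> open U -> U `<=` cdom c ->
  smooth_eucl (pullback c U) (fun z => f (cinv c z)) -> smooth_fun U f.
Proof.
move=> cc oU Uc Hf d ad.
have oW : open (pullback d U) by exact: open_pullback.
apply: (@smooth_eucl_ext _ _ _ (fun z => f (cinv c (cmap c (cinv d z))))) => //.
  by move=> w [_ /Uc dw]; rewrite cmapK.
apply: (@smooth_eucl_comp _ _ _ _ (pullback c U)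
  (fun z => cmap c (cinv d z)) (fun z => f (cinv c z))) => //.
- exact: open_pullback.
- by move=> w [_ Uw]; apply: pullback_map => //; exact: Uc.
- move=> j; have [_ +] := cc d ad; move=> /(_ j); apply: smooth_eucl_sub.
  by move=> w [cw /Uc].
Qed.

Lemma smooth_coord c j : compatible c ->
  smooth_fun (cdom c) (fun x => cmap c x 0 j).
Proof. by move=> cc d ad; have [_] := cc d ad; exact. Qed.

Lemma smooth_fun_continuous U f x : open U -> U x -> smooth_fun U f ->
  {for x, continuous f}.
Proof.
move=> oU Ux Hf; pose c := chart_at x.
have cx : cdom c x by exact: chart_at_dom.
have Hc := Hf c (chart_at_atlas x).
have [H _] := Hc [::] (cmap c x) (pullback_map cx Ux).
have fc : {for x, continuous (fun y => f (cinv c (cmap c y)))}.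
  exact: (@continuous_comp _ _ _ (cmap c) (fun z => f (cinv c z)) x (cmap_cont cx) H).
move=> A; rewrite -{1}[x](cmapK cx) => /fc fA.
have := @cdom_open _ _ _ c; rewrite openE => /(_ x cx) nc.
change (nbhs x (fun y => A (f y))).
by apply: (@filterS2 _ (nbhs x) _ _ _ _ _ nc fA) => y cy /=; rewrite cmapK.
Qed.

Lemma near_chart_at x (P : M -> Prop) : (\forall y \near x, P y) ->
  \forall z \near cmap (chart_at x) x, P (cinv (chart_at x) z).
Proof.
move=> nP; have cx := chart_at_dom x; have cc := cmap_cod cx.
by apply: (cinv_cont cc); rewrite cmapK.
Qed.

Lemma tder_near x (v : tangent x) f g : (\forall y \near x, f y = g y) ->
  tder v f = tder v g.
Proof. by move=> fg; apply: near_eq_derive; exact: (near_chart_at fg). Qed.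

Lemma tder_cst x (v : tangent x) (a : R) : tder v (fun=> a) = 0.
Proof. by rewrite /tder derive_cst. Qed.

Section Leibniz.
Variables (U : set M) (oU : open U) (x : M) (Ux : U x).

Lemma smooth_chart_at_Ck f k : smooth_fun U f ->
  Ck (pullback (chart_at x) U) k (fun z => f (cinv (chart_at x) z)).
Proof. by move=> /(_ _ (chart_at_atlas x)) /smooth_euclP; exact. Qed.

Lemma smooth_tder_differentiable f : smooth_fun U f ->
  differentiable (fun z => f (cinv (chart_at x) z)) (cmap (chart_at x) x).
Proof.
move=> /(smooth_chart_at_Ck 1) /Ck_differentiable H.
have [] // := H (open_pullback _ oU) (cmap (chart_at x) x).
by apply: pullback_map => //; exact: chart_at_dom.
Qed.

Lemma tderD (v : tangent x) f g : smooth_fun U f -> smooth_fun U g ->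
  tder v (fun y => f y + g y) = tder v f + tder v g.
Proof.
move=> /smooth_tder_differentiable df /smooth_tder_differentiable dg.
by rewrite /tder deriveD //; exact: diff_derivable.
Qed.

Lemma tderM (v : tangent x) f g : smooth_fun U f -> smooth_fun U g ->
  tder v (fun y => f y * g y) = f x * tder v g + g x * tder v f.
Proof.
move=> /smooth_tder_differentiable df /smooth_tder_differentiable dg.
rewrite /tder deriveM; [|exact: diff_derivable|exact: diff_derivable].
by rewrite !cmapK //; exact: chart_at_dom.
Qed.

Lemma tder_linear (a : R) (v w : tangent x) f : smooth_fun U f ->
  tder (a *: (v : 'rV[R]_n) + w : tangent x) f = a * tder v f + tder w f.
Proof.
move=> /(smooth_chart_at_Ck 1) /Ck_differentiable H.
have [|_ D] := H (open_pullback _ oU) (cmap (chart_at x) x).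
  by apply: pullback_map => //; exact: chart_at_dom.
by rewrite /tder !D linearD linearZ.
Qed.

(** The chain rule: tder is computed in the distinguished chart at x, but
    foliated charts are the ones in which leafwise derivatives are visible. *)
Lemma tder_chart (v : tangent x) f c : compatible c -> cdom c x ->
  smooth_fun U f ->
  tder v f = \sum_j tcomp v c j *
    'D_(basis_vec R j) (fun z => f (cinv c z)) (cmap c x).
Proof.
move=> cc cx Hf; pose a := chart_at x.
have ax : cdom a x by exact: chart_at_dom.
have aa : atlas a by exact: chart_at_atlas.
have -> : tder v f = tder v (fun y => f (cinv c (cmap c y))).
  apply: tder_near; have := @cdom_open _ _ _ c; rewrite openE => /(_ x cx).
  by apply: filterS => y cy; rewrite cmapK.
have oW : open (pullback a (U `&` cdom c)).
  by apply: open_pullback; apply: openI => //; exact: cdom_open.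
have Wx : pullback a (U `&` cdom c) (cmap a x) by exact: pullback_map.
have E : cmap c (cinv a (cmap a x)) = cmap c x by rewrite cmapK.
have := @chain_rule R n n (pullback a (U `&` cdom c)) (pullback c U)
  (fun z => cmap c (cinv a z)) (fun z => f (cinv c z)) (cmap a x) v oW
  (open_pullback _ oU) Wx.
move=> H; have [||j|_ D] := H.
- by rewrite E; exact: pullback_map.
- by have /smooth_euclP := smooth_in_chart cc oU Hf; exact.
- have [_ +] := cc a aa; move=> /(_ j) /smooth_euclP /(_ 1%N).
  by apply: Ck_sub; move=> w [aw [_ cw]].
- by apply: (etrans D); rewrite E.
Qed.

End Leibniz.

Lemma smooth_tder U (X : forall x : M, tangent x) f : open U ->
  smooth_vfield U X -> smooth_fun U f -> smooth_fun U (fun x => tder (X x) f).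
Proof.
move=> oU HX Hf; apply: smooth_fun_local => x Ux; pose c := chart_at x.
have cx : cdom c x by exact: chart_at_dom.
have ac : atlas c by exact: chart_at_atlas.
have cc := atlas_compatible ac.
have oV : open (U `&` cdom c) by apply: openI => //; exact: cdom_open.
exists (U `&` cdom c); split=> //.
apply: (@smooth_fun_ext _ (fun y => \sum_j tcomp (X y) c j *
    'D_(basis_vec R j) (fun z => f (cinv c z)) (cmap c y))) => //.
  by move=> y [Uy cy]; rewrite -(tder_chart oU Uy).
apply: smooth_fun_sum => // j _; apply: smooth_funM => //; first exact: HX.
apply: (smooth_fun_chart cc oV) => [y []//|].
apply: (@smooth_eucl_ext _ _ _ ('D_(basis_vec R j) (fun z => f (cinv c z)))).
- exact: open_pullback.
- by move=> z [cz _]; rewrite cinvK.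
- apply: smooth_eucl_partial; apply: smooth_in_chart => //.
  by apply: smooth_fun_sub Hf => y [].
Qed.

(** The set S is the image of a closed ball of the chart: it is compact, hence
    closed because M is Hausdorff, and therefore the extension by 0 outside
    the chart is smooth. *)
Lemma bump_manifold x U : open U -> U x -> exists (chi : M -> R) (S : set M),
  [/\ smooth_fun setT chi, closed S, S `<=` U,
      forall y, ~ S y -> chi y = 0 & \forall y \near x, chi y = 1].
Proof.
move=> oU Ux; pose c := chart_at x.
have cx : cdom c x by exact: chart_at_dom.
have ac : atlas c by exact: chart_at_atlas.
have cc := atlas_compatible ac.
have : nbhs (cmap c x) (pullback c U).
  by apply: open_nbhs_nbhs; split; [exact: open_pullback|exact: pullback_map].
move=> /nbhs_ballP[d /= d0 Hd].
have d2 : 0 < d / 2 by rewrite divr_gt0.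
have [phi [sphi phi1 phi0]] := bump_eucl (cmap c x) d2.
pose K := [set z : 'rV[R]_n | `|z - cmap c x| <= d / 2].
have KW z : K z -> pullback c U z.
  move=> Kz; apply: Hd; rewrite -ball_normE /= distrC (le_lt_trans Kz) //.
  by rewrite ltr_pdivrMr // ltr_pMr // ltr1n.
have cK : compact K.
  apply: bounded_closed_compact.
    exists (`|cmap c x| + d / 2); split; first exact: num_real.
    move=> y ly z Kz; apply: ltW; apply: le_lt_trans ly.
    by rewrite -[z](subrK (cmap c x)) addrC (le_trans (ler_normD _ _)) // lerD2l.
  have -> : K = closed_ball (cmap c x) (d / 2).
    rewrite closed_ballE //; apply/seteqP; split=> z;
      by rewrite /K /closed_ball_ /= distrC.
  exact: closed_ball_closed.
pose S := cinv c @` K.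
have cS : closed S.
  apply: compact_closed; first exact: mhausdorff.
  apply: continuous_compact => //; apply: continuous_in_subspaceT => z /set_mem /KW[cz _].
  exact: cinv_cont.
(* cmap c y is meaningless outside the domain of c. *)
pose chi y := if `[< cdom c y >] then phi (cmap c y) else 0.
have chi_in y : cdom c y -> chi y = phi (cmap c y) by rewrite /chi => cy; case: asboolP.
have chi0 y : ~ S y -> chi y = 0.
  move=> nS; rewrite /chi; case: asboolP => // cy; apply: phi0.
  rewrite leNgt; apply/negP => /ltW Ky; apply: nS; exists (cmap c y) => //.
  by rewrite cmapK.
exists chi, S; split=> //.
- apply: smooth_fun_local => y _; have [cy|ncy] := pselect (cdom c y).
    exists (cdom c); split=> //; first exact: cdom_open.
    apply: (smooth_fun_chart cc (cdom_open c)) => //.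
    apply: (@smooth_eucl_ext _ _ _ phi).
    + by apply: open_pullback; exact: cdom_open.
    + by move=> z [cz dz]; rewrite chi_in // cinvK.
    + by apply/smooth_euclP => k; apply: Ck_sub (sphi k).
  have oS : open (~` S) by exact: closed_openC.
  exists (~` S); split=> //.
    by move=> [z /KW[cz _] zy]; apply: ncy; rewrite -zy; exact: cinv_dom.
  by apply: smooth_fun_ext (smooth_fun_cst 0 oS) => // z /chi0.
- by move=> y [z /KW[_ Uz] <-].
- have n1 := cmap_cont cx phi1.
  have := @cdom_open _ _ _ c; rewrite openE => /(_ x cx) nc.
  apply: (@filterS2 _ (nbhs x) _ _ _ _ _ nc n1) => y cy /= H.
  by rewrite chi_in.
Qed.

Lemma smooth_fun_extend U f (chi : M -> R) (S : set M) : open U ->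
  smooth_fun U f -> smooth_fun setT chi -> closed S -> S `<=` U ->
  (forall y, ~ S y -> chi y = 0) -> smooth_fun setT (fun y => chi y * f y).
Proof.
move=> oU Hf Hchi cS SU chi0; apply: smooth_fun_local => x _.
have [Ux|nUx] := pselect (U x).
  exists U; split=> //; apply: smooth_funM; [exact: oU| |exact: Hf].
  by apply: smooth_fun_sub Hchi.
have oS : open (~` S) by exact: closed_openC.
exists (~` S); split=> //; first by move=> /SU.
by apply: smooth_fun_ext (smooth_fun_cst 0 oS) => // z /chi0 ->; rewrite mul0r.
Qed.

End SmoothManifold.

(** * Frames and sections of vector bundles *)

Section VectorBasis.
Variables (R : realType) (V : vectType R) (m : nat).

Lemma basis_coord (X : 'I_m -> V) v : basis_of fullv [tuple X l | l < m] ->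
  v = \sum_l coord [tuple X l | l < m] l v *: X l.
Proof.
move=> bX; rewrite {1}(coord_basis bX (memvf v)).
by apply: eq_bigr => l _; rewrite -tnth_nth tnth_mktuple.
Qed.

Lemma coord_basis_sum (X : 'I_m -> V) (k : 'I_m -> R) i :
  free [tuple X l | l < m] ->
  coord [tuple X l | l < m] i (\sum_l k l *: X l) = k i.
Proof.
move=> fX; rewrite -[RHS](coord_sum_free k i fX); congr (coord _ _ _).
by apply: eq_bigr => l _; rewrite -tnth_nth tnth_mktuple.
Qed.

Definition change_mx (X Y : 'I_m -> V) : 'M[R]_m :=
  \matrix_(l, j) coord [tuple X l | l < m] j (Y l).

(** Turns the question whether Y is a basis into one about a determinant. *)
Lemma change_mx_unit (X Y : 'I_m -> V) : basis_of fullv [tuple X l | l < m] ->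
  (change_mx X Y \in unitmx) = basis_of fullv [tuple Y l | l < m].
Proof.
move=> bX; have fX := basis_free bX.
have dV : \dim {:V} = m by rewrite -(size_basis bX) .
apply/idP/idP => [uP|bY].
  rewrite basisEfree size_tuple dV leqnn andbT subvf andbT.
  apply/freeP => k Hk i.
  suff : \row_l k l *m change_mx X Y = 0.
    move/(congr1 (mulmx^~ (invmx (change_mx X Y)))).
    by rewrite mulmxK // mul0mx => /rowP /(_ i); rewrite !mxE.
  apply/rowP => j; rewrite !mxE.
  have Hk' : \sum_l k l *: Y l = 0.
    by rewrite -[RHS]Hk; apply: eq_bigr => l _; rewrite -tnth_nth tnth_mktuple.
  have := congr1 (coord [tuple X l | l < m] j) Hk'.
  rewrite linear_sum linear0 => H; apply: etrans H.
  by apply: eq_bigr => l _; rewrite !mxE linearZ.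
have fY := basis_free bY.
have /mulmx1_unit[] // : change_mx X Y *m change_mx Y X = 1%:M.
apply/matrixP => i j; rewrite !mxE.
have E : coord [tuple Y l | l < m] j (Y i) = (i == j)%:R.
  have -> : Y i = \sum_l (i == l)%:R *: Y l.
    rewrite (bigD1 i) //= eqxx scale1r big1 ?addr0 // => l li.
    by rewrite eq_sym (negbTE li) scale0r.
  by rewrite coord_basis_sum.
rewrite -E {1}(basis_coord (Y i) bX) linear_sum.
by apply: eq_bigr => l _; rewrite !mxE linearZ.
Qed.

Lemma coord_change (X Y : 'I_m -> V) v i :
  basis_of fullv [tuple X l | l < m] -> basis_of fullv [tuple Y l | l < m] ->
  coord [tuple Y l | l < m] i v =
  \sum_j coord [tuple X l | l < m] j v * invmx (change_mx X Y) j i.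
Proof.
move=> bX bY; have uP : change_mx X Y \in unitmx by rewrite change_mx_unit.
have H : \row_j coord [tuple X l | l < m] j v =
    \row_l coord [tuple Y l | l < m] l v *m change_mx X Y.
  apply/rowP => j; rewrite !mxE {1}(basis_coord v bY) linear_sum.
  by apply: eq_bigr => l _; rewrite !mxE linearZ.
have := congr1 (mulmx^~ (invmx (change_mx X Y))) H.
rewrite mulmxK // => /rowP/(_ i); rewrite !mxE => <-.
by apply: eq_bigr => j _; rewrite mxE.
Qed.

Lemma daddv_pi_sum (B C : {vspace V}) b c : (B :&: C = 0)%VS ->
  b \in B -> c \in C -> daddv_pi B C (b + c) = b.
Proof.
move=> BC bB cC; rewrite linearD /= daddv_pi_id //.
suff -> : daddv_pi B C c = 0 by rewrite addr0.
have := daddv_pi_add BC (memv_add (mem0v B) cC).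
rewrite add0r (@daddv_pi_id _ _ C B c) 1?capvC // => /eqP.
by rewrite addrC -subr_eq0 addrAC subrr add0r => /eqP.
Qed.

End VectorBasis.

Section Sections.
Variables (R : realType) (n : nat) (M : manifold R n) (m : nat) (E : vbundle M m).
Implicit Types (U W : set M) (s t : section E) (f : M -> R).

Lemma frame_dim x : \dim {:E x} = m.
Proof.
have [e fe ex] := frames_cover E x.
exact: (size_basis (frames_basis fe ex)).
Qed.

Lemma smooth_section_sub U W s : W `<=` U -> smooth_section U s -> smooth_section W s.
Proof.
by move=> WU H e fe i; apply: smooth_fun_sub (H e fe i) => x [/WU].
Qed.

Lemma open_frame U e : open U -> @frames _ _ _ _ E e -> open (U `&` e.1).
Proof. by move=> oU /frames_open; exact: openI. Qed.

Lemma smooth_section_local U s :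
  (forall x, U x -> exists W, [/\ open W, W x & smooth_section W s]) ->
  smooth_section U s.
Proof.
move=> H e fe i; apply: smooth_fun_local => x [Ux ex].
have [W [oW Wx sW]] := H x Ux.
by exists (W `&` e.1); split=> //; [exact: open_frame|exact: sW].
Qed.

Lemma smooth_section_ext U s t : open U -> (forall x, U x -> s x = t x) ->
  smooth_section U s -> smooth_section U t.
Proof.
move=> oU st H e fe i; apply: smooth_fun_ext (H e fe i).
  exact: open_frame.
by move=> x [/st ->].
Qed.

Lemma smooth_section0 U : open U -> smooth_section U (fun x => 0 : E x).
Proof.
move=> oU e fe i; have oW := open_frame oU fe.
by apply: smooth_fun_ext (smooth_fun_cst 0 oW) => // x _; rewrite linear0.
Qed.

Lemma smooth_sectionD U s t : open U -> smooth_section U s -> smooth_section U t ->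
  smooth_section U (fun x => s x + t x).
Proof.
move=> oU Hs Ht e fe i; have oW := open_frame oU fe.
apply: smooth_fun_ext (smooth_funD oW (Hs e fe i) (Ht e fe i)) => // x _.
by rewrite linearD.
Qed.

Lemma smooth_sectionZ U f s : open U -> smooth_fun U f -> smooth_section U s ->
  smooth_section U (fun x => f x *: s x).
Proof.
move=> oU Hf Hs e fe i; have oW := open_frame oU fe.
have Hf' : smooth_fun (U `&` e.1) f by apply: smooth_fun_sub Hf => x [].
apply: smooth_fun_ext (smooth_funM oW Hf' (Hs e fe i)) => // x _.
by rewrite linearZ.
Qed.

Lemma smooth_section_sum U (I : Type) (r : seq I) (P : pred I)
    (F : I -> section E) : open U -> (forall i, P i -> smooth_section U (F i)) ->
  smooth_section U (fun x => \sum_(i <- r | P i) F i x).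
Proof.
move=> oU H; elim: r => [|a r IH].
  by apply: smooth_section_ext (smooth_section0 oU) => // x _; rewrite big_nil.
case Pa : (P a).
  by apply: smooth_section_ext (smooth_sectionD oU (H a Pa) IH) => // x _; rewrite big_cons Pa.
by apply: smooth_section_ext IH => // x _; rewrite big_cons Pa.
Qed.

Lemma smooth_change_mx U e (e' : 'I_m -> section E) : @frames _ _ _ _ E e ->
  (forall l, smooth_section U (e' l)) -> forall i j,
  smooth_fun (U `&` e.1)
    (fun x => change_mx (fun l => e.2 l x) (fun l => e' l x) i j).
Proof.
move=> fe H i j c ac.
have -> : (fun z => change_mx (fun l => e.2 l (cinv c z)) (fun l => e' l (cinv c z)) i j) =
   (fun z => coord [tuple e.2 l (cinv c z) | l < m] j (e' i (cinv c z))).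
  by apply/funext => z; rewrite mxE.
exact: H.
Qed.

(** Passing from a frame of the bundle atlas to e' multiplies the coordinates
    by the inverse of a smooth matrix. *)
Lemma smooth_frame_coord U (e' : 'I_m -> section E) s : open U ->
  (forall l, smooth_section U (e' l)) ->
  (forall x, U x -> basis_of fullv [tuple e' l x | l < m]) ->
  smooth_section U s -> forall i,
  smooth_fun U (fun x => coord [tuple e' l x | l < m] i (s x)).
Proof.
move=> oU He' be' Hs i; apply: smooth_fun_local => x Ux.
have [e fe ex] := frames_cover E x; have oW := open_frame oU fe.
exists (U `&` e.1); split=> //.
apply: (@smooth_fun_ext _ _ _ _ (fun y =>
  \sum_j coord [tuple e.2 l y | l < m] j (s y) *
     invmx (change_mx (fun l => e.2 l y) (fun l => e' l y)) j i)) => //.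
  move=> y [Uy ey]; rewrite -coord_change //; [exact: frames_basis|exact: be'].
apply: smooth_fun_sum => // j _; apply: smooth_funM => //; first exact: Hs.
apply: smooth_fun_invmx => //; first exact: smooth_change_mx.
by move=> y [Uy ey]; rewrite change_mx_unit; [exact: be'|exact: frames_basis].
Qed.

(** A basis at x has nonzero determinant in a frame of the bundle atlas, and
    this persists near x. *)
Lemma frame_near U (e' : 'I_m -> section E) x : open U -> U x ->
  (forall l, smooth_section U (e' l)) ->
  basis_of fullv [tuple e' l x | l < m] ->
  \forall y \near x, basis_of fullv [tuple e' l y | l < m].
Proof.
move=> oU Ux He' bx; have [e fe ex] := frames_cover E x.
have oW := open_frame oU fe; have Wx : (U `&` e.1) x by [].
pose dt y := \det (change_mx (fun l => e.2 l y) (fun l => e' l y)).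
have sd : smooth_fun (U `&` e.1) dt.
  by apply: smooth_fun_det => //; exact: smooth_change_mx.
have cd := smooth_fun_continuous oW Wx sd.
have d0 : dt x != 0.
  by rewrite -unitfE -unitmxE change_mx_unit //; exact: frames_basis.
have n1 : \forall y \near x, dt y != 0.
  have : nbhs (dt x) [set t | t != 0].
    apply: open_nbhs_nbhs; split=> //; exact: open_neq.
  by move=> /cd.
have n2 := open_nbhs_nbhs (conj oW Wx).
apply: (@filterS2 _ (nbhs x) _ _ _ _ _ n1 n2) => y dy [Uy ey].
rewrite -(change_mx_unit (X := fun l => e.2 l y)); last exact: frames_basis.
by rewrite unitmxE unitfE.
Qed.

(** Brackets take sections over all of M as arguments, so that local sections
    enter them only after multiplication with a bump function. *)
Lemma smooth_section_extend U s (chi : M -> R) (S : set M) : open U ->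
  smooth_section U s -> smooth_fun setT chi -> closed S -> S `<=` U ->
  (forall y, ~ S y -> chi y = 0) ->
  smooth_section setT (fun y => chi y *: s y).
Proof.
move=> oU Hs Hchi cS SU chi0; apply: smooth_section_local => x _.
have [Ux|nUx] := pselect (U x).
  exists U; split=> //; apply: smooth_sectionZ; [exact: oU| |exact: Hs].
  by apply: smooth_fun_sub Hchi.
have oS : open (~` S) by exact: closed_openC.
exists (~` S); split=> //; first by move=> /SU.
apply: smooth_section_ext (smooth_section0 oS) => // z /chi0 ->.
by rewrite scale0r.
Qed.

Lemma complement_basis (B C : forall x, {vspace E x}) x r r'
    (b : 'I_r -> E x) (c : 'I_r' -> E x) :
  (B x + C x = fullv)%VS -> (B x :&: C x = 0)%VS ->
  basis_of (B x) [tuple b i | i < r] -> basis_of (C x) [tuple c i | i < r'] ->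
  forall (rm : m = (r + r')%N),
  basis_of fullv [tuple (match fintype.split (cast_ord rm l) with
     | inl i => b i | inr j => c j end) | l < m].
Proof.
move=> BCf BC0 bb bc rm; rewrite basisEdim size_tuple frame_dim leqnn andbT.
set X := [tuple _ | l < m].
have bX i : b i \in <<X>>%VS.
  apply: memv_span; apply/tnthP; exists (cast_ord (esym rm) (lshift r' i)).
  rewrite tnth_mktuple cast_ordKV; have := unsplitK (inl i : 'I_r + 'I_r').
  by move=> /= ->.
have cX i : c i \in <<X>>%VS.
  apply: memv_span; apply/tnthP; exists (cast_ord (esym rm) (rshift r i)).
  rewrite tnth_mktuple cast_ordKV; have := unsplitK (inr i : 'I_r + 'I_r').
  by move=> /= ->.
rewrite -BCf subv_add; apply/andP; split.
  rewrite -(span_basis bb); apply/span_subvP => y /tnthP[i ->].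
  by rewrite tnth_mktuple.
rewrite -(span_basis bc); apply/span_subvP => y /tnthP[i ->].
by rewrite tnth_mktuple.
Qed.

Section Projections.
Variables (B C : forall x, {vspace E x}) (dBC : bundle_decomposition B C).

Lemma decomposition_cap x : (B x :&: C x = 0)%VS.
Proof. by case: dBC => _ _ /(_ x) []. Qed.

Lemma decomposition_add x : (B x + C x = fullv)%VS.
Proof. by case: dBC => _ _ /(_ x) []. Qed.

(** Local bases of B and of C together form a frame, in which the projection
    keeps some of the coordinates and drops the others. *)
Lemma smooth_proj_section b U s : open U -> smooth_section U s ->
  smooth_section U (proj_section B C b s).
Proof.
move=> oU Hs; case: dBC => sB sC _; apply: smooth_section_local => x0 Ux0.
have [UB [r [eB [oB xB HB bB]]]] := sB x0.
have [UC [r' [eC [oC xC HC bC]]]] := sC x0.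
pose W := U `&` (UB `&` UC).
have oW : open W by apply: openI => //; exact: openI.
have rm : m = (r + r')%N.
  rewrite -(frame_dim x0) -(decomposition_add x0) dimv_disjoint_sum.
    by rewrite (size_basis (bB x0 xB)) (size_basis (bC x0 xC)).
  exact: decomposition_cap.
pose e l : section E := match fintype.split (cast_ord rm l) with
     | inl i => eB i | inr j => eC j end.
have eE y : [tuple e l y | l < m] = [tuple (match fintype.split (cast_ord rm l) with
     | inl i => eB i y | inr j => eC j y end) | l < m].
  by apply: eq_mktuple => l; rewrite /e; case: fintype.split.
have be y : W y -> basis_of fullv [tuple e l y | l < m].
  move=> [_ [By Cy]]; rewrite eE; apply: (@complement_basis B C).
  - exact: decomposition_add.
  - exact: decomposition_cap.
  - exact: bB.
  - exact: bC.
have se l : smooth_section W (e l).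
  rewrite /e; case: fintype.split => i.
    by apply: smooth_section_sub (HB i) => y [_ []].
  by apply: smooth_section_sub (HC i) => y [_ []].
have sW : smooth_section W s by apply: smooth_section_sub Hs => y [].
exists W; split=> //.
pose isC l := if fintype.split (cast_ord rm l) is inr _ then true else false.
pose th l y := coord [tuple e l y | l < m] l (s y).
have sp c : smooth_section W (fun y => \sum_(l | isC l == c) th l y *: e l y).
  apply: smooth_section_sum => // l _.
  apply: smooth_sectionZ; [exact: oW|exact: smooth_frame_coord|exact: se].
apply: smooth_section_ext (sp b) => // y Wy; have [_ [By Cy]] := Wy.
have inB : \sum_(l | isC l == false) th l y *: e l y \in B y.
  apply: memv_suml => l; rewrite /isC /e; case: fintype.split => // i _.
  apply: memvZ; rewrite -(span_basis (bB y By)); apply: memv_span.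
  by apply/tnthP; exists i; rewrite tnth_mktuple.
have inC : \sum_(l | isC l == true) th l y *: e l y \in C y.
  apply: memv_suml => l; rewrite /isC /e; case: fintype.split => // i _.
  apply: memvZ; rewrite -(span_basis (bC y Cy)); apply: memv_span.
  by apply/tnthP; exists i; rewrite tnth_mktuple.
have sE : s y = \sum_(l | isC l == false) th l y *: e l y +
    \sum_(l | isC l == true) th l y *: e l y.
  rewrite {1}(basis_coord (s y) (be y Wy)) (bigID (fun l => isC l == false)) /=.
  by congr (_ + _); apply: eq_bigl => l; case: (isC l).
rewrite /proj_section; case: b => /=; rewrite sE.
  by rewrite addrC daddv_pi_sum // capvC decomposition_cap.
by rewrite daddv_pi_sum // decomposition_cap.
Qed.

End Projections.
End Sections.

(** * Tensoriality of the differential *)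

Section Tensoriality.
Variables (R : realType) (n : nat) (M : manifold R n) (m : nat) (E : vbundle M m).

Definition smooth_args k (a : 'I_k -> section E) := forall i, smooth_section setT (a i).

Lemma smooth_set_arg k (a : 'I_k -> section E) i s : smooth_args a ->
  smooth_section setT s -> smooth_args (set_arg a i s).
Proof. by move=> sa ss j; rewrite /set_arg; case: eqP. Qed.

Lemma set_arg_at k (a : 'I_k -> section E) i s x :
  (fun j => set_arg a i s j x) = set_arg (fun j => a j x) i (s x).
Proof. by apply/funext => j; rewrite /set_arg; case: eqP. Qed.

Lemma smooth_combine (g : M -> R) (s t : section E) :
  smooth_fun setT g -> smooth_section setT s -> smooth_section setT t ->
  smooth_section setT (fun y => g y *: s y + t y).
Proof.
move=> sg ss st.
exact: (smooth_sectionD openT (smooth_sectionZ openT sg ss) st).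
Qed.

(** Linearity over functions in each argument, at the point x. It is what
    makes an operator on sections a form: its values at x then depend on the
    values of the sections at x alone. *)
Definition tensorial_at k (W : ('I_k -> section E) -> M -> R) x :=
  forall (a : 'I_k -> section E) i (g : M -> R) (s t : section E),
    smooth_args a -> smooth_fun setT g -> smooth_section setT s ->
    smooth_section setT t ->
    W (set_arg a i (fun y => g y *: s y + t y)) x =
    g x * W (set_arg a i s) x + W (set_arg a i t) x.

(** With a bump function chi at x and a frame e near x, the section d is the
    sum of (1 - chi ^ 2) d and of the (chi d_l) (chi e_l). All these
    coefficients are global smooth functions that vanish at x. *)
Lemma tensor_local (phi : section E -> R) x (d : section E) :
  (forall (g : M -> R) (s t : section E), smooth_fun setT g ->
     smooth_section setT s -> smooth_section setT t ->
     phi (fun y => g y *: s y + t y) = g x * phi s + phi t) ->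
  smooth_section setT d -> d x = 0 -> phi d = 0.
Proof.
move=> phiL sd dx0.
have s0 : smooth_section setT (fun x => 0 : E x) by apply: smooth_section0; exact: openT.
have phi0 : phi (fun x => 0) = 0.
  have := phiL (fun=> 1) _ _ (smooth_fun_cst 1 openT) s0 s0.
  have -> : (fun y => 1 *: 0 + 0) = (fun y => 0 : E y).
    by apply: functional_extensionality_dep => y; rewrite scaler0 addr0.
  by rewrite mul1r => /eqP; rewrite -subr_eq subrr eq_sym => /eqP.
have [e fe ex] := frames_cover E x.
have oe := frames_open fe.
have [chi [S [schi cS Se chi0 chi1]]] := bump_manifold oe ex.
have chix : chi x = 1 := nbhs_singleton chi1.
have se l : smooth_section setT (fun y => chi y *: e.2 l y).
  apply: (smooth_section_extend (U := e.1) (S := S)) => //.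
  move=> e' fe' i; have := frames_smooth fe fe' l i; apply: smooth_fun_sub.
  by [].
have sc l : smooth_fun setT (fun y => chi y * coord [tuple e.2 i y | i < m] l (d y)).
  apply: (smooth_fun_extend (U := e.1) (S := S)) => //.
  have := sd e fe l; apply: smooth_fun_sub => y ey; by split.
(* The coefficient of d itself in its decomposition. *)
pose h y := 1 + -1 * (chi y * chi y).
have sh : smooth_fun setT h.
  apply: smooth_funD; [exact: openT|apply: smooth_fun_cst; exact: openT|].
  apply: smooth_funM; [exact: openT|apply: smooth_fun_cst; exact: openT|].
  by apply: smooth_funM => //; exact: openT.
pose part (r : seq 'I_m) : section E := fun y =>
  \sum_(l <- r) (chi y * coord [tuple e.2 i y | i < m] l (d y)) *: (chi y *: e.2 l y).
have sp r : smooth_section setT (part r).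
  apply: (smooth_section_sum _ openT) => l _.
  exact: (smooth_sectionZ openT (sc l) (se l)).
have dE : d = (fun y => h y *: d y + part (index_enum _) y).
  apply: functional_extensionality_dep => y; rewrite /part.
  have [ey|ney] := pselect (e.1 y).
    have H : part (index_enum _) y = (chi y * chi y) *: d y.
      rewrite {1}(basis_coord (d y) (frames_basis fe ey)) scaler_sumr.
      apply: eq_bigr => l _; rewrite !scalerA; congr (_ *: _); ring.
    rewrite -/(part _ y) H -scalerDl.
    by have -> : h y + chi y * chi y = 1; [rewrite /h; ring|rewrite scale1r].
  have c0 : chi y = 0 by apply: chi0 => /Se.
  rewrite big1 => [|l _]; last by rewrite c0 mul0r scale0r.
  by rewrite addr0 /h c0 mul0r mulr0 addr0 scale1r.
have phip r : phi (part r) = 0.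
  elim: r => [|l r IH].
    rewrite -[RHS]phi0; congr phi; apply: functional_extensionality_dep => y.
    by rewrite /part big_nil.
  have -> : part (l :: r) = (fun y =>
      (chi y * coord [tuple e.2 i y | i < m] l (d y)) *: (chi y *: e.2 l y) + part r y).
    by apply: functional_extensionality_dep => y; rewrite /part big_cons.
  by rewrite (phiL _ _ _ (sc l) (se l) (sp r)) IH dx0 linear0 mulr0 mul0r addr0.
rewrite dE (phiL _ _ _ sh sd (sp _)) phip addr0 /h chix.
by rewrite mulr1 mulN1r subrr mul0r.
Qed.

(** The arguments are exchanged one at a time. *)
Lemma tensorial_pointwise k (W : ('I_k -> section E) -> M -> R) x a a' :
  tensorial_at W x -> smooth_args a -> smooth_args a' ->
  (forall i, a i x = a' i x) -> W a x = W a' x.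
Proof.
move=> tW sa sa' aa'.
have slot b i s s' : smooth_args b -> smooth_section setT s ->
    smooth_section setT s' -> s x = s' x -> W (set_arg b i s) x = W (set_arg b i s') x.
  move=> sb ss ss' ssx.
  pose d : section E := fun y => s y + -1 *: s' y.
  have sm1 : smooth_fun setT (fun _ : M => (-1) : R).
    by apply: smooth_fun_cst; exact: openT.
  have sd : smooth_section setT d.
    exact: (smooth_sectionD openT ss (smooth_sectionZ openT sm1 ss')).
  have d0 : d x = 0 by rewrite /d ssx scaleN1r subrr.
  have H := tensor_local (phi := fun s => W (set_arg b i s) x) (x := x) _ sd d0.
  have s1 : smooth_fun setT (fun _ : M => 1 : R).
    by apply: smooth_fun_cst; exact: openT.
  have -> : s = (fun y => 1 *: d y + s' y).
    apply: functional_extensionality_dep => y.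
    by rewrite scale1r /d scaleN1r subrK.
  rewrite tW // H ?mulr0 ?add0r // => g s1' t1' sg' ss1 st1.
  exact: tW.
have H h : (h <= k)%N -> W (fun i : 'I_k => if (i < h)%N then a' i else a i) x = W a x.
  elim: h => [|h IH] hk; first by congr W.
  rewrite -(IH (ltnW hk)); pose ih := Ordinal hk.
  set b := fun i : 'I_k => if (i < h)%N then a' i else a i.
  have sb : smooth_args b by move=> i; rewrite /b; case: ifP.
  have -> : (fun i : 'I_k => if (i < h.+1)%N then a' i else a i) = set_arg b ih (a' ih).
    apply/funext => i; rewrite /set_arg /b ltnS [(i <= h)%N]leq_eqVlt.
    have [->|ni] := eqVneq i ih; first by rewrite /= eqxx.
    by rewrite -(inj_eq val_inj) /= in ni; rewrite (negbTE ni).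
  have {2}-> : b = set_arg b ih (a ih).
    apply/funext => i; rewrite /set_arg; case: eqP => // ->.
    by rewrite /b ltnn.
  exact: slot.
rewrite -(H k (leqnn k)); congr (W _ x); apply/funext => i.
by rewrite ltn_ord.
Qed.

Lemma tensorial_eval_form k (w : aform E k) U x : aform_on U w -> U x ->
  tensorial_at (eval_form w) x.
Proof.
move=> [aw _] Ux a i g s t _ _ _ _; rewrite /eval_form !set_arg_at.
by have [wl _] := aw x Ux.
Qed.

Lemma tensorial_type_component k (W : ('I_k -> section E) -> M -> R) s x
    (B C : forall x, {vspace E x}) : bundle_decomposition B C ->
  tensorial_at W x -> tensorial_at (type_component B C s W) x.
Proof.
move=> dBC tW a i g s1 t1 sa sg ss st; rewrite /type_component mulr_sumr -big_split /=.
apply: eq_bigr => S _.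
have P Q : (fun j => proj_section B C (j \in S) (set_arg a i Q j)) =
    set_arg (fun j => proj_section B C (j \in S) (a j)) i (proj_section B C (i \in S) Q).
  by apply/funext => j; rewrite /set_arg; case: eqP => [->|].
have PL : proj_section B C (i \in S) (fun y => g y *: s1 y + t1 y) =
    (fun y => g y *: proj_section B C (i \in S) s1 y + proj_section B C (i \in S) t1 y).
  apply: functional_extensionality_dep => y; rewrite /proj_section.
  by case: ifP => _; rewrite linearP.
have sP b s' : smooth_section setT s' -> smooth_section setT (proj_section B C b s').
  by move=> ss'; exact: (smooth_proj_section dBC _ openT ss').
rewrite !P PL; apply: tW; [|exact: sg|exact: sP|exact: sP].
by move=> j; apply: sP; exact: sa.
Qed.

End Tensoriality.

Section BracketLinearity.
Variables (R : realType) (n : nat) (M : manifold R n) (m : nat).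
Variables (A : lie_algebroid M m).
Implicit Types (a b c : section A) (g : M -> R).

Lemma bracketZDr g a b c x : smooth_fun setT g -> smooth_section setT a ->
  smooth_section setT b -> smooth_section setT c ->
  bracket a (fun y => g y *: b y + c y) x =
  g x *: bracket a b x + anchor_der a g x *: b x + bracket a c x.
Proof.
move=> sg sa sb sc.
have sgb : smooth_section setT (fun y => g y *: b y) := smooth_sectionZ openT sg sb.
have sgc := smooth_sectionD openT sgb sc.
have E : (fun y => g y *: b y + c y) = (fun y => 1 *: (g y *: b y) + c y).
  by apply: functional_extensionality_dep => y; rewrite scale1r.
rewrite (bracket_antisym sa sgc) E (bracket_linear 1 sgb sc sa) scale1r opprD.
by rewrite -(bracket_antisym sa sgb) -(bracket_antisym sa sc) (bracket_leibniz sg sa sb).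
Qed.

Lemma bracketZDl g a b c x : smooth_fun setT g -> smooth_section setT a ->
  smooth_section setT b -> smooth_section setT c ->
  bracket (fun y => g y *: b y + c y) a x =
  g x *: bracket b a x - anchor_der a g x *: b x + bracket c a x.
Proof.
move=> sg sa sb sc.
have sgc := smooth_sectionD openT (smooth_sectionZ openT sg sb) sc.
rewrite (bracket_antisym sgc sa) (bracketZDr _ sg sa sb sc) !opprD.
by rewrite -scalerN -(bracket_antisym sb sa) -(bracket_antisym sc sa).
Qed.

End BracketLinearity.

Section RestArgs.
Variables (T : Type) (k : nat).

(** The arguments of a bracket term of the differential at a point, with y in
    place of the value of the bracket. *)
Definition rest_args (y : T) (a : 'I_k.+1 -> T) (i j : 'I_k.+1) : 'I_k -> T :=
  fun l => if l == 0%N :> nat then y else a (inord (bump j (bump i l.-1))).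

End RestArgs.

(** The two bumps skip i and j in turn; l.-1 accounts for the slot 0 of the
    bracket, and the result is small enough for inord. *)
Lemma rest_index k (i j : 'I_k.+1) (l : 'I_k) : (i < j)%N -> l != 0%N :> nat ->
  @inord k (bump j (bump i l.-1)) = bump j (bump i l.-1) :> nat /\
  @inord k (bump j (bump i l.-1)) != i /\ @inord k (bump j (bump i l.-1)) != j.
Proof.
move=> ij l0; have lk := ltn_ord l; have jk := ltn_ord j.
have E : @inord k (bump j (bump i l.-1)) = bump j (bump i l.-1) :> nat.
  rewrite inordK // /bump; case: leqP; case: leqP; lia.
rewrite -!(inj_eq val_inj) /= E; split=> //; split;
  apply/eqP; rewrite /bump; case: leqP; case: leqP; lia.
Qed.

Lemma rest_index_surj k (i j h : 'I_k.+1) : (i < j)%N -> h != i -> h != j ->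
  exists l : 'I_k, [/\ l != 0%N :> nat, @inord k (bump j (bump i l.-1)) = h &
    forall l' : 'I_k, l' != 0%N :> nat -> @inord k (bump j (bump i l'.-1)) = h -> l' = l].
Proof.
rewrite -!(inj_eq val_inj) /= => ij hi hj.
have jk := ltn_ord j; have hk := ltn_ord h.
have lk : ((unbump i (unbump j h)).+1 < k)%N.
  by rewrite /unbump; case: (ltnP j h); case: (ltnP i _); lia.
have key : bump j (bump i (unbump i (unbump j h))) = h.
  by rewrite /bump /unbump; case: (ltnP j h); case: (ltnP i _); case: leqP; case: leqP; lia.
exists (Ordinal lk); split=> //=.
  by apply: val_inj; rewrite /= key inordK.
move=> l' l'0 /(congr1 (fun z : 'I__ => z : nat)).
have [-> _] := rest_index ij l'0.
rewrite -{1}key => /(congr1 (unbump j)); rewrite !bumpK => /(congr1 (unbump i)).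
rewrite !bumpK => H; apply: val_inj => /=; rewrite -H; lia.
Qed.

Lemma rest_args_set (T : Type) k (y : T) (a : 'I_k.+1 -> T) (i j h : 'I_k.+1) :
  (i < j)%N -> h != i -> h != j -> exists l : 'I_k, l != 0%N :> nat /\
  forall z, rest_args y (set_arg a h z) i j = set_arg (rest_args y a i j) l z.
Proof.
move=> ij hi hj; have [l [l0 lh lu]] := rest_index_surj ij hi hj.
exists l; split=> // z; apply/funext => t; rewrite /rest_args /set_arg.
have [->|tl] := eqVneq t l; first by rewrite (negbTE l0) lh eqxx.
case: ifP => // /negbT t0; case: eqP => // /(lu _ t0) /eqP.
by rewrite (negbTE tl).
Qed.

Lemma rest_args_same (T : Type) k (y : T) (a : 'I_k.+1 -> T) (i j h : 'I_k.+1) z :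
  (i < j)%N -> (h == i) || (h == j) ->
  rest_args y (set_arg a h z) i j = rest_args y a i j.
Proof.
move=> ij hij; apply/funext => t; rewrite /rest_args /set_arg.
case: ifP => // /negbT t0; have [_ [ni nj]] := rest_index ij t0.
by case/orP: hij => /eqP ->; rewrite ?(negbTE ni) ?(negbTE nj).
Qed.

Section RestForms.
Variables (R : realType) (V : lmodType R) (k : nat) (w : ('I_k -> V) -> R).
Hypothesis aw : alternating_form w.

Lemma rest_args_linear (t : R) (y z : V) a (i j : 'I_k.+1) : (i < j)%N ->
  w (rest_args (t *: y + z) a i j) = t * w (rest_args y a i j) + w (rest_args z a i j).
Proof.
move=> ij; have k0 : (0 < k)%N by have := ltn_ord j; lia.
have E x : rest_args x a i j = set_arg (rest_args 0 a i j) (Ordinal k0) x.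
  apply/funext => l; rewrite /rest_args /set_arg -(inj_eq val_inj) /=.
  by case: eqP.
by rewrite (E (t *: y + z)) (E y) (E z) aw.1.
Qed.

End RestForms.

Section RestFront.
Variables (R : realType) (V : lmodType R) (k : nat) (w : ('I_k -> V) -> R).
Hypothesis aw : alternating_form w.

(** The Leibniz rule for the bracket of the arguments i and j produces
    multiples of the argument i in front of the others; moving it back to its
    place gives the sign. *)
Lemma rest_args_front_lt (a : 'I_k.+1 -> V) (i j : 'I_k.+1) : (i < j)%N ->
  w (rest_args (a i) a i j) = (-1) ^+ i * w (a \o lift j).
Proof.
case: k w aw a i j => [|k'] w' aw' a i j ij.
  by have := ltn_ord j; have := ltn_ord i; lia.
have ik : (i < k'.+1)%N by have := ltn_ord j; lia.
rewrite -(@alt_front _ _ _ w' (a \o lift j) (Ordinal ik) aw'); congr w'.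
apply/funext => l; rewrite /rest_args; case: (unliftP ord0 l) => [t ->|->].
  rewrite fconsS /=; congr a; apply: val_inj => /=.
  have [-> _] := @rest_index _ i j (lift ord0 t) ij isT.
  by [].
rewrite fcons0 /=; congr a; apply: val_inj => /=.
by rewrite /bump leqNgt ij.
Qed.

Lemma rest_args_front_gt (a : 'I_k.+1 -> V) (i j : 'I_k.+1) : (j < i)%N ->
  w (rest_args (a i) a j i) = - ((-1) ^+ i * w (a \o lift j)).
Proof.
case: k w aw a i j => [|k'] w' aw' a i j ji.
  by have := ltn_ord j; have := ltn_ord i; lia.
have ik : (i.-1 < k'.+1)%N by have := ltn_ord i; lia.
have -> : (-1) ^+ i = - (-1) ^+ i.-1 :> R.
  by rewrite -[RHS]mulN1r -exprS prednK //; exact: leq_ltn_trans ji.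
rewrite mulNr opprK.
rewrite -(@alt_front _ _ _ w' (a \o lift j) (Ordinal ik) aw'); congr w'.
apply/funext => l; rewrite /rest_args; case: (unliftP ord0 l) => [t ->|->].
  rewrite fconsS /=; congr a; apply: val_inj => /=.
  have [-> _] := @rest_index _ j i (lift ord0 t) ji isT.
  by rewrite /= /bump; case: leqP; case: leqP; case: leqP; case: leqP; lia.
rewrite fcons0 /=; congr a; apply: val_inj => /=.
by rewrite /bump; case: leqP; lia.
Qed.

End RestFront.

Fact sign_alg_lt (R : comPzRingType) (e f g P c Q T : R) : e * e = 1 ->
  e * f * (g * P + (- c * (e * Q) + T)) = g * (e * f * P) + e * f * T - f * (c * Q).
Proof.
move=> ee; have -> : f * (c * Q) = e * e * (f * (c * Q)) by rewrite ee mul1r.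
ring.
Qed.

Fact sign_alg_gt (R : comPzRingType) (e f g P c Q T : R) : e * e = 1 ->
  f * e * (g * P + (c * - (e * Q) + T)) = g * (f * e * P) + f * e * T - f * (c * Q).
Proof.
move=> ee; have -> : f * (c * Q) = e * e * (f * (c * Q)) by rewrite ee mul1r.
ring.
Qed.

Section TensorialDifferential.
Variables (R : realType) (n : nat) (M : manifold R n) (m : nat).
Variables (A : lie_algebroid M m).

Lemma bracket_args_at k (a : 'I_k.+1 -> section A) i j x :
  (fun l => bracket_args a i j l x) =
  rest_args (bracket (a i) (a j) x) (fun h => a h x) i j.
Proof. by apply/funext => l; rewrite /bracket_args /rest_args; case: ifP. Qed.

Lemma smooth_eval_form k (w : aform A k) U (a : 'I_k -> section A) :
  open U -> aform_on U w -> smooth_args a -> smooth_fun U (eval_form w a).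
Proof.
move=> oU [_ sw] sa; apply: (sw U a oU) => // i.
exact: (smooth_section_sub (@subsetT _ U) (sa i)).
Qed.

Section Computation.
Variables (k : nat) (w : aform A k) (U : set M) (x : M).
Hypotheses (oU : open U) (hw : aform_on U w) (Ux : U x).
Variables (a : 'I_k.+1 -> section A) (i : 'I_k.+1) (g : M -> R) (s t : section A).
Hypotheses (sa : smooth_args a) (sg : smooth_fun setT g).
Hypotheses (ss : smooth_section setT s) (st : smooth_section setT t).

Let q : section A := fun y => g y *: s y + t y.
Let d (j : 'I_k.+1) : R := (-1) ^+ j * (anchor_der (a j) g x *
  @w x (fun l => set_arg a i s (lift j l) x)).

Let near_U : \forall y \near x, U y.
Proof. exact: open_nbhs_nbhs. Qed.

(** The anchor of the argument j also differentiates the function g, which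
    leaves the defect d j; for j = i, the argument to which the anchor is
    applied, the term is linear over functions. *)
Lemma dA_anchor_term (j : 'I_k.+1) :
  (-1) ^+ j * anchor_der (set_arg a i q j)
     (eval_form w (fun l => set_arg a i q (lift j l))) x =
  g x * ((-1) ^+ j * anchor_der (set_arg a i s j)
     (eval_form w (fun l => set_arg a i s (lift j l))) x) +
  (-1) ^+ j * anchor_der (set_arg a i t j)
     (eval_form w (fun l => set_arg a i t (lift j l))) x +
  (if j == i then 0 else d j).
Proof.
have [->|ji] := eqVneq j i.
  have E z : (fun l => set_arg a i z (lift i l)) = (fun l => a (lift i l)).
    by apply/funext => l; rewrite /set_arg eq_sym (negbTE (neq_lift i l)).
  rewrite !E !set_arg_eq addr0 /anchor_der /q linearP.
  have sf := smooth_eval_form oU hw (fun l => sa (lift i l)).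
  by rewrite (tder_linear oU Ux _ _ _ sf); ring.
have aj z : set_arg a i z j = a j by rewrite /set_arg (negbTE ji).
rewrite !aj; have [i' ii'] : exists i', i = lift j i'.
  by case: (unliftP j i) => [i' ->|ij]; [exists i'|rewrite ij eqxx in ji].
have E z : (fun l => set_arg a i z (lift j l)) = set_arg (fun l => a (lift j l)) i' z.
  by apply/funext => l; rewrite /set_arg ii' (inj_eq lift_inj).
have sE z : smooth_section setT z ->
    smooth_fun U (eval_form w (set_arg (fun l => a (lift j l)) i' z)).
  move=> sz; apply: (smooth_eval_form oU hw).
  exact: (smooth_set_arg i' (fun l => sa (lift j l)) sz).
have gU : smooth_fun U g by exact: smooth_fun_sub sg.
have -> : anchor_der (a j) (eval_form w (fun l => set_arg a i q (lift j l))) x =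
    anchor_der (a j) (fun y =>
      g y * eval_form w (set_arg (fun l => a (lift j l)) i' s) y +
      eval_form w (set_arg (fun l => a (lift j l)) i' t) y) x.
  apply: tder_near; apply: filterS near_U => y Uy.
  rewrite E /eval_form !set_arg_at /q.
  by have [wl _] := hw.1 y Uy.
rewrite /anchor_der (tderD oU Ux _ (smooth_funM oU gU (sE _ ss)) (sE _ st)).
rewrite (tderM oU Ux _ gU (sE _ ss)) /d !E.
rewrite {2 3}/eval_form /anchor_der.
have -> : (fun l => set_arg a i s (lift j l) x) =
   (fun l => set_arg (fun l => a (lift j l)) i' s l x) by rewrite -E.
ring.
Qed.

Let sign2 l : (-1) ^+ l * (-1) ^+ l = 1 :> R.
Proof. by rewrite -exprD addnn -mul2n exprM sqrrN expr1n expr1n. Qed.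

(** The defect of a bracket with the argument i is a multiple of that
    argument, and it matches the defect of an anchor term. *)
Lemma dA_bracket_term (j l : 'I_k.+1) : (j < l)%N ->
  (-1) ^+ (j + l) * eval_form w (bracket_args (set_arg a i q) j l) x =
  g x * ((-1) ^+ (j + l) * eval_form w (bracket_args (set_arg a i s) j l) x) +
  (-1) ^+ (j + l) * eval_form w (bracket_args (set_arg a i t) j l) x -
  (if j == i then d l else if l == i then d j else 0).
Proof.
move=> jl; have aw := hw.1 x Ux.
rewrite /eval_form !bracket_args_at.
have [ji|ji] := eqVneq j i.
  have lj : l != i by rewrite -ji eq_sym -(inj_eq val_inj) /= ltn_eqF.
  have al z : set_arg a i z l = a l by rewrite /set_arg (negbTE lj).
  rewrite ji !set_arg_eq !al !set_arg_at -ji.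
  rewrite !(rest_args_same _ _ _ jl) ?ji ?eqxx // -ji.
  rewrite (bracketZDl _ sg (sa l) ss st) -addrA -scaleNr.
  rewrite !(rest_args_linear aw _ _ _ _ jl).
  have := rest_args_front_lt aw (fun h => set_arg a i s h x) jl.
  rewrite [X in rest_args X]/set_arg ji eqxx set_arg_at.
  rewrite rest_args_same ?eqxx -?ji // => ->.
  rewrite /d ji exprD.
  have E : @w x (set_arg (fun h => a h x) i (s x) \o lift l) =
     @w x (fun h => set_arg a i s (lift l h) x).
    by congr (@w x); apply/funext => h; rewrite -set_arg_at.
  rewrite E; exact: (sign_alg_lt _ _ _ _ _ _ (sign2 i)).
have aj z : set_arg a i z j = a j by rewrite /set_arg (negbTE ji).
have [li|li] := eqVneq l i.
  rewrite li !set_arg_eq !aj !set_arg_at -li.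
  rewrite !(rest_args_same _ _ _ jl) ?li ?eqxx ?orbT // -li.
  rewrite (bracketZDr _ sg (sa j) ss st) -addrA.
  rewrite !(rest_args_linear aw _ _ _ _ jl).
  have := rest_args_front_gt aw (fun h => set_arg a i s h x) jl.
  rewrite [X in rest_args X]/set_arg li eqxx set_arg_at.
  rewrite rest_args_same ?eqxx ?orbT -?li // => ->.
  rewrite /d li exprD.
  have E : @w x (set_arg (fun h => a h x) i (s x) \o lift j) =
     @w x (fun h => set_arg a i s (lift j h) x).
    by congr (@w x); apply/funext => h; rewrite -set_arg_at.
  rewrite E; exact: (sign_alg_gt _ _ _ _ _ _ (sign2 i)).
have al z : set_arg a i z l = a l by rewrite /set_arg (negbTE li).
rewrite !aj !al !set_arg_at subr0.
have ij : i != j by rewrite eq_sym.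
have il : i != l by rewrite eq_sym.
have [h [_ Eh]] := rest_args_set (bracket (a j) (a l) x) (fun h => a h x) jl ij il.
by rewrite !Eh aw.1; ring.
Qed.

(** Every j distinct from i contributes d j twice with opposite signs: through
    its anchor and through its bracket with the argument i. *)
Lemma tensorial_dA_at : dA w (set_arg a i q) x =
  g x * dA w (set_arg a i s) x + dA w (set_arg a i t) x.
Proof.
rewrite /dA (eq_bigr _ (fun j _ => dA_anchor_term j)).
rewrite (eq_bigr _ (fun j _ => eq_bigr _ (fun l jl => dA_bracket_term jl))).
rewrite !big_split /= -!mulr_sumr.
under [X in _ + X]eq_bigr => j _ do rewrite !big_split /= sumrN -mulr_sumr.
rewrite !big_split /= sumrN -mulr_sumr.
suff -> : \sum_(j < k.+1) (if j == i then 0 else d j) =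
   \sum_(j < k.+1) \sum_(l < k.+1 | (j < l)%N)
      (if j == i then d l else if l == i then d j else 0).
  ring.
rewrite (bigD1 i) //= eqxx add0r.
rewrite (eq_bigr d) => [|j /negbTE -> //].
rewrite (bigID (fun j : 'I_k.+1 => (i < j)%N)) /= [RHS](bigD1 i) //=.
congr (_ + _).
  rewrite [RHS](eq_bigr d) => [|l _]; last by rewrite eqxx.
  apply: eq_bigl => j; rewrite -(inj_eq val_inj) /=.
  by case: (ltngtP i j).
rewrite [RHS](bigID (fun j : 'I_k.+1 => (i < j)%N)) /= [X in _ = X + _]big1.
  rewrite add0r; apply: eq_bigr => j /andP[ji ij].
  have jlti : (j < i)%N.
    by rewrite ltn_neqAle leqNgt ij andbT; move: ji; rewrite -(inj_eq val_inj).
  rewrite (bigD1 i) //= (negbTE ji) eqxx big1 ?addr0 // => l /andP[_ /negbTE li].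
  by rewrite li.
move=> j /andP[/negbTE ji ij]; apply: big1 => l jl; rewrite ji.
case: eqP => // li; move: jl; rewrite li; move: ij; lia.
Qed.

End Computation.

Lemma tensorial_dA k (w : aform A k) U x : open U -> aform_on U w -> U x ->
  tensorial_at (dA w) x.
Proof. by move=> oU hw Ux a i g s t *; exact: (tensorial_dA_at oU hw Ux). Qed.

End TensorialDifferential.

(** * Adapted frames *)

Section FoliatedChart.
Variables (R : realType) (n : nat) (M : manifold R n).
Variables (c : chart R M n) (cc : compatible c) (x : M) (cx : cdom c x).

Let a := chart_at x.
Let ax : cdom a x := chart_at_dom x.
Let aa : atlas a := chart_at_atlas x.

Lemma derive_coord (z v : 'rV[R]_n) (l : 'I_n) : 'D_v (fun z : 'rV[R]_n => z 0 l) z = v 0 l.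
Proof.
apply/cvg_lim => //; apply: cvg_near_cst.
near=> h; rewrite /= !mxE addrK /GRing.scale /= mulrA mulVf ?mul1r //.
by near: h; exact: nbhs_dnbhs_neq.
Unshelve. all: by end_near.
Qed.

Lemma tcomp_linear (t : R) (v w : tangent x) l :
  tcomp (t *: (v : 'rV[R]_n) + w : tangent x) c l = t * tcomp v c l + tcomp w c l.
Proof. exact: (tder_linear (@cdom_open _ _ _ c) cx _ _ _ (smooth_coord l cc)). Qed.

Lemma tcomp0 l : tcomp (0 : tangent x) c l = 0.
Proof.
have := tcomp_linear 1 (0 : 'rV[R]_n) (0 : 'rV[R]_n) l.
rewrite scaler0 addr0 mul1r => /eqP.
by rewrite -subr_eq subrr eq_sym => /eqP.
Qed.

Lemma tcomp_sum (I : Type) (s : seq I) (k : I -> R) (v : I -> 'rV[R]_n) l :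
  tcomp (\sum_(i <- s) k i *: v i : tangent x) c l =
  \sum_(i <- s) k i * tcomp (v i : tangent x) c l.
Proof.
elim: s => [|i s IH]; first by rewrite !big_nil tcomp0.
by rewrite !big_cons tcomp_linear IH.
Qed.

(** The components of v in the distinguished chart are derivatives of
    functions, hence combinations of the components in c. *)
Lemma tcomp_inj (v : tangent x) : (forall l, tcomp v c l = 0) -> v = 0 :> 'rV[R]_n.
Proof.
move=> v0; apply/rowP => j; rewrite mxE.
have -> : v 0 j = tder v (fun y => cmap a y 0 j).
  rewrite /tder -(derive_coord (cmap a x) v j); apply: near_eq_derive.
  apply: filterS (open_nbhs_nbhs (conj (@ccod_open _ _ _ a) (cmap_cod ax))) => z az.
  by rewrite cinvK.
rewrite (tder_chart (@cdom_open _ _ _ a) ax _ cc cx (smooth_coord j (atlas_compatible aa))).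
by rewrite big1 // => l _; rewrite v0 mul0r.
Qed.

(** The i-th coordinate vector of the chart c at x, in the components of the
    distinguished chart. *)
Definition coord_tangent (i : 'I_n) : tangent x :=
  \row_j 'D_(basis_vec R i) (fun z => cmap a (cinv c z) 0 j) (cmap c x).

Lemma tcomp_coord_tangent i l : tcomp (coord_tangent i) c l = (l == i)%:R.
Proof.
have oW : open (pullback a (cdom c)) by apply: open_pullback; exact: cdom_open.
have oW' : open (pullback c (cdom a)) by apply: open_pullback; exact: cdom_open.
have Wa : pullback a (cdom c) (cmap a x) by exact: pullback_map.
have Wc : pullback c (cdom a) (cmap c x) by exact: pullback_map.
have H1 : forall k, Ck (pullback a (cdom c)) k (fun z => cmap c (cinv a z) 0 l).
  by have [_ +] := cc aa; move=> /(_ l) /smooth_euclP.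
have H2 j : forall k, Ck (pullback c (cdom a)) k (fun z => cmap a (cinv c z) 0 j).
  by have [+ _] := cc aa; move=> /(_ j) /smooth_euclP.
rewrite /tcomp /tder.
have [_ ->] := Ck_differentiable oW (H1 1%N) Wa.
have E : cmap a (cinv c (cmap c x)) = cmap a x by rewrite cmapK.
have Wga : pullback a (cdom c) (cmap a (cinv c (cmap c x))) by rewrite E.
have [_ D] := chain_rule (g := fun z => cmap a (cinv c z)) (basis_vec R i) oW' oW
  Wc Wga (H1 1%N) (fun j => H2 j 1%N).
rewrite /gradient_form.
transitivity (\sum_j 'D_(basis_vec R i) (fun z => cmap a (cinv c z) 0 j) (cmap c x) *
  'D_(basis_vec R j) (fun z => cmap c (cinv a z) 0 l) (cmap a x)).
  by apply: eq_bigr => j _; rewrite mxE.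
rewrite -E -D.
have -> : (l == i)%:R = basis_vec R i 0 l by rewrite mxE eqxx.
rewrite -(derive_coord (cmap c x)); apply: near_eq_derive.
apply: filterS (open_nbhs_nbhs (conj oW' Wc)) => z [cz az] /=.
by rewrite cmapK // cinvK.
Qed.

End FoliatedChart.

Lemma derive_constant_line (R : realType) (V : normedModType R) (f : V -> R) (z v : V) :
  (\forall h \near (0 : R), f (h *: v + z) = f z) -> 'D_v f z = 0.
Proof.
move=> H; apply/cvg_lim => //; apply: cvg_near_cst.
near=> h; rewrite /= (_ : f _ = f z) ?subrr ?scaler0 //.
by near: h; exact: nbhs_dnbhs.
Unshelve. all: by end_near.
Qed.

Section LeafTangent.
Variables (R : realType) (p q : nat) (M : manifold R (p + q)) (F : foliation M).
Variables (c : chart R M (p + q)) (fc : fcharts F c).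

Lemma fchart_compatible (d : chart R M (p + q)) : fcharts F d -> compatible d.
Proof. by move=> fd e ae; exact: (fcharts_smooth fd ae). Qed.

(** One foliated chart suffices: the transverse coordinates of another one are
    constant along its slices, so the leafwise coordinate vectors annihilate
    them. *)
Lemma leaf_tangentP x (v : tangent x) : cdom c x ->
  (forall j : 'I_q, tcomp v c (rshift p j) = 0) -> leaf_tangent F v.
Proof.
move=> cx v0 d fd dx j.
have cc := fchart_compatible fc; have cd := fchart_compatible fd.
rewrite /tcomp (tder_chart (@cdom_open _ _ _ d) dx _ cc cx (smooth_coord _ cd)).
rewrite big1 // => l _; case: (fintype.splitP l) => [l' ll|j' lj]; last first.
  have -> : l = rshift p j' by apply: val_inj.
  by rewrite v0 mul0r.
have -> : l = lshift q l' by apply: val_inj.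
rewrite derive_constant_line ?mulr0 //.
have oz : overlap c d (cmap c x) by split; [exact: cmap_cod|rewrite cmapK].
have [W [nW WW HW]] := fcharts_foliated fc fd oz.
have cont : {for (0 : R), continuous (fun h : R =>
    h *: basis_vec R (lshift q l') + cmap c x)}.
  apply: continuousD; last exact: cst_continuous.
  exact: scalel_continuous.
have : nbhs (0 *: basis_vec R (lshift q l') + cmap c x) W by rewrite scale0r add0r.
move=> nW'; have := cont _ nW'; apply: (@filterS _ (nbhs (0 : R))) => h Wh.
have rs : rsubmx (h *: basis_vec R (lshift q l') + cmap c x) = rsubmx (cmap c x).
  by apply/rowP => i; rewrite !mxE eqxx eq_rlshift mulr0 add0r.
by have /rowP/(_ j) := HW _ _ Wh (nbhs_singleton nW) rs; rewrite !mxE.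
Qed.

End LeafTangent.

Section AdaptedFrame.
Variables (R : realType) (p q : nat) (M : manifold R (p + q)) (F : foliation M).
Variables (m : nat) (A : lie_algebroid M m) (B C : forall x : M, {vspace A x}).
Hypotheses (hB : minimally_foliated F B) (hC : bundle_decomposition B C).
Variables (c : chart R M (p + q)) (fc : fcharts F c).

Let cc : compatible c := fchart_compatible fc.

(** The transverse components of the anchor vanish because B is mapped to the
    tangent spaces of the leaves; injectivity of the anchor on B does the
    rest. *)
Lemma B_anchor_inj x b : cdom c x -> b \in B x ->
  (forall l : 'I_p, tcomp (anchor A x b : tangent x) c (lshift q l) = 0) -> b = 0.
Proof.
move=> cx bB H; have [fl inj] := hB.
apply: (inj x) => //; first exact: mem0v.
rewrite linear0; apply: (tcomp_inj cc cx) => l.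
have lt : leaf_tangent F (anchor A x b : tangent x).
  by rewrite -(fla_anchor fl x); exists b.
case: (fintype.splitP l) => [l' ll|j' lj].
  by have -> : l = lshift q l' by apply: val_inj.
have -> : l = rshift p j' by apply: val_inj.
exact: lt.
Qed.

Lemma B_anchor_surj x (i : 'I_p) : cdom c x -> exists2 b, b \in B x &
  forall l : 'I_p, tcomp (anchor A x b : tangent x) c (lshift q l) = (l == i)%:R.
Proof.
move=> cx; have [fl inj] := hB.
have lt : leaf_tangent F (coord_tangent c x (lshift q i)).
  apply: (leaf_tangentP fc cx) => j.
  by rewrite tcomp_coord_tangent // eq_rlshift.
move: lt; rewrite -(fla_anchor fl x) => -[b bB Eb]; exists b => // l.
by rewrite Eb tcomp_coord_tangent // (inj_eq (@lshift_inj _ _)).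
Qed.

(** The leafwise components of the anchors of a local basis of B form a
    matrix, whose rows are independent by injectivity of the anchor on B and
    which has full rank by its surjectivity onto the tangent space of the
    leaf. Its inverse turns the basis into lifts of the coordinate vectors. *)
Lemma leaf_frame x0 : cdom c x0 -> exists (W : set M) (b : 'I_p -> section A),
  [/\ open W, W x0, W `<=` cdom c, forall i, smooth_section W (b i) &
  [/\ forall x, W x -> forall i, b i x \in B x,
      forall x, W x -> forall i (l : 'I_p),
        tcomp (anchor A x (b i x) : tangent x) c (lshift q l) = (l == i)%:R &
      basis_of (B x0) [tuple b i x0 | i < p]]].
Proof.
move=> cx0; have [sB _ _] := hC.
have [UB [r [e [oB xB HB bB]]]] := sB x0.
pose W := UB `&` cdom c.
have oW : open W by apply: openI => //; exact: cdom_open.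
pose P x : 'M[R]_(r, p) := \matrix_(i, l)
  tcomp (anchor A x (e i x) : tangent x) c (lshift q l).
have eB x : W x -> forall i, e i x \in B x.
  move=> [Bx _] i; rewrite -(span_basis (bB x Bx)); apply: memv_span.
  by apply/tnthP; exists i; rewrite tnth_mktuple.
have PE x : W x -> forall (k : 'rV[R]_r) l, (k *m P x) 0 l =
    tcomp (anchor A x (\sum_i k 0 i *: e i x) : tangent x) c (lshift q l).
  move=> [Bx cx] k l; rewrite linear_sum.
  rewrite (eq_bigr (fun i => k 0 i *: anchor A x (e i x))); last first.
    by move=> i _; rewrite linearZ.
  by rewrite (tcomp_sum cc cx) !mxE; apply: eq_bigr => i _; rewrite mxE.
have Pfree x : W x -> row_free (P x).
  move=> Wx; apply: inj_row_free => k kP; have [Bx cx] := Wx.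
  have k0 : \sum_i k 0 i *: e i x = 0.
    apply: (B_anchor_inj cx).
      by apply: memv_suml => i _; apply: memvZ; exact: eB.
    by move=> l; rewrite -PE // kP mxE.
  apply/rowP => i; rewrite mxE.
  by rewrite -(coord_basis_sum (k 0) i (basis_free (bB x Bx))) k0 linear0.
have Pfull x : W x -> row_full (P x).
  move=> Wx; have [Bx cx] := Wx; apply/row_fullP.
  have H (i : 'I_p) : exists k : 'rV[R]_r, forall l, (k *m P x) 0 l = (l == i)%:R.
    have [b bBx Hb] := B_anchor_surj i cx.
    exists (\row_j coord [tuple e l x | l < r] j b) => l.
    have Eb : \sum_j (\row_j coord [tuple e l x | l < r] j b) 0 j *: e j x = b.
      rewrite [RHS](coord_basis (bB x Bx) bBx).
      by apply: eq_bigr => j _; rewrite mxE -tnth_nth tnth_mktuple.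
    by rewrite (PE x Wx) Eb Hb.
  have [k Hk] := choice H.
  exists (\matrix_i k i); apply/matrixP => i l.
  have := Hk i l; rewrite !mxE eq_sym => <-.
  by apply: eq_bigr => j _; rewrite !mxE.
have Wx0 : W x0 by [].
have rp : r = p.
  by have /eqP <- := Pfree x0 Wx0; have /eqP := Pfull x0 Wx0.
subst r; have Pu x : W x -> P x \in unitmx by move=> /Pfree; rewrite row_free_unit.
have sP i l : smooth_fun W (fun x => P x i l).
  apply: (@smooth_fun_ext _ _ _ _ (fun x => tder (anchor A x (e i x) : tangent x)
    (fun y => cmap c y 0 (lshift q l)))) => //.
    by move=> x _; rewrite mxE.
  apply: smooth_tder => //.
    apply: (anchor_smooth oW); apply: smooth_section_sub (HB i) => x [].
    by [].
  by apply: smooth_fun_sub (smooth_coord (lshift q l) cc) => x [].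
pose b i : section A := fun x => \sum_j invmx (P x) i j *: e j x.
have bBx x : W x -> forall i, b i x \in B x.
  by move=> Wx i; apply: memv_suml => j _; apply: memvZ; exact: eB.
have tb x : W x -> forall i (l : 'I_p),
    tcomp (anchor A x (b i x) : tangent x) c (lshift q l) = (l == i)%:R.
  move=> Wx i l.
  have Eb : \sum_j (row i (invmx (P x))) 0 j *: e j x = b i x.
    by apply: eq_bigr => j _; rewrite mxE.
  have := PE x Wx (row i (invmx (P x))) l.
  rewrite -row_mul mulVmx ?(Pu x Wx) // Eb => <-.
  by rewrite !mxE eq_sym.
exists W, b; split=> //.
- by move=> x [].
- move=> i; apply: smooth_section_sum => // j _.
  apply: (smooth_sectionZ oW); first exact: smooth_fun_invmx.
  by apply: smooth_section_sub (HB j) => x [].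
- split=> //.
  rewrite basisEfree size_tuple (size_basis (bB x0 xB)) leqnn andbT.
  apply/andP; split; last first.
    apply/span_subvP => y /tnthP[i ->]; rewrite tnth_mktuple; exact: bBx.
  apply/freeP => k k0 l.
  have Hk : \sum_i k i *: b i x0 = 0.
    by rewrite -[RHS]k0; apply: eq_bigr => i _; rewrite -tnth_nth tnth_mktuple.
  have : tcomp (anchor A x0 (\sum_i k i *: b i x0) : tangent x0) c (lshift q l) = 0.
    by rewrite Hk linear0 (tcomp0 cc cx0).
  rewrite linear_sum.
  rewrite (eq_bigr (fun i => k i *: anchor A x0 (b i x0))); last first.
    by move=> i _; rewrite linearZ.
  rewrite (tcomp_sum cc cx0) (bigD1 l) //= (tb x0 Wx0) eqxx mulr1 big1 ?addr0 //.
  by move=> i il; rewrite (tb x0 Wx0) eq_sym (negbTE il) mulr0.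
Qed.

(** For sections over all of M the bracket needs no passage to germs. *)
Definition B_foliated (W : set M) (a : section A) := smooth_section setT a /\
  forall x, W x -> forall b, sub_section B b -> bracket b a x \in B x.

Lemma B_foliated0 W : B_foliated W (fun x => 0).
Proof.
have s0 : smooth_section setT (fun x => 0 : A x) := smooth_section0 openT.
split=> // x _ b [sb _].
have := bracketZDr x (smooth_fun_cst 1 openT) sb s0 s0.
have -> : (fun y => 1 *: 0 + 0) = (fun y => 0 : A y).
  by apply: functional_extensionality_dep => y; rewrite scaler0 addr0.
rewrite scale1r scaler0 addr0 => /eqP.
by rewrite -subr_eq subrr eq_sym => /eqP ->; exact: mem0v.
Qed.

Lemma B_foliatedZD W (t : R) a a' : B_foliated W a -> B_foliated W a' ->
  B_foliated W (fun x => t *: a x + a' x).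
Proof.
move=> [sa Ha] [sa' Ha']; have st := smooth_fun_cst (M := M) t openT.
split; first exact: (smooth_combine st sa sa').
move=> x Wx b sb; rewrite (bracketZDr x st sb.1 sa sa').
rewrite /anchor_der tder_cst scale0r addr0.
by apply: memvD; [apply: memvZ; exact: Ha|exact: Ha'].
Qed.

Lemma global_section_value x0 (v : A x0) :
  exists2 s : section A, smooth_section setT s & s x0 = v.
Proof.
have [e fe ex] := frames_cover A x0.
have oe := frames_open fe.
have [chi [S [schi cS Se chi0 chi1]]] := bump_manifold oe ex.
have chix : chi x0 = 1 := nbhs_singleton chi1.
have se l : smooth_section setT (fun y => chi y *: e.2 l y).
  apply: (smooth_section_extend (U := e.1) (S := S)) => //.
  move=> e' fe' i; have := frames_smooth fe fe' l i; apply: smooth_fun_sub.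
  by [].
exists (fun y => \sum_l coord [tuple e.2 i x0 | i < m] l v *: (chi y *: e.2 l y)).
  apply: (smooth_section_sum _ openT) => l _.
  apply: (smooth_sectionZ openT) (se l); exact: (smooth_fun_cst _ openT).
rewrite [RHS](basis_coord v (frames_basis fe ex)).
by apply: eq_bigr => l _; rewrite chix scale1r.
Qed.

(** The given sections span with function coefficients; freezing these at x0
    keeps the value there and yields a combination with constant coefficients,
    which is again foliated. *)
Lemma foliated_values x0 : exists W : set M, [/\ open W, W x0 &
  forall v : A x0, exists2 a, B_foliated W a & a x0 = v].
Proof.
have [fl _] := hB; have [U [oU Ux0 HU]] := fla_spanned fl x0.
have [chi [S [schi cS SU chi0 chi1]]] := bump_manifold oU Ux0.
pose W := U `&` [set x | chi x = 1]°.
have oW : open W by apply: openI => //; exact: open_interior.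
have Wx0 : W x0 by [].
exists W; split=> // v.
have [s ss sv] := global_section_value v.
have [N [f [a [sf fa sE]]]] := HU s (smooth_section_sub (@subsetT _ U) ss).
have fol i : B_foliated W (fun y => chi y *: a i y).
  have sa : smooth_section setT (fun y => chi y *: a i y).
    exact: (smooth_section_extend oU (fa i).1 schi cS SU chi0).
  split=> // x [Ux Wx] b sb; apply: ((fa i).2 x Ux _ b sa _ sb).
  apply: (@filterS _ (nbhs x) _ _ _ _ Wx) => y /= ->; exact: scale1r.
exists (fun y => \sum_i f i x0 *: (chi y *: a i y)).
  have H r : B_foliated W (fun y => \sum_(i <- r) f i x0 *: (chi y *: a i y)).
    elim: r => [|i r IH].
      have -> : (fun y => \sum_(i <- [::]) f i x0 *: (chi y *: a i y)) = (fun y => 0).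
        by apply: functional_extensionality_dep => y; rewrite big_nil.
      exact: B_foliated0.
    have -> : (fun y => \sum_(i <- i :: r) f i x0 *: (chi y *: a i y)) =
        (fun y => f i x0 *: (chi y *: a i y) + \sum_(i <- r) f i x0 *: (chi y *: a i y)).
      by apply: functional_extensionality_dep => y; rewrite big_cons.
    exact: B_foliatedZD.
  exact: H.
have chix : chi x0 = 1 := nbhs_singleton chi1.
rewrite -sv sE //; apply: eq_bigr => i _; by rewrite chix scale1r.
Qed.

(** The projection onto C differs from a by a section of B, and the sections
    of B are closed under brackets. *)
Lemma proj_B_foliated W a : B_foliated W a ->
  B_foliated W (proj_section B C true a).
Proof.
move=> [sa Ha].
have sB : smooth_section setT (proj_section B C false a).
  exact: (smooth_proj_section hC _ openT sa).
have bB : sub_section B (proj_section B C false a).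
  split; first exact: sB.
  by move=> x; exact: memv_pi.
have BB : B_foliated W (proj_section B C false a).
  split; first exact: sB.
  move=> x _ b sb; have [fl _] := hB.
  have [_ cl] := fla_subalgebroid fl; exact: (cl _ _ sb bB).2.
have -> : proj_section B C true a =
    (fun x => -1 *: proj_section B C false a x + a x).
  apply: functional_extensionality_dep => x; rewrite /proj_section.
  have ax : a x \in (B x + C x)%VS by rewrite decomposition_add // memvf.
  rewrite -{3}(daddv_pi_add (decomposition_cap hC x) ax).
  by rewrite scaleN1r addKr.
exact: B_foliatedZD.
Qed.

Definition chart_cube x0 (d : R) : set M :=
  cdom c `&` [set x | cube (cmap c x0) d (cmap c x)].

(** Near a point, the leafwise part of the differential has constant
    coefficients in such a frame: the sections of index less than p are lifts
    to B of the leafwise coordinate fields of c, the others are sections of C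
    whose brackets with the former stay in B. The sections are global so that
    they can be bracketed. *)
Record adapted_frame (V : set M) (e : 'I_m -> section A) : Prop := {
  af_smooth : forall l, smooth_section setT (e l);
  af_B : forall (l : 'I_m) x, (l < p)%N -> e l x \in B x;
  af_C : forall (l : 'I_m) x, (p <= l)%N -> e l x \in C x;
  af_basis : forall x, V x -> basis_of fullv [tuple e l x | l < m];
  af_bracket_BB : forall x (i j : 'I_m), V x -> (i < p)%N -> (j < p)%N ->
    bracket (e i) (e j) x = 0;
  af_bracket_BC : forall x (i j : 'I_m), V x -> (i < p)%N -> (p <= j)%N ->
    bracket (e i) (e j) x \in B x;
  af_anchor : forall x (i : 'I_m) (l : 'I_(p + q)) W f, (i < p)%N ->
    l = i :> nat -> V x -> open W -> W x -> smooth_fun W f ->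
    anchor_der (e i) f x =
    'D_(basis_vec R l) (fun z => f (cinv c z)) (cmap c x) }.

(** The lifts of the coordinate fields commute: their brackets lie in B and
    have anchor 0, because coordinate fields commute, and the anchor is
    injective on B. The other sections are the projections onto C of foliated
    sections that take the values of a basis of C at x0. *)
Lemma adapted_frame_exists x0 (U : set M) : cdom c x0 -> open U -> U x0 ->
  exists (d : R) (e : 'I_m -> section A),
  [/\ 0 < d, cube (cmap c x0) d `<=` ccod c, open (chart_cube x0 d),
      chart_cube x0 d `<=` U & (p <= m)%N /\ adapted_frame (chart_cube x0 d) e].
Proof.
move=> cx0 oU Ux0.
have [W1 [b [oW1 W1x0 W1c sb [bB tb bb]]]] := leaf_frame cx0.
have [W2 [oW2 W2x0 HW2]] := foliated_values x0.
have [chi [S [schi cS SW chi0 chi1]]] := bump_manifold oW1 W1x0.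
pose bt i : section A := fun y => chi y *: b i y.
have sbt i : smooth_section setT (bt i).
  exact: (smooth_section_extend oW1 (sb i) schi cS SW chi0).
have btB i x : bt i x \in B x.
  have [W1x|nW1x] := pselect (W1 x); first by apply: memvZ; exact: bB.
  by rewrite /bt chi0 ?scale0r ?mem0v // => /SW.
pose r' := \dim (C x0).
have HC (j : 'I_r') : exists a, B_foliated W2 a /\ a x0 = (vbasis (C x0))`_j.
  by have [a fa av] := HW2 (vbasis (C x0))`_j; exists a.
have [a0 Ha0] := choice HC.
pose ct j := proj_section B C true (a0 j).
have fct j : B_foliated W2 (ct j) by apply: proj_B_foliated; exact: (Ha0 j).1.
have ctC j x : ct j x \in C x by exact: memv_pi.
have rm : m = (p + r')%N.
  rewrite -(frame_dim A x0) -(decomposition_add hC x0) dimv_disjoint_sum.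
    by rewrite (size_basis bb).
  exact: (decomposition_cap hC).
pose e l : section A := match fintype.split (cast_ord rm l) with
     | inl i => bt i | inr j => ct j end.
have eB (l : 'I_m) : (l < p)%N -> exists2 i : 'I_p, i = l :> nat & e l = bt i.
  move=> lp; rewrite /e; case: fintype.splitP => [i /= li|j /= lj].
    by exists i.
  by move: lp; rewrite lj ltnNge leq_addr.
have eC (l : 'I_m) : (p <= l)%N -> exists j : 'I_r', e l = ct j.
  move=> lp; rewrite /e; case: fintype.splitP => [i /= li|j /= lj].
    by move: lp; rewrite li leqNgt ltn_ord.
  by exists j.
have se l : smooth_section setT (e l).
  by rewrite /e; case: fintype.split => i; [exact: sbt|exact: (fct i).1].
have chix0 : chi x0 = 1 := nbhs_singleton chi1.
have be0 : basis_of fullv [tuple e l x0 | l < m].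
  have -> : [tuple e l x0 | l < m] = [tuple (match fintype.split (cast_ord rm l) with
     | inl i => b i x0 | inr j => (vbasis (C x0))`_j end) | l < m].
    apply: eq_mktuple => l; rewrite /e; case: fintype.split => i.
      by rewrite /bt chix0 scale1r.
    rewrite /ct /proj_section (Ha0 i).2 daddv_pi_id //.
      by rewrite capvC (decomposition_cap hC).
    by apply: (vbasis_mem (U := C x0)); apply: mem_nth; rewrite size_tuple.
  apply: (@complement_basis _ _ _ _ _ B C).
  - exact: (decomposition_add hC).
  - exact: (decomposition_cap hC).
  - exact: bb.
  - have -> : [tuple (vbasis (C x0))`_i | i < r'] = vbasis (C x0).
      by apply: eq_from_tnth => i; rewrite tnth_mktuple (tnth_nth 0).
    exact: vbasisP.
have nbe := frame_near openT I se be0.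
(* On Om the bump function is 1, so that e extends b and c unchanged, and e is
   still a basis. *)
pose Om := (U `&` W1) `&` (W2 `&` ([set x | chi x = 1]° `&`
  [set x | basis_of fullv [tuple e l x | l < m]]°)).
have oOm : open Om.
  apply: openI; first exact: openI.
  by apply: openI => //; apply: openI; exact: open_interior.
have Omx0 : Om x0 by [].
have : nbhs (cmap c x0) (pullback c Om).
  by apply: open_nbhs_nbhs; split; [exact: open_pullback|exact: pullback_map].
move=> /nbhs_ballP[d /= d0 Hd].
have HQ z : cube (cmap c x0) d z -> pullback c Om z.
  by move=> Qz; apply: Hd; rewrite -ball_normE /= distrC.
exists d, e; set V := chart_cube x0 d.
have oV : open V.
  rewrite openE => x [cx Qx].
  have n1 : nbhs x (cdom c) by apply: open_nbhs_nbhs; split=> //; exact: cdom_open.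
  have n2 : nbhs x [set x | cube (cmap c x0) d (cmap c x)].
    apply: (cmap_cont cx); apply: open_nbhs_nbhs; split=> //; exact: open_cube.
  exact: (filterI n1 n2).
have VOm x : V x -> Om x.
  by move=> [cx /HQ[_]]; rewrite cmapK.
have et x (i : 'I_m) (l : 'I_(p + q)) : V x -> (i < p)%N ->
    tcomp (anchor A x (e i x) : tangent x) c l = (l == i :> nat)%:R.
  move=> Vx ip; have [i' ii' ->] := eB i ip.
  have [[_ W1x] [_ [/interior_subset /= chix _]]] := VOm x Vx.
  rewrite /bt chix scale1r; case: (fintype.splitP l) => [l' ll|j' lj].
    have -> : l = lshift q l' by apply: val_inj.
    by rewrite tb // -ii'.
  have -> : l = rshift p j' by apply: val_inj.
  have lt : leaf_tangent F (anchor A x (b i' x) : tangent x).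
    have [fl _] := hB; rewrite -(fla_anchor fl x); exists (b i' x) => //.
    exact: bB.
  rewrite (lt c fc (W1c _ W1x) j') /= gtn_eqF //.
  by rewrite (leq_trans ip) // leq_addr.
split=> //.
- by move=> z /HQ[].
- by move=> x /VOm[[]].
split; first by rewrite rm leq_addr.
split; first exact: se.
- by move=> l x /eB[i _ ->]; exact: btB.
- by move=> l x /eC[j ->]; exact: ctC.
- by move=> x /VOm[_ [_ [_ /interior_subset]]].
- move=> x i j Vx ip jp; have cx : cdom c x by case: Vx.
  have eBs (l : 'I_m) : (l < p)%N -> sub_section B (e l).
    by move=> lp; split=> // y; have [l' _ ->] := eB l lp; exact: btB.
  have [fl _] := hB; have [_ cl] := fla_subalgebroid fl.
  apply: (B_anchor_inj cx); first exact: (cl _ _ (eBs i ip) (eBs j jp)).2.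
  move=> l; set f := fun y => cmap c y 0 (lshift q l).
  have sf : smooth_fun V f.
    by apply: smooth_fun_sub (smooth_coord (lshift q l) cc) => y [].
  rewrite /tcomp (anchor_bracket oV sf (se i) (se j) Vx).
  have const (k : 'I_m) : (k < p)%N -> \forall y \near x,
      tder (anchor A y (e k y) : tangent y) f = (lshift q l == k :> nat)%:R.
    by move=> kp; apply: filterS (open_nbhs_nbhs (conj oV Vx)) => y Vy; exact: et.
  by rewrite (tder_near _ (const j jp)) (tder_near _ (const i ip)) !tder_cst subrr.
- move=> x i j Vx ip pj; have [j' ->] := eC j pj.
  have [_ [W2x _]] := VOm x Vx; apply: ((fct j').2 x W2x).
  by split=> // y; have [l' _ ->] := eB i ip; exact: btB.
- move=> x i l W f ip li Vx oW Wx sf; have cx : cdom c x by case: Vx.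
  rewrite /anchor_der (tder_chart oW Wx _ cc cx sf) (bigD1 l) //= et // li eqxx mul1r.
  rewrite big1 ?addr0 // => l' l'l; rewrite et // -li.
  by rewrite (inj_eq val_inj) (negbTE l'l) mul0r.
Qed.

End AdaptedFrame.

(** * The homotopy formula along the leaves *)

Section LeafMeanLinear.
Variables (R : realType) (n p : nat) (z0 : 'rV[R]_n) (d : R).
Let Q := cube z0 d.

Lemma leaf_mean_cont01 r f z : (forall z, Q z -> {for z, continuous f}) -> Q z ->
  cont01 (fun t => t ^+ r * f (leaf_scale p z0 t z)).
Proof.
move=> cf Qz.
exact: (@joint_cont01 _ _ (fun t z => t ^+ r * f (leaf_scale p z0 t z)) z
  (@leaf_mean_joint _ _ p z0 d r f z cf Qz)).
Qed.

Lemma eq_leaf_mean r f g z : (forall z, Q z -> f z = g z) -> Q z ->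
  leaf_mean p z0 r f z = leaf_mean p z0 r g z.
Proof.
move=> fg Qz; apply: eq_int01 => t t01; congr (_ * _); apply: fg.
exact: leaf_scale_cube.
Qed.

Lemma leaf_mean_sum r (I : Type) (s : seq I) (P : pred I) (k : I -> R)
    (f : I -> 'rV[R]_n -> R) z :
  (forall i z, Q z -> {for z, continuous (f i)}) -> Q z ->
  leaf_mean p z0 r (fun z => \sum_(i <- s | P i) k i * f i z) z =
  \sum_(i <- s | P i) k i * leaf_mean p z0 r (f i) z.
Proof.
move=> cf Qz.
rewrite (eq_bigr (fun i => int01 (fun t => k i * (t ^+ r * f i (leaf_scale p z0 t z))))); last first.
  by move=> i _; rewrite int01Z //; apply: leaf_mean_cont01 => //; exact: cf.
rewrite -int01_sum; last first.
  by move=> i; apply: cont01Z; apply: leaf_mean_cont01 => //; exact: cf.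
apply: eq_int01 => t _; rewrite mulr_sumr; apply: eq_bigr => i _.
by rewrite mulrCA.
Qed.

Lemma leaf_meanZ r (k : R) f z :
  (forall z, Q z -> {for z, continuous f}) -> Q z ->
  leaf_mean p z0 r (fun z => k * f z) z = k * leaf_mean p z0 r f z.
Proof.
move=> cf Qz; rewrite /leaf_mean -int01Z; last exact: leaf_mean_cont01.
by apply: eq_int01 => t _; rewrite mulrCA.
Qed.

End LeafMeanLinear.

Lemma fcons_lift (T : Type) k (a : T) (v : 'I_k.+1 -> T) (i : 'I_k.+1) :
  fcons a v \o lift (lift ord0 i) = fcons a (v \o lift i).
Proof.
apply/funext => t /=; case: (unliftP ord0 t) => [t' ->|->].
  have -> : lift (lift ord0 i) (lift ord0 t') = lift ord0 (lift i t').
    by apply: val_inj; rewrite /= /bump /=; case: leqP; case: leqP; lia.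
  by rewrite !fconsS.
have -> : lift (lift ord0 i) ord0 = ord0 by apply: val_inj.
by rewrite !fcons0.
Qed.

Section FlatHomotopy.
Variables (R : realType) (p q m : nat) (pm : (p <= m)%N).
Variables (z0 : 'rV[R]_(p + q)) (d : R) (r k : nat).
Let Q := cube z0 d.

(** A direction of R^(p + q) for every frame index, so that the entries of a
    tuple L can be used as directions of derivation: basis_vec for l < p + q,
    else 0. *)
Definition frame_vec (l : 'I_m) : 'rV[R]_(p + q) := \row_j (j == l :> nat)%:R.

Let inB (j : 'I_p) : 'I_m := widen_ord pm j.

Lemma frame_vecE (l : 'I_m) (j : 'I_(p + q)) : j = l :> nat -> frame_vec l = basis_vec R j.
Proof. by move=> jl; apply/rowP => i; rewrite !mxE -jl eqxx. Qed.

Lemma frame_vec_widen (j : 'I_p) : frame_vec (inB j) = basis_vec R (lshift q j).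
Proof. exact: frame_vecE. Qed.

Variable f : ('I_k.+1 -> 'I_m) -> 'rV[R]_(p + q) -> R.
Hypothesis sf : forall L j, Ck Q j (f L).

(** Contraction with the Euler field of the leaf based at z0, followed by the
    mean along the leaf. *)
Definition homotopy_op (L : 'I_k -> 'I_m) (z : 'rV[R]_(p + q)) : R :=
  \sum_(j < p) (z 0 (lshift q j) - z0 0 (lshift q j)) *
    leaf_mean p z0 r (f (fcons (inB j) L)) z.

Let cf L : forall z, Q z -> {for z, continuous (f L)}.
Proof. by have [] := sf L 0%N. Qed.

Lemma homotopy_op_Ck L j : Ck Q j (homotopy_op L).
Proof.
have oQ : open Q by exact: open_cube.
apply: Ck_sum => // i _; apply: CkM => //.
  exact: (CkD oQ (Ck_coord j (lshift q i) oQ) (Ck_cst oQ j _)).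
exact: leaf_mean_Ck.
Qed.

(** The derivative falls on the coefficients of the Euler field or on the
    mean. *)
Lemma homotopy_op_derive L (i : 'I_p) z : Q z ->
  'D_(basis_vec R (lshift q i)) (homotopy_op L) z =
  leaf_mean p z0 r (f (fcons (inB i) L)) z +
  \sum_(j < p) (z 0 (lshift q j) - z0 0 (lshift q j)) *
    leaf_mean p z0 r.+1 ('D_(basis_vec R (lshift q i)) (f (fcons (inB j) L))) z.
Proof.
move=> Qz; set v := basis_vec R (lshift q i).
have E : homotopy_op L = \sum_(j < p) ((fun z : 'rV[R]_(p + q) => z 0 (lshift q j) - z0 0 (lshift q j)) *
    leaf_mean p z0 r (f (fcons (inB j) L))).
  by apply/funext => y; rewrite fct_sumE.
have D1 (j : 'I_p) : is_derive z v (fun z : 'rV[R]_(p + q) => z 0 (lshift q j) - z0 0 (lshift q j))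
    (j == i)%:R.
  have H : is_derive z v (fun z : 'rV[R]_(p + q) => z 0 (lshift q j)) (j == i)%:R.
    apply: DeriveDef; first exact/diff_derivable/differentiable_coord.
    by rewrite derive_coord /v mxE eqxx (inj_eq (@lshift_inj _ _)).
  have := @is_deriveB _ _ _ _ _ z v _ _ H (is_derive_cst (z0 0 (lshift q j)) z v).
  by rewrite subr0.
have D2 (j : 'I_p) : is_derive z v (leaf_mean p z0 r (f (fcons (inB j) L)))
    (leaf_mean p z0 r.+1 ('D_v (f (fcons (inB j) L))) z).
  have := @leaf_mean_derive _ _ p z0 d r _ z (lshift q i) (sf (fcons (inB j) L) 1%N) Qz.
  by rewrite /= ltn_ord addn1.
have D3 j := @is_deriveM _ _ _ _ z v _ _ (D1 j) (D2 j).
have D4 := is_derive_sum D3.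
rewrite E (@derive_val _ _ _ _ _ _ _ D4) big_split /= addrC; congr (_ + _).
rewrite (bigD1 i) //= eqxx [_ *: 1]mulr1 big1 ?addr0 // => j ji.
by rewrite (negbTE ji) [_ *: 0]mulr0.
Qed.

Hypothesis front : forall (L : 'I_k.+1 -> 'I_m) (i : 'I_k.+1) z, Q z ->
  f (fcons (L i) (L \o lift i)) z = (-1) ^+ i * f L z.

Lemma frame_vec_cont (l : 'I_m) L z : Q z ->
  {for z, continuous ('D_(frame_vec l) (f L))}.
Proof.
move=> Qz; have [lt|ge] := ltnP l (p + q).
  rewrite (@frame_vecE l (Ordinal lt)) //.
  by have [_ [_ H]] := sf L 1%N; have [c _] := H (Ordinal lt); exact: c.
have -> : frame_vec l = 0.
  apply/rowP => j; rewrite !mxE ltn_eqF //; exact: leq_trans ge.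
have -> : 'D_0 (f L) = cst 0 by apply/funext => y; rewrite derive0.
exact: cst_continuous.
Qed.

(** Each of the r + 1 leafwise slots contributes one mean of f L, by the first
    term of homotopy_op_derive. By closedness the remaining terms add up to
    the mean of the Euler derivative of f L, and leaf_mean_euler concludes. *)
Lemma flat_homotopy (L : 'I_k.+1 -> 'I_m) z : Q z -> #|[set i | (L i < p)%N]%SET| = r.+1 ->
  (forall (j : 'I_p) z, Q z -> 'D_(basis_vec R (lshift q j)) (f L) z +
    \sum_(i | (L i < p)%N) (-1) ^+ i.+1 *
      'D_(frame_vec (L i)) (f (fcons (inB j) (L \o lift i))) z = 0) ->
  \sum_(i | (L i < p)%N) (-1) ^+ i * 'D_(frame_vec (L i)) (homotopy_op (L \o lift i)) z
  = f L z.
Proof.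
move=> Qz cL closed.
pose X (j : 'I_p) := z 0 (lshift q j) - z0 0 (lshift q j).
have fst i : (L i < p)%N ->
    (-1) ^+ i * 'D_(frame_vec (L i)) (homotopy_op (L \o lift i)) z =
    leaf_mean p z0 r (f L) z + \sum_(j < p) X j * ((-1) ^+ i *
      leaf_mean p z0 r.+1 ('D_(frame_vec (L i)) (f (fcons (inB j) (L \o lift i)))) z).
  move=> Li; pose i' := Ordinal Li.
  have Ei : L i = inB i' by apply: val_inj.
  rewrite Ei frame_vec_widen homotopy_op_derive // -Ei mulrDr; congr (_ + _).
    rewrite (@eq_leaf_mean _ _ p z0 d r _ ( fun z => (-1) ^+ i * f L z)) //; last first.
      by move=> y Qy; exact: front.
    rewrite (@leaf_meanZ _ _ p z0 d r _ (f L) z (@cf L) Qz).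
    by rewrite mulrA -exprD addnn -mul2n exprM sqrrN expr1n expr1n mul1r.
  by rewrite mulr_sumr; apply: eq_bigr => j _; rewrite mulrCA.
rewrite (eq_bigr _ fst) big_split /= sumr_const.
have -> : #|[pred i | (L i < p)%N]| = r.+1 by rewrite -cL cardsE.
rewrite exchange_big /= -mulr_natl.
rewrite -[RHS](leaf_mean_euler p r (sf L 1%N) Qz); congr (_ + _).
rewrite big_split_ord /= [X in _ = _ + X]big1 ?addr0; last first.
  by move=> j; rewrite /= ltnNge leq_addr.
rewrite [RHS](eq_bigl xpredT) => [|j]; last by rewrite /= ltn_ord.
apply: eq_bigr => j _; rewrite -mulr_sumr; congr (_ * _).
rewrite -(@leaf_mean_sum _ _ p z0 d r.+1 _ _ _ (fun i : 'I_k.+1 => (-1) ^+ i)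
  (fun i => 'D_(frame_vec (L i)) (f (fcons (inB j) (L \o lift i)))) z) //; last first.
  by move=> i y Qy; exact: frame_vec_cont.
apply: (@eq_leaf_mean _ _ p z0 d) => // y Qy.
have := closed j y Qy => /eqP; rewrite addr_eq0 => /eqP ->.
rewrite -sumrN; apply: eq_bigr => i _.
by rewrite exprS mulN1r mulNr opprK.
Qed.

End FlatHomotopy.

(** * The differential in an adapted frame *)

Section FrameDifferential.
Variables (R : realType) (p q : nat) (M : manifold R (p + q)).
Variables (m : nat) (A : lie_algebroid M m) (B C : forall x : M, {vspace A x}).
Variables (c : chart R M (p + q)) (V : set M) (oV : open V).
Variables (e : 'I_m -> section A) (af : adapted_frame B C c V e).

Definition transverse_slots k (L : 'I_k -> 'I_m) : {set 'I_k} :=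
  [set i | (p <= L i)%N]%SET.

Lemma card_leaf_slots k (L : 'I_k -> 'I_m) :
  #|[set i | (L i < p)%N]%SET| = (k - #|transverse_slots L|)%N.
Proof.
have -> : [set i | (L i < p)%N]%SET = ~: transverse_slots L.
  by apply/setP => i; rewrite !inE ltnNge.
by rewrite cardsCs finset.setCK card_ord.
Qed.

Lemma frame_vanish k u r x (w : ('I_k -> A x) -> R) (L : 'I_k -> 'I_m) :
  bigraded_form (B x) (C x) u r w -> #|transverse_slots L| != u ->
  w (fun i => e (L i) x) = 0.
Proof.
move=> bw; rewrite neq_ltn => /orP[lt|gt].
  apply: (bigraded_vanish_B (T := [set i | (L i < p)%N]%SET) bw).
    rewrite card_leaf_slots.
    have : (#|transverse_slots L| <= k)%N by rewrite -[leqRHS](card_ord k) max_card.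
    have [kE _] := bw; lia.
  by move=> j; rewrite inE => /(af_B af x).
apply: (bigraded_vanish_C (T := transverse_slots L) bw gt).
by move=> j; rewrite inE => /(af_C af x).
Qed.

(** A bracket of frame sections loses an argument in C: it is 0 if both
    sections are in B, lies in B if one of them is, and replaces two arguments
    in C by a single one otherwise. The arguments left in B are then too many
    for the type. *)
Lemma frame_bracket_vanish k u r x (w : ('I_k -> A x) -> R) (L : 'I_k.+1 -> 'I_m)
    (i j : 'I_k.+1) : V x -> alternating_form w ->
  bigraded_form (B x) (C x) u r w -> #|transverse_slots L| = u -> (i < j)%N ->
  w (rest_args (bracket (e (L i)) (e (L j)) x) (fun h => e (L h) x) i j) = 0.
Proof.
move=> Vx aw bw cL ij; have [kE _] := bw.
(* The slots of the remaining arguments that are in C. *)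
pose N : {set 'I_k} := [set t : 'I_k | (t != 0%N :> nat) &&
  (p <= L (@inord k (bump j (bump i t.-1))))%N]%SET.
pose D := transverse_slots L :\ i :\ j.
have cN : (#|N| <= #|D|)%N.
  rewrite -(card_in_imset (f := fun t : 'I_k => @inord k (bump j (bump i t.-1))) (D := mem N)).
    apply: subset_leq_card; apply/fintype.subsetP => h /imsetP[t].
    rewrite !inE => /andP[t0 pt] ->; have [_ [ni nj]] := rest_index ij t0.
    by rewrite ni nj.
  move=> t t'; rewrite !inE => /andP[t0 _] /andP[t'0 _].
  move=> /(congr1 (fun z : 'I__ => z : nat)).
  have [-> _] := rest_index ij t0; have [-> _] := rest_index ij t'0.
  move=> /(can_inj (bumpK _)) /(can_inj (bumpK _)) H; apply: val_inj => /=.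
  by rewrite -(prednK (n := t)) ?lt0n // H prednK ?lt0n.
have notN (t : 'I_k) : t != 0%N :> nat -> t \notin N ->
    e (L (@inord k (bump j (bump i t.-1)))) x \in B x.
  by rewrite !inE => -> /=; rewrite -ltnNge => /(af_B af x).
have cD : (#|D| + (p <= L i) + (p <= L j) = u)%N.
  have ji : j != i by rewrite -(inj_eq val_inj) /= gtn_eqF.
  rewrite -cL (cardsD1 i (transverse_slots L)) (cardsD1 j (transverse_slots L :\ i)).
  rewrite /D !inE ji /=.
  by rewrite addnAC addnC; congr (_ + _)%N; rewrite addnC.
have cNk : (#|N| <= k)%N by rewrite -[leqRHS](card_ord k) max_card.
have cC : (#|~: N| = k - #|N|)%N by rewrite cardsCs finset.setCK card_ord.
have inBcase : bracket (e (L i)) (e (L j)) x \in B x -> (#|D| < u)%N ->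
    w (rest_args (bracket (e (L i)) (e (L j)) x) (fun h => e (L h) x) i j) = 0.
  move=> bB Du; apply: (bigraded_vanish_B (T := ~: N) bw); first by rewrite cC; lia.
  move=> t tN; rewrite /rest_args; case: ifPn => // t0; apply: notN => //.
  by move: tN; rewrite finset.in_setC.
have [Li|Li] := ltnP (L i) p; have [Lj|Lj] := ltnP (L j) p.
- rewrite (af_bracket_BB af Vx Li Lj).
  have := rest_args_linear aw 1 0 0 (fun h => e (L h) x) ij.
  rewrite scaler0 addr0 mul1r => /eqP.
  by rewrite -subr_eq subrr eq_sym => /eqP.
- apply: inBcase; first exact: (af_bracket_BC af Vx Li Lj).
  by move: cD; rewrite Lj /=; lia.
- apply: inBcase; last by move: cD; rewrite Li /=; lia.
  rewrite (bracket_antisym (af_smooth af _) (af_smooth af _)) memvN.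
  exact: (af_bracket_BC af Vx Lj Li).
- have k0 : (0 < k)%N by have := ltn_ord j; lia.
  apply: (bigraded_vanish_B (T := ~: N :\ Ordinal k0) bw).
    have H : (k - #|N| <= 1 + #|~: N :\ Ordinal k0|)%N.
      by rewrite -cC (cardsD1 (Ordinal k0) (~: N)) leq_add2r leq_b1.
    rewrite -ltnS -add1n; apply: (leq_trans _ H).
    have arith a b : (a <= b)%N -> (b + 1 + 1 = u)%N -> (1 + r.+1 <= k - a)%N.
      by rewrite kE; lia.
    by apply: (arith _ _ cN); rewrite -cD Li Lj.
  move=> t; rewrite finset.in_setD1 finset.in_setC => /andP[t0 tN]; rewrite /rest_args.
  have t0' : t != 0%N :> nat by move: t0; rewrite -(inj_eq val_inj).
  by rewrite (negbTE t0'); exact: notN.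
Qed.

(** The reason for using adapted frames: on components, the part of type (0,1)
    of the differential is the exterior derivative along the leaves, with the
    transverse indices as parameters. Brackets contribute nothing, and an
    anchor term that differentiates along C is applied to a function that
    vanishes near x, since one argument in C is missing from the form. *)
Lemma dA_frame k u r (w : aform A k) (L : 'I_k.+1 -> 'I_m) x :
  aform_of_type B C u r V w -> V x -> #|transverse_slots L| = u ->
  dA w (fun i => e (L i)) x =
  \sum_(i | (L i < p)%N) (-1) ^+ i * 'D_(frame_vec R p q (L i))
    (fun z => w (cinv c z) (fun l => e (L (lift i l)) (cinv c z))) (cmap c x).
Proof.
move=> [aw bw] Vx cL; rewrite /dA [X in _ + X]big1 ?addr0; last first.
  move=> i _; apply: big1 => j ij; rewrite /eval_form bracket_args_at.
  by rewrite (frame_bracket_vanish Vx (aw.1 x Vx) (bw x Vx) cL ij) mulr0.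
rewrite (bigID (fun i => (L i < p)%N)) /= [X in _ + X]big1 ?addr0; last first.
  move=> i Li; rewrite /anchor_der (@tder_near _ _ _ x _ _ (fun=> 0)) ?tder_cst ?mulr0 //.
  apply: filterS (open_nbhs_nbhs (conj oV Vx)) => y Vy.
  apply: (frame_vanish (L := fun l => L (lift i l)) (bw y Vy)).
  rewrite -leqNgt in Li.
  have : transverse_slots L :\ i = [set lift i l | l in transverse_slots (fun l => L (lift i l))]%SET.
    apply/setP => h; rewrite !inE; apply/andP/imsetP => [[hi ph]|[l]].
      case: (unliftP i h) => [l hl|hE]; last by rewrite hE eqxx in hi.
      by exists l => //; rewrite inE -hl.
    by rewrite inE => pl ->; rewrite eq_sym neq_lift.
  move=> /(congr1 (fun S : {set _} => #|S|)); rewrite card_imset; last exact: lift_inj.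
  move=> <-; rewrite -cL [X in _ != X](cardsD1 i) inE Li /=.
  by rewrite add1n neq_ltn ltnSn.
apply: eq_bigr => i Li.
have lt : (L i < p + q)%N by rewrite (leq_trans Li) // leq_addr.
rewrite (@frame_vecE _ p q m (L i) (Ordinal lt)) //.
rewrite (af_anchor af (l := Ordinal lt) Li _ Vx oV Vx) //.
exact: (smooth_eval_form oV aw (fun l => af_smooth af _)).
Qed.

End FrameDifferential.

Lemma transverse_slots_fcons p m k (l : 'I_m) (L : 'I_k -> 'I_m) : (l < p)%N ->
  #|transverse_slots p (fcons l L)| = #|transverse_slots p L|.
Proof.
move=> lp; rewrite -(card_imset (mem (transverse_slots p L)) (@lift_inj _ ord0)).
apply: eq_card => h; apply/idP/imsetP => [|[t]].
  rewrite inE; case: (unliftP ord0 h) => [t ->|->].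
    by rewrite fconsS => pt; exists t; rewrite ?inE.
  by rewrite fcons0 leqNgt lp.
by rewrite inE => pt ->; rewrite inE fconsS.
Qed.

Section FrameComponents.
Variables (R : realType) (p q : nat) (M : manifold R (p + q)).
Variables (m : nat) (A : lie_algebroid M m) (B C : forall x : M, {vspace A x}).
Hypothesis hC : bundle_decomposition B C.
Variables (c : chart R M (p + q)) (cc : compatible c) (x0 : M) (d : R).
Let z0 := cmap c x0.
Let V := chart_cube c x0 d.
Hypotheses (Qc : cube z0 d `<=` ccod c) (oV : open V).
Variables (e : 'I_m -> section A) (af : adapted_frame B C c V e).
Let Q := cube z0 d.

Definition frame_component k (w : aform A k) (L : 'I_k -> 'I_m)
    (z : 'rV[R]_(p + q)) : R :=
  w (cinv c z) (fun i => e (L i) (cinv c z)).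

Lemma chart_cube_inv z : Q z -> V (cinv c z).
Proof.
by move=> Qz; split; [exact: cinv_dom (Qc Qz)|rewrite /= cinvK //; exact: Qc].
Qed.

Lemma frame_component_Ck k (w : aform A k) L j : aform_on V w ->
  Ck Q j (frame_component w L).
Proof.
move=> hw; have sw := smooth_eval_form oV hw (fun l => af_smooth af (L l)).
have /smooth_euclP/(_ j) := smooth_in_chart cc oV sw.
apply: Ck_sub => z Qz; split; [exact: Qc|exact: chart_cube_inv].
Qed.

Lemma frame_component_near k (w : aform A k) (L : 'I_k -> 'I_m) g (v z : 'rV[R]_(p + q)) :
  (forall z, Q z -> frame_component w L z = g z) -> Q z ->
  'D_v (frame_component w L) z = 'D_v g z.
Proof.
move=> wg Qz; apply: near_eq_derive.
by apply: filterS wg _; apply: open_nbhs_nbhs; split=> //; exact: open_cube.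
Qed.

(** The values at x of a tensorial operator are determined by those on frame
    tuples, through the multilinear expansion of the arguments at x. *)
Lemma tensorial_frame_eq k (W W' : ('I_k -> section A) -> M -> R) x : V x ->
  tensorial_at W x -> tensorial_at W' x ->
  (forall L : 'I_k -> 'I_m, W (fun i => e (L i)) x = W' (fun i => e (L i)) x) ->
  forall a, smooth_args a -> W a x = W' a x.
Proof.
move=> Vx tW tW' WW' a sa; have bx := af_basis af Vx.
pose th l v := coord [tuple e l x | l < m] l (v : A x).
pose lift_sec (v : A x) : section A := fun y => \sum_l th l v *: e l y.
have s_cst (t : R) : smooth_fun setT (fun _ : M => t) := smooth_fun_cst t openT.
have sl v : smooth_section setT (lift_sec v).
  apply: (smooth_section_sum _ openT) => l _.
  exact: (smooth_sectionZ openT (s_cst _) (af_smooth af l)).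
have lx v : lift_sec v x = v by rewrite [RHS](basis_coord v bx).
have sla (v : 'I_k -> A x) : smooth_args (fun i => lift_sec (v i)) by move=> i; exact: sl.
have mlin (W0 : ('I_k -> section A) -> M -> R) : tensorial_at W0 x ->
    forall (v : 'I_k -> A x) (i : 'I_k) (t : R) (b b' : A x),
    W0 (fun j => lift_sec (set_arg v i (t *: b + b') j)) x =
    t * W0 (fun j => lift_sec (set_arg v i b j)) x +
    W0 (fun j => lift_sec (set_arg v i b' j)) x.
  move=> tW0 v i t b b'.
  have E z : (fun j => lift_sec (set_arg v i z j)) =
      set_arg (fun j => lift_sec (v j)) i (lift_sec z).
    by apply/funext => j; rewrite /set_arg; case: eqP.
  rewrite !E -(tW0 _ i (fun=> t) _ _ (sla v) (s_cst t) (sl b) (sl b')).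
  apply: (tensorial_pointwise tW0).
  - exact: (smooth_set_arg i (sla v) (sl _)).
  - apply: (smooth_set_arg i (sla v)).
    exact: (smooth_combine (s_cst t) (sl b) (sl b')).
  - by move=> j; rewrite /set_arg; case: eqP => // _; rewrite !lx.
have ax (W0 : ('I_k -> section A) -> M -> R) : tensorial_at W0 x ->
    W0 a x = W0 (fun i => lift_sec (a i x)) x.
  move=> tW0; apply: (tensorial_pointwise tW0 sa (sla (fun i => a i x))).
  by move=> i; rewrite lx.
have exp (W0 : ('I_k -> section A) -> M -> R) : tensorial_at W0 x ->
    W0 a x = \sum_(L : {ffun 'I_k -> 'I_m}) (\prod_i th (L i) (a i x)) *
      W0 (fun i => e (L i)) x.
  move=> tW0; rewrite ax //.
  rewrite (mlin_expand (w := fun v => W0 (fun i => lift_sec (v i)) x) (mlin _ tW0)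
    (e := fun l => e l x) (theta := th)); last first.
    by move=> i; exact: basis_coord bx.
  apply: eq_bigr => L _; congr (_ * _).
  apply: (tensorial_pointwise tW0).
  - by move=> i; exact: sl.
  - by move=> i; exact: (af_smooth af).
  - by move=> i; rewrite lx.
rewrite (exp _ tW) (exp _ tW'); apply: eq_bigr => L _; by rewrite WW'.
Qed.

Lemma proj_frame b l : proj_section B C b (e l) =
  if b == (p <= l)%N then e l else (fun x => 0).
Proof.
have cap x := decomposition_cap hC x.
have cap' x : (C x :&: B x = 0)%VS by rewrite capvC.
apply: functional_extensionality_dep => x; rewrite /proj_section.
have [lp|pl] := ltnP l p.
  have eB := af_B af x lp; case: b => /=; last by rewrite daddv_pi_id.
  by rewrite -[e l x]add0r daddv_pi_sum // mem0v.
have eC := af_C af x pl; case: b => /=; first by rewrite daddv_pi_id.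
by rewrite -[e l x]add0r daddv_pi_sum // mem0v.
Qed.

Lemma tensorial_zero_arg k (W : ('I_k -> section A) -> M -> R) x a i :
  tensorial_at W x -> smooth_args a -> a i = (fun x => 0) -> W a x = 0.
Proof.
move=> tW sa ai; have s0 : smooth_section setT (fun x => 0 : A x) := smooth_section0 openT.
have := tW a i (fun=> 1) _ _ sa (smooth_fun_cst 1 openT) s0 s0.
have -> : (fun y => 1 *: 0 + 0) = (fun y => 0 : A y).
  by apply: functional_extensionality_dep => y; rewrite scaler0 addr0.
rewrite mul1r -ai set_arg_id => /eqP.
by rewrite -subr_eq subrr eq_sym => /eqP.
Qed.

(** The projections fix or annihilate the sections of an adapted frame, so
    that a single choice of the arguments in C contributes to the component of
    type u. *)
Lemma d2A_frame k u (w : aform A k) x (L : 'I_k.+1 -> 'I_m) : aform_on V w -> V x ->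
  d2A B C u w (fun i => e (L i)) x =
  if #|transverse_slots p L| == u then dA w (fun i => e (L i)) x else 0.
Proof.
move=> hw Vx; rewrite /d2A /type_component.
have tw := tensorial_dA oV hw Vx.
have other (S : {set 'I_k.+1}) : S != transverse_slots p L ->
    dA w (fun i => proj_section B C (i \in S) (e (L i))) x = 0.
  move=> SL; have /existsP[i iS] : [exists i, (i \in S) != (p <= L i)%N].
    apply: contraR SL; rewrite negb_exists => /forallP H; apply/eqP/setP => i.
    by rewrite inE; apply/eqP; have := H i; rewrite negbK.
  apply: (tensorial_zero_arg (i := i) tw).
    by move=> j; apply: (smooth_proj_section hC _ openT); exact: (af_smooth af).
  by rewrite proj_frame (negbTE iS).
have same : dA w (fun i => proj_section B C (i \in transverse_slots p L) (e (L i))) x =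
    dA w (fun i => e (L i)) x.
  by congr (dA w _ x); apply/funext => i; rewrite proj_frame inE eqxx.
case: ifPn => [cL|cL].
  rewrite (bigD1 (transverse_slots p L)) //= same big1 ?addr0 //.
  by move=> S /andP[_ /other].
apply: big1 => S cS; apply: other; apply: contra cL => /eqP <-.
exact: cS.
Qed.

End FrameComponents.

(** * The primitive *)

Section PrimitiveForm.
Variables (R : realType) (p q : nat) (M : manifold R (p + q)).
Variables (m : nat) (A : lie_algebroid M m) (B C : forall x : M, {vspace A x}).
Hypothesis hC : bundle_decomposition B C.
Variables (c : chart R M (p + q)) (cc : compatible c) (x0 : M) (d : R).
Let z0 := cmap c x0.
Let V := chart_cube c x0 d.
Hypotheses (Qc : cube z0 d `<=` ccod c) (oV : open V).
Variables (e : 'I_m -> section A) (af : adapted_frame B C c V e).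
Hypothesis pm : (p <= m)%N.
Let Q := cube z0 d.
Variables (k u r : nat) (lambda : aform A k.+1).
Hypothesis hl : aform_of_type B C u r.+1 V lambda.

Let f := frame_component c e lambda.
Let h := homotopy_op pm z0 r f.

Definition dual_frame (x : M) (l : 'I_m) : 'Hom(A x, R^o) :=
  linfun (coord [tuple e i x | i < m] l : A x -> R^o).

Lemma dual_frameE x l (w : A x) :
  dual_frame x l w = coord [tuple e i x | i < m] l w.
Proof. by rewrite lfunE. Qed.

(** The tensor with components h L in the frame. As h L is antisymmetric in L,
    the sum over all tuples defines an alternating form. *)
Definition primitive_form : aform A k := fun x w =>
  \sum_(L : {ffun 'I_k -> 'I_m})
    (\prod_i dual_frame x (L i) (w i)) * h L (cmap c x).

Let lQ z : Q z -> V (cinv c z). Proof. exact: chart_cube_inv. Qed.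

Lemma component_Ck L j : Ck Q j (f L).
Proof. exact: (frame_component_Ck cc Qc oV af _ _ hl.1). Qed.

Let cf L z : Q z -> {for z, continuous (f L)}.
Proof. by have [H _] := component_Ck L 0%N; exact: H. Qed.

Lemma component_front (L : 'I_k.+1 -> 'I_m) (i : 'I_k.+1) z : Q z ->
  f (fcons (L i) (L \o lift i)) z = (-1) ^+ i * f L z.
Proof.
move=> Qz; rewrite /f /frame_component.
rewrite -(alt_front (fun j => e (L j) (cinv c z)) i (hl.1.1 _ (lQ Qz))).
congr (@lambda _ _); apply/funext => t.
by case: (unliftP ord0 t) => [t' ->|->]; rewrite ?fconsS ?fcons0.
Qed.

Lemma primitive_swap (L : 'I_k -> 'I_m) i j z : Q z -> i != j ->
  h (L \o tperm i j) z = - h L z.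
Proof.
move=> Qz ij; rewrite /h /homotopy_op -sumrN; apply: eq_bigr => l _.
rewrite -mulrN; congr (_ * _); rewrite -mulN1r.
rewrite -(@leaf_meanZ _ _ p z0 d r (-1) _ z) //; last by move=> y; exact: cf.
apply: (@eq_leaf_mean _ _ p z0 d) => // y Qy; rewrite mulN1r.
have ij' : lift ord0 i != lift ord0 j by rewrite (inj_eq (@lift_inj _ ord0)).
rewrite /f /frame_component -(alt_swap (hl.1.1 _ (lQ Qy)) _ ij').
congr (@lambda _ _); apply/funext => t /=.
apply: (congr1 (fun a => e a (cinv c y))).
case: (unliftP ord0 t) => [t' ->|->].
  rewrite fconsS /= -(@fconsS _ _ (widen_ord pm l) L); congr fcons.
  case: tpermP => [->|->|/eqP n1 /eqP n2]; rewrite ?tpermL ?tpermR //.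
  by rewrite tpermD // eq_sym (inj_eq (@lift_inj _ ord0)).
by rewrite tpermD ?fcons0 // eq_sym neq_lift.
Qed.

Lemma primitive_vanish (L : 'I_k -> 'I_m) z : Q z -> #|transverse_slots p L| != u ->
  h L z = 0.
Proof.
move=> Qz nL; rewrite /h /homotopy_op big1 // => l _.
set L' := fcons _ L.
rewrite (@eq_leaf_mean _ _ p z0 d r _ (fun y => 0 * f L' y)) //; last first.
  move=> y Qy; rewrite mul0r /f /frame_component; apply: (frame_vanish af (L := L') (hl.2 _ (lQ Qy))).
  by rewrite transverse_slots_fcons //= ltn_ord.
rewrite (@leaf_meanZ _ _ p z0 d r 0 _ z) //; last by move=> y; exact: cf.
by rewrite mul0r mulr0.
Qed.

Lemma primitive_form_frame (L : 'I_k -> 'I_m) x : V x ->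
  primitive_form (fun i => e (L i) x) = h L (cmap c x).
Proof.
move=> Vx; have /andP[_ fx] := af_basis af Vx.
have dE l l' : dual_frame x l (e l' x) = (l == l')%:R.
  rewrite dual_frameE.
  have := coord_basis_sum (fun i => (i == l')%:R) l fx.
  rewrite (bigD1 l') //= eqxx scale1r big1 ?addr0 // => i /negbTE ->.
  by rewrite scale0r.
rewrite /primitive_form (bigD1 [ffun i => L i]) //= [X in _ + X]big1 ?addr0.
  rewrite big1 ?mul1r; last by move=> i _; rewrite dE ffunE eqxx.
  by congr (h _ _); apply/funext => i; rewrite ffunE.
move=> L' nL; have /existsP[i iL] : [exists i, L' i != L i].
  apply: contraR nL; rewrite negb_exists => /forallP H; apply/eqP/ffunP => i.
  by rewrite ffunE; apply/eqP; have := H i; rewrite negbK.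
by rewrite (bigD1 i) //= dE (negbTE iL) !mul0r.
Qed.

Lemma primitive_form_on : aform_on V primitive_form.
Proof.
split=> [x [cx Vx]|W a oW WV sa].
  apply: (antisym_array_alternating (a := fun L => h L (cmap c x)) (dual_frame x)).
  by move=> L i j ij; exact: primitive_swap.
apply: smooth_fun_sum => // L _; apply: smooth_funM => //.
  apply: smooth_fun_prod => // i _.
  apply: (smooth_fun_ext oW (f := fun x => coord [tuple e l x | l < m] (L i) (a i x))).
    by move=> x _; rewrite dual_frameE.
  apply: (smooth_frame_coord oW _ _ (sa i)).
    by move=> l; apply: smooth_section_sub (af_smooth af l).
  by move=> x /WV; exact: (af_basis af).
apply: (smooth_fun_chart cc oW); first by move=> x /WV[].
apply/smooth_euclP => j.
have oP := @open_pullback _ _ _ c _ oW.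
apply: (Ck_ext oP (f := h L)); first by move=> z [cz _]; rewrite cinvK.
have := homotopy_op_Ck pm (z0 := z0) (d := d) r component_Ck L j.
apply: Ck_sub => z [cz /WV[_]].
by rewrite /= cinvK.
Qed.

Lemma primitive_form_type : aform_of_type B C u r V primitive_form.
Proof.
split=> [|x Vx]; first exact: primitive_form_on.
have [kE _] := hl.2 x Vx; have bx := af_basis af Vx.
have dual0 (D D' : {vspace A x}) (P : pred 'I_m) l w : (D :&: D' = 0)%VS ->
    (forall j, P j -> e j x \in D) -> (forall j, ~~ P j -> e j x \in D') ->
    ~~ P l -> w \in D -> dual_frame x l w = 0.
  move=> DD' eD eD' Pl wD; rewrite dual_frameE.
  (* The component of w along D; w minus it is in both D and its complement. *)
  pose w' := \sum_j (if P j then coord [tuple e i x | i < m] j w else 0) *: e j x.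
  suff -> : w = w' by rewrite (coord_basis_sum _ l (andP bx).2) (negbTE Pl).
  have w'D : w' \in D.
    apply: memv_suml => j _; case: ifP => Pj; last by rewrite scale0r mem0v.
    by apply: memvZ; exact: eD.
  apply/eqP; rewrite -subr_eq0 -memv0 -DD' memv_cap memvB //=.
  rewrite {1}(basis_coord w bx) -sumrB; apply: memv_suml => j _.
  rewrite -scalerBl; case: ifP => Pj; first by rewrite subrr scale0r mem0v.
  by apply: memvZ; apply: eD'; rewrite Pj.
apply: (bigraded_of_basis (e := fun l => e l x) (theta := dual_frame x)
  (isB := fun l => (l < p)%N)).
- exact: primitive_form_on.1.
- by rewrite addnS in kE; case: kE.
- by move=> w; rewrite {1}(basis_coord w bx); apply: eq_bigr => l _; rewrite dual_frameE.
- move=> l w lp wB; apply: (dual0 (B x) (C x) (fun j => (j < p)%N)) => //.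
  + exact: decomposition_cap.
  + by move=> j; exact: (af_B af).
  + by move=> j; rewrite -leqNgt; exact: (af_C af).
- move=> l w lp wC; apply: (dual0 (C x) (B x) (fun j => (p <= j)%N)) => //.
  + by rewrite capvC decomposition_cap.
  + by move=> j; exact: (af_C af).
  + by move=> j; rewrite -ltnNge; exact: (af_B af).
  + by rewrite -ltnNge.
- move=> L nL; rewrite primitive_form_frame //; apply: primitive_vanish.
    by case: Vx.
  apply: contra nL => /eqP <-; apply/eqP/eq_card => i; by rewrite !inE -leqNgt.
Qed.

Hypothesis hclosed : eq_forms_on V (d2A B C u lambda) (fun _ _ => 0).

(** The equation satisfied by lambda on the frame tuple that starts with a
    leafwise section of index j and continues with L. *)
Lemma component_closed (L : 'I_k.+1 -> 'I_m) (j : 'I_p) z : Q z ->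
  #|transverse_slots p L| = u ->
  'D_(basis_vec R (lshift q j)) (f L) z +
    \sum_(i | (L i < p)%N) (-1) ^+ i.+1 *
      'D_(frame_vec R p q (L i)) (f (fcons (widen_ord pm j) (L \o lift i))) z = 0.
Proof.
move=> Qz cL; set l := widen_ord pm j; pose L' := fcons l L.
have lp : (l < p)%N by rewrite /= ltn_ord.
have cL' : #|transverse_slots p L'| = u by rewrite transverse_slots_fcons.
have Vz := lQ Qz.
have := hclosed (a := fun i => e (L' i)) (fun i => af_smooth af _) Vz.
rewrite (d2A_frame hC oV af _ L' hl.1 Vz) cL' eqxx (dA_frame oV af hl Vz cL').
rewrite big_mkcond big_ord_recl /L' fcons0 lp expr0 mul1r cinvK; last exact: Qc.
move=> H; rewrite -[RHS]H; congr (_ + _).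
  rewrite frame_vec_widen; apply: (congr1 (fun g => 'D_(basis_vec R (lshift q j)) g z)).
  by apply/funext => y; rewrite /f /frame_component; congr (@lambda _ _);
    apply/funext => t; rewrite fconsS.
rewrite [LHS]big_mkcond; apply: eq_bigr => i _; rewrite fconsS; case: ifP => // _.
congr (_ * _); apply: (congr1 (fun g => 'D_(frame_vec R p q (L i)) g z)).
by apply/funext => y; rewrite -fcons_lift.
Qed.

Lemma d2A_primitive : eq_forms_on V (eval_form lambda) (d2A B C u primitive_form).
Proof.
move=> a sa x Vx; have [cx Qx] := Vx.
have [kE _] := hl.2 x Vx.
apply: (tensorial_frame_eq af Vx (tensorial_eval_form hl.1 Vx)) => // [|L].
  apply: tensorial_type_component => //.
  exact: (tensorial_dA oV primitive_form_on Vx).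
rewrite (d2A_frame hC oV af _ L primitive_form_on Vx).
case: eqP => [cL|/eqP cL]; last exact: (frame_vanish af (L := L) (hl.2 x Vx)).
rewrite (dA_frame oV af primitive_form_type Vx cL).
transitivity (f L (cmap c x)).
  by rewrite /f /frame_component cmapK.
rewrite -(@flat_homotopy _ p q m pm z0 d r k f component_Ck _ L _ Qx) //.
- apply: eq_bigr => i Li; congr (_ * _); apply/esym.
  apply: (frame_component_near (w := primitive_form) (L := L \o lift i) (x0 := x0) (d := d)) => // z Qz.
  rewrite /frame_component (primitive_form_frame (L \o lift i) (lQ Qz)) cinvK //.
  exact: Qc.
- by move=> L0 i z; exact: component_front.
- rewrite card_leaf_slots cL kE; lia.
- by move=> j z Qz; exact: component_closed.
Qed.

End PrimitiveForm.

Theorem proposition4p1 (R : realType) (p q : nat) (M : manifold R (p + q))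
    (F : foliation M) (m : nat) (A : lie_algebroid M m)
    (B C : forall x : M, {vspace A x})
    (hB : minimally_foliated F B) (hC : bundle_decomposition B C)
    (u v k : nat) (x0 : M) (U : set M) (lambda : aform A k.+1)
    (hU : open U) (hx0 : U x0) (hv : (0 < v)%N)
    (hlambda : aform_of_type B C u v U lambda)
    (hclosed : eq_forms_on U (d2A B C u lambda) (fun _ _ => 0%R)) :
  exists (V : set M) (mu : aform A k),
    [/\ open V, V x0, V `<=` U,
        aform_of_type B C u v.-1 V mu &
        eq_forms_on V (eval_form lambda) (d2A B C u mu)].
Proof.
have [c fc cx0] := fcharts_cover F x0.
have [d [e [d0 Qc oV VU [pm af]]]] := adapted_frame_exists hB hC fc cx0 hU hx0.
have cc := fchart_compatible fc.
have hl : aform_of_type B C u v.-1.+1 (chart_cube c x0 d) lambda.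
  rewrite prednK //; have [[a1 a2] bl] := hlambda.
  split=> [|x /VU]; last exact: bl.
  split=> [x /VU|W a oW WV]; first exact: a1.
  by apply: a2 => //; exact: subset_trans VU.
have hc : eq_forms_on (chart_cube c x0 d) (d2A B C u lambda) (fun _ _ => 0).
  by move=> a sa x /VU; exact: hclosed.
exists (chart_cube c x0 d), (primitive_form c x0 e pm v.-1 lambda); split=> //.
- by split=> //=; rewrite /cube /= subrr normr0.
- exact: (primitive_form_type hC cc Qc oV af).
- exact: (d2A_primitive hC cc Qc oV af).
Qed.
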